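(* Let $\lambda$ and $\gamma$ be partitions and let $\alpha=(\alpha_1,\ldots,\alpha_{\ell})$ be a composition. Then the coefficient of $\tilde s_{\gamma}$ in the expansion of $h_{\alpha_1}h_{\alpha_2}\cdots h_{\alpha_{\ell}}\,\tilde s_\lambda$ in the basis $\{\tilde s_\nu\}_\nu$ equals the number of tableaux $T\in\mathcal{MCT}_\gamma(\lambda,\alpha)$ that are lattice tableaux.
   Context: $h_k$ denotes the complete homogeneous symmetric function. For a partition $\mu\vdash n$, let $\Xi_\mu$ be the multiset of $n$ complex numbers consisting, for each part $\mu_i$, of all $\mu_i$-th roots of unity (the eigenvalues of a permutation matrix of cycle type $\mu$); $f[\Xi_\mu]$ denotes the evaluation of a symmetric function $f$ at these $n$ values (remaining variables set to $0$). For a partition $\lambda$, $\tilde s_\lambda$ is the symmetric function (irreducible character basis of Orellana–Zabrocki) characterized by $\tilde s_\lambda[\Xi_\mu]=\chi^{(n-|\lambda|,\lambda)}(\mu)$ for all $n\ge|\lambda|+\lambda_1$ and all $\mu\vdash n$, where $\chi^\nu$ is the irreducible $S_n$-character. The $\tilde s_\lambda$ form a basis of the ring of symmetric functions. Tableaux conventions: Young diagrams are in French notation (row 1 at the bottom; cell $(i,j)$ is in row $i$, column $j$). Labels use the totally ordered alphabet $\bar1<\bar2<\cdots<1<2<\cdots$. Multisets over this alphabet with at most one barred letter are ordered by reverse lexicographic order: for $M=\{m_1\le\cdots\le m_r\}$ and $N=\{n_1\le\cdots\le n_s\}$, compare $m_r$ with $n_s$, then $m_{r-1}$ with $n_{s-1}$,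 etc.; $M<N$ if at the first index $i$ where they differ $m_{r-i}<n_{s-i}$, or if all compared entries agree and $M$ runs out first ($r<s$). For a partition $\gamma$ and integer $r\ge\gamma_1$, the shape $(r,\gamma)/(\gamma_1)$ consists of cells $(1,j)$ for $\gamma_1<j\le r$ and cells $(i+1,j)$ for $i\ge1$, $1\le j\le\gamma_i$. For a partition $\lambda$ and composition $\alpha$, $\mathcal{MCT}_\gamma(\lambda,\alpha)$ is the set of fillings $T$ of a shape $(r,\gamma)/(\gamma_1)$, for some $r\ge\gamma_1$, of each cell by a nonempty multiset over the alphabet containing at most one barred letter, such that: labels weakly increase left to right along rows and strictly increase bottom to top along columns (in reverse lex order); the multiset union of all labels is $\{\bar1^{\lambda_1},\bar2^{\lambda_2},\ldots,1^{\alpha_1},2^{\alpha_2},\ldots\}$; and no cell of row 1 has a label consisting only of a barred letter. Reading order: cells are read from the bottom row to the top row, right to left within each row. For a multiset $S$ of unbarred letters, $read(T|_S)$ is the word of the barred letters $\bar j$, in reading order, of the cells whose label equals $\{\bar j\}\cup S$; $read(T|_-)$ is this word for $S=\emptyset$ (cells labeled exactly $\{\bar j\}$). Let $S_1<\cdots<S_d$ be the distinct nonempty multisets of unbarred letters occurring as the unbarred part of some label of $T$. $T$ is a lattice tableau if the word $read(T|_-)read(T|_{S_1})\cdots read(T|_{S_d})$, with $\bar j$ read as $j$, is a lattice word, i.e. in every prefix the number of occurrences of $j$ is at least the number of occurrences of $j+1$ for every $j\ge1$. *)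

(* Defs.v *)
From HB Require Import structures.
From mathcomp Require Import all_boot all_order all_fingroup all_algebra all_field all_character.
From mathcomp Require Import finmap.
From mathcomp Require Import mpoly.

Set Implicit Arguments.
Unset Strict Implicit.
Unset Printing Implicit Defensive.

Import GRing.Theory.
Local Open Scope ring_scope.

Definition is_part (s : seq nat) : bool := sorted geq s && (0%N \notin s).

Definition partition_type := {s : seq nat | is_part s}.

Definition part_size (s : seq nat) : nat := sumn s.
Definition first_part (s : seq nat) : nat := head 0%N s.

Definition conj_part (s : seq nat) : seq nat :=
  [seq count (fun x => j < x)%N s | j <- iota 0 (first_part s)].

(* The ring of symmetric functions over Q, as the inverse limit (in the graded *)
(* sense) of the rings of symmetric polynomials in n variables, along the maps *)
(* setting the last variable to 0.                                             *)

Definition restrict_last n (p : {mpoly rat[n.+1]}) : {mpoly rat[n]} :=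
  p \mPo [tuple if unlift ord_max i is Some j then 'X_j else 0 | i < n.+1].

Record symfun := SymFun {
  symfun_at :> forall n, {mpoly rat[n]};
  symfun_symmetric : forall n, symfun_at n \is symmetric;
  symfun_restrict : forall n, restrict_last (symfun_at n.+1) = symfun_at n;
  symfun_bounded : exists d : nat, forall n, (msize (symfun_at n) <= d)%N
}.

Definition hsym (k n : nat) : {mpoly rat[n]} :=
  \sum_(m : 'X_{1..n < k.+1} | mdeg m == k) 'X_[m].

(* 'X^m - 1 is separable over algC, so for m > 0 this lists every m-th root of *)
(* unity exactly once (see mem_roots_of_unity and uniq_roots_of_unity below).  *)
Definition roots_of_unity (m : nat) : seq algC :=
  sval (closed_field_poly_normal ('X^m - 1 : {poly algC})).

Lemma roots_of_unityE m : (0 < m)%N ->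
  'X^m - 1 = \prod_(z <- roots_of_unity m) ('X - z%:P).
Proof.
move=> m_gt0; rewrite /roots_of_unity; case: closed_field_poly_normal => r /= E.
by rewrite {1}E (eqP (monicXnsubC 1 m_gt0)) scale1r.
Qed.

Lemma mem_roots_of_unity m z : (0 < m)%N ->
  (z \in roots_of_unity m) = (z ^+ m == 1).
Proof.
move=> m_gt0; rewrite -root_prod_XsubC -roots_of_unityE //.
by rewrite rootE !hornerE subr_eq0.
Qed.

Lemma uniq_roots_of_unity m : (0 < m)%N -> uniq (roots_of_unity m).
Proof.
move=> m_gt0; rewrite -separable_prod_XsubC -roots_of_unityE //.
by apply: separable_Xn_sub_1; rewrite Num.Theory.pnatr_eq0 -lt0n.
Qed.

Definition Xi (mu : seq nat) : seq algC :=
  flatten [seq roots_of_unity m | m <- mu].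

Lemma size_Xi mu : is_part mu -> size (Xi mu) = part_size mu.
Proof.
case/andP=> _ mu_pos; rewrite size_flatten /shape -map_comp /part_size.
congr sumn; rewrite -[RHS]map_id; apply/eq_in_map => m m_mu /=.
have m_gt0: (0 < m)%N by rewrite lt0n; apply: contraNneq mu_pos => <-.
apply: succn_inj; rewrite -(size_prod_XsubC _ id) -roots_of_unityE //.
by rewrite size_XnsubC.
Qed.

(* For a partition mu, size (Xi mu) = part_size mu, so evaluating the          *)
(* (part_size mu)-variable component puts the remaining variables to 0.        *)
Definition eval_Xi (f : symfun) (mu : seq nat) : algC :=
  mmap (ratr : rat -> algC) (fun i => nth 0 (Xi mu) i) (f (part_size mu)).

Definition cycle_type n (w : 'S_n) : seq nat :=
  sort geq [seq #|X| | X : {set 'I_n} <- enum (porbits w)].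

(* Permutations of 'I_n preserving the consecutive blocks of sizes a_0, a_1,.. *)
Definition young_set n (a : seq nat) : {set 'S_n} :=
  [set w : 'S_n | [forall i, reshape_index a (w i) == reshape_index a i]].

Lemma young_group_set n a : group_set (young_set n a).
Proof.
apply/group_setP; split=> [|u v]; first by rewrite inE; apply/forallP=> i; rewrite perm1.
rewrite !inE => /forallP hu /forallP hv; apply/forallP=> i.
by rewrite permM (eqP (hv _)) (eqP (hu _)).
Qed.

Canonical young n a : {group 'S_n} := Group (young_group_set n a).

Lemma sign_class_fun n :
  is_class_fun <<[set: 'S_n]>>%g [ffun w : 'S_n => (-1) ^+ (odd_perm w) : algC].
Proof.
by rewrite genGid; apply: intro_class_fun => [u v _ _ | u];
  rewrite ?odd_permJ ?in_setT.
Qed.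

Definition sign_cfun n : 'CF([set: 'S_n]) := Cfun 0 (sign_class_fun n).

(* The irreducible character chi^nu of S_n for a partition nu of n: the common *)
(* irreducible constituent of the trivial character induced from the Young     *)
(* subgroup S_nu and of the sign character induced from S_nu', nu' being the   *)
(* conjugate partition (the definition of James and Kerber). A zero part in nu *)
(* is harmless.                                                                *)
Definition is_Specht_index n (nu : seq nat) (i : Iirr [set: 'S_n]) : bool :=
  (i \in irr_constt ('Ind[[set: 'S_n]] (1 : 'CF(young n nu)))) &&
  (i \in irr_constt
           ('Ind[[set: 'S_n]] ('Res[young n (conj_part nu)] (sign_cfun n)))).

Definition irr_char_Sn n (nu : seq nat) : 'CF([set: 'S_n]) :=
  if [pick i | is_Specht_index nu i] is Some i then 'chi_i else 0.

(* f is the element s~_lam of the irreducible character basis; the value of a  *)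
(* character at mu is its value at any permutation of cycle type mu.           *)
Definition is_stilde (lam : seq nat) (f : symfun) : Prop :=
  forall n, (part_size lam + first_part lam <= n)%N ->
  forall mu : seq nat, is_part mu -> part_size mu = n ->
  forall w : 'S_n, cycle_type w = mu ->
    eval_Xi f mu = irr_char_Sn n ((n - part_size lam)%N :: lam) w.

Definition is_expansion (st : partition_type -> symfun)
    (F : forall n, {mpoly rat[n]}) (c : {fsfun partition_type -> rat with 0}) :
    Prop :=
  forall n, F n = \sum_(nu <- finsupp c) c nu *: st nu n.

(* inl j is the barred letter j+1, inr j is the unbarred letter j+1. *)
Definition letter := (nat + nat)%type.

Definition barred (x : letter) : bool := if x is inl _ then true else false.

Definition letter_le (x y : letter) : bool :=
  match x, y with
  | inl i, inl j => (i <= j)%N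
  | inl _, inr _ => true
  | inr _, inl _ => false
  | inr i, inr j => (i <= j)%N
  end.

(* A multiset of letters is represented by its weakly increasing enumeration. *)
Definition label := seq letter.

Definition is_label (M : label) : bool :=
  [&& sorted letter_le M, M != [::] & (count barred M <= 1)%N].

Fixpoint lex_le (u v : seq letter) : bool :=
  match u, v with
  | [::], _ => true
  | _ :: _, [::] => false
  | x :: u', y :: v' => if x == y then lex_le u' v' else letter_le x y
  end.

Definition label_le (M N : label) : bool := lex_le (rev M) (rev N).
Definition label_lt (M N : label) : bool := (M != N) && label_le M N.

Definition bars (M : label) : seq nat :=
  pmap (fun x : letter => if x is inl j then Some j else None) M.
Definition unbarred_part (M : label) : label := [seq x <- M | ~~ barred x].

(* A filling of (r, gam)/(gam_1) is the sequence of its rows from bottom to    *)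
(* top, each read from left to right. The first one occupies the columns       *)
(* gam_1+1..r, hence the shift in column.                                      *)
Definition tableau := seq (seq label).

Definition trow (T : tableau) (i : nat) : seq label := nth [::] T i.
Definition entry (T : tableau) (i k : nat) : label := nth [::] (trow T i) k.
Definition column (gam : seq nat) (i k : nat) : nat :=
  if i == 0%N then (first_part gam + k)%N else k.

Definition has_shape (gam : seq nat) (T : tableau) : Prop :=
  exists2 r, (first_part gam <= r)%N &
    [seq size R | R <- T] = (r - first_part gam)%N :: gam.

Definition rows_weakly_increase (T : tableau) : Prop :=
  forall i k1 k2, (k1 < k2)%N -> (k2 < size (trow T i))%N ->
    label_le (entry T i k1) (entry T i k2).

Definition columns_strictly_increase (gam : seq nat) (T : tableau) : Prop :=
  forall i1 i2 k1 k2, (i1 < i2)%N ->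
    (k1 < size (trow T i1))%N -> (k2 < size (trow T i2))%N ->
    column gam i1 k1 = column gam i2 k2 ->
    label_lt (entry T i1 k1) (entry T i2 k2).

Definition has_content (lam alpha : seq nat) (T : tableau) : Prop :=
  forall j, count_mem (inl j : letter) (flatten (flatten T)) = nth 0%N lam j /\
            count_mem (inr j : letter) (flatten (flatten T)) = nth 0%N alpha j.

Record MCT (gam lam alpha : seq nat) (T : tableau) : Prop := {
  MCT_shape : has_shape gam T;
  MCT_label : all is_label (flatten T);
  MCT_rows : rows_weakly_increase T;
  MCT_columns : columns_strictly_increase gam T;
  MCT_content : has_content lam alpha T;
  MCT_row1 : all (fun M : label => ~~ all barred M) (trow T 0)
}.

Definition reading (T : tableau) : seq label := flatten [seq rev R | R <- T].

Definition read_word (T : tableau) (U : label) : seq nat :=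
  flatten [seq bars M | M <- reading T & unbarred_part M == U].

Definition unbarred_parts (T : tableau) : seq label :=
  sort label_le
    (undup [seq U <- [seq unbarred_part M | M <- flatten T] | U != [::]]).

Definition lattice_word (w : seq nat) : Prop :=
  forall k j, (count_mem j.+1 (take k w) <= count_mem j (take k w))%N.

Definition lattice_tableau (T : tableau) : Prop :=
  lattice_word
    (read_word T [::] ++ flatten [seq read_word T U | U <- unbarred_parts T]).

(* Main.v *)
From HB Require Import structures.
From mathcomp Require Import all_boot all_order all_fingroup all_algebra all_field all_character.
From mathcomp Require Import finmap.
From mathcomp Require Import mpoly.
From mathcomp Require Import zify ring.
Require Import Defs.

Set Implicit Arguments.
Unset Strict Implicit.
Unset Printing Implicit Defensive.

Import GRing.Theory Num.Theory.

(** Write X_delta for the virtual character of S_n given by the Jacobi-Trudi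
    determinant in the permutation characters on words; a lattice-word
    sign-reversing involution computes the inner product of X_delta with any
    permutation character on words as a number of lattice fillings, which shows
    that the X_delta are orthonormal and are the irreducible characters.

    On a permutation w of cycle type mu, the product of the h_a evaluates at the
    eigenvalues Xi_mu to the number of w-fixed words whose letters are exponent
    vectors (multisets of unbarred letters) of total weight alpha. Hence
    h_alpha * s~_lam restricts to the product of this permutation character with
    X_(n-|lam|,lam), and its inner product with X_(n-|gam|,gam) counts arrays
    a((e,r),k), with e an exponent vector, that are lattice in both directions.
    Reading a((e,r),k) as the number of cells of row r labelled by e together
    with the barred letter k (no bar for k = 0) turns these arrays into lattice
    tableaux; the entries with e = 0, k = 0 fill the part of the bottom row that
    is not recorded in the tableau.

    A family of symmetric polynomials that vanishes at Xi_mu for all large mu is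
    zero, since the elementary symmetric polynomials take the values of a
    triangular grid there, so that identities of characters lift to symmetric
    functions. *)

(** * Arrays, lattice conditions and the cancelling involution *)

(** The inner product behind a coefficient contains two Jacobi-Trudi determinants, one for lam and
    one for gam, and they are cancelled one after the other. The obstacle is that the second
    cancellation must respect the lattice condition left by the first. Seen in the transposed array,
    that condition is column strictness between neighbouring rows of a skew filling whose offsets
    depend only on the row sums. The involution is therefore built for skew fillings from the start:
    it leaves alone every k lying directly below a k+1 and reflects the remaining letters k and k+1
    after the first violation of the lattice condition. This keeps the row sums, and hence the
    offsets, as well as the column strictness. The other point is the dependence on n. A tableau
    fixes its array up to the multiplicity of the empty label in the bottom row, and for large n
    this multiplicity is so big that all inequalities involving it hold. The number of arrays is
    then a number of tableaux, free of n, so one family of coefficients serves all large n. *)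

Definition psum (u : nat -> nat) (t : nat) : nat := \sum_(i < t) u i.

Lemma psum0 u : psum u 0 = 0.
Proof. by rewrite /psum big_ord0. Qed.

Lemma psumS u t : psum u t.+1 = psum u t + u t.
Proof. by rewrite /psum big_ord_recr. Qed.

Lemma eq_psum u v t : (forall i, i < t -> u i = v i) -> psum u t = psum v t.
Proof. by move=> e; apply: eq_bigr => i _; apply: e. Qed.

Lemma leq_psum u s t : s <= t -> psum u s <= psum u t.
Proof.
move=> /subnKC <-; elim: (t - s) => [|d IH]; first by rewrite addn0.
by rewrite addnS psumS; lia.
Qed.

Lemma psumD u v t : psum (fun i => u i + v i) t = psum u t + psum v t.
Proof. by rewrite /psum big_split. Qed.

Section TailSwap.

Variables (x y : nat -> nat) (t0 : nat).

(** Each step t is read as a block in which [y t] letters of the larger kind precede [x t] letters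
    of the smaller kind. In block [t0] some larger letter is the first to break the ballot
    condition, and [excess] counts the larger letters of the block behind it. [swapx] and [swapy]
    exchange the two kinds after the violating letter, as in the reflection principle. *)
Definition excess := (psum y t0.+1 - psum x t0).-1.

Definition swapx t := if t < t0 then x t else if t == t0 then excess else y t.
Definition swapy t :=
  if t < t0 then y t else if t == t0 then y t + x t - excess else x t.

Hypothesis before : psum y t0 <= psum x t0.
Hypothesis at_t0 : psum x t0 < psum y t0.+1.

Lemma excess_le : excess <= y t0.
Proof. by move: before at_t0; rewrite /excess psumS; lia. Qed.

Lemma swapD t : swapx t + swapy t = x t + y t.
Proof.
rewrite /swapx /swapy; case: ltngtP => // [_|->]; first by rewrite addnC.
by have := excess_le; lia.
Qed.

Lemma psum_swapx_before t : t <= t0 -> psum swapx t = psum x t.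
Proof.
by move=> le_t; apply: eq_psum => i lt_i; rewrite /swapx (leq_trans lt_i le_t).
Qed.

Lemma psum_swapy_before t : t <= t0 -> psum swapy t = psum y t.
Proof.
by move=> le_t; apply: eq_psum => i lt_i; rewrite /swapy (leq_trans lt_i le_t).
Qed.

(** The violating letter keeps its kind while everything behind it is exchanged, so the totals are
    exchanged up to a shift by one. This shift is the one produced by adding [rho] to the weight. *)
Lemma psum_swapx_after t : t0 < t -> (psum swapx t).+1 = psum y t.
Proof.
move=> /subnKC <-; elim: (t - t0.+1) => [|d IH].
  rewrite addn0 psumS psum_swapx_before // {1}/swapx ltnn eqxx.
  by move: at_t0; rewrite /excess; lia.
rewrite addnS psumS (psumS y) -IH {2}/swapx.
by rewrite ifN ?ifN //; lia.
Qed.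

Lemma psum_swapy_after t : t0 < t -> psum swapy t = (psum x t).+1.
Proof.
move=> /subnKC <-; elim: (t - t0.+1) => [|d IH].
  rewrite addn0 !psumS psum_swapy_before // {1}/swapy ltnn eqxx.
  by move: before at_t0; rewrite /excess psumS; lia.
rewrite addnS psumS (psumS x) IH {1}/swapy.
by rewrite ifN ?ifN //; lia.
Qed.

End TailSwap.

Lemma eq_swapx x y x' y' t0 : x =1 x' -> y =1 y' ->
  swapx x y t0 =1 swapx x' y' t0.
Proof.
move=> ex ey t; rewrite /swapx /excess ex ey.
by rewrite (eq_psum (fun i _ => ey i)) (eq_psum (fun i _ => ex i)).
Qed.

Lemma eq_swapy x y x' y' t0 : x =1 x' -> y =1 y' ->
  swapy x y t0 =1 swapy x' y' t0.
Proof.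
move=> ex ey t; rewrite /swapy /excess ex ey.
by rewrite (eq_psum (fun i _ => ey i)) (eq_psum (fun i _ => ex i)).
Qed.

Lemma swapx_invol x y t0 : psum y t0 <= psum x t0 < psum y t0.+1 ->
  swapx (swapx x y t0) (swapy x y t0) t0 =1 x.
Proof.
case/andP=> b a t; rewrite /swapx; case: ltngtP => // [lt_t|->].
  by rewrite /swapy ltnNge ltnW //= gtn_eqF.
rewrite /excess psum_swapy_after // psum_swapx_before // psumS; lia.
Qed.

Lemma swapy_invol x y t0 : psum y t0 <= psum x t0 < psum y t0.+1 ->
  swapy (swapx x y t0) (swapy x y t0) t0 =1 y.
Proof.
move=> h t; have [b a] := andP h.
have h' : psum (swapy x y t0) t0 <= psum (swapx x y t0) t0 <
          psum (swapy x y t0) t0.+1.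
  by rewrite (psum_swapy_after b a (ltnSn t0)) psum_swapx_before // psum_swapy_before // psumS; lia.
have [b' a'] := andP h'.
have := swapD b' a' t; rewrite swapx_invol // => e.
by have := swapD b a t; lia.
Qed.

(** * Exchange of the letters k and k+1 in a skew filling *)

Section LetterSwap.

Variables (A : nat -> nat -> nat) (B : nat -> nat) (lk : pred nat).

(** [A t j] counts the letters j in row t of a skew filling whose row t starts at offset [B t]; the
    letters j fill the columns from [pre t j] to [pre t j.+1]. With this reading [ssat] is column
    strictness between linked rows: the letters up to k of row t+1 end no later than the letters
    below k of row t. In [viol] each row contributes its k+1 before its k. *)
Definition pre t k := B t + psum (A t) k.

Definition ssat k := forall t, lk t -> pre t.+1 k.+1 <= pre t k.

Definition viol t k := psum (A^~ k) t < psum (A^~ k.+1) t.+1.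

(** Under [ssat k] and [ssat k.+1] the k of row t and the k+1 of row t+1 overlap exactly in the
    columns from [pre t k] to [pre t.+1 k.+2]; truncated subtraction gives 0 if there are none.
    These vertical pairs are kept, as in a Bender-Knuth move, and [matchedp] books them in their
    upper row. *)
Definition matched k t := if lk t then pre t.+1 k.+2 - pre t k else 0.
Definition matchedp k t := if t is t'.+1 then matched k t' else 0.

Definition freex k t := A t k - matched k t.
Definition freey k t := A t k.+1 - matchedp k t.

Definition swapA t0 k t j :=
  if j == k then swapx (freex k) (freey k) t0 t + matched k t
  else if j == k.+1 then swapy (freex k) (freey k) t0 t + matchedp k t
  else A t j.

Lemma preS t k : pre t k.+1 = pre t k + A t k.
Proof. by rewrite /pre psumS addnA. Qed.

Section Ss.

Variable k : nat.
Hypotheses (ss0 : ssat k) (ss1 : ssat k.+1).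

Lemma freexE t : A t k = freex k t + matched k t.
Proof.
rewrite /freex /matched; case: ifP => [/ss1|]; last by rewrite subn0 addn0.
by rewrite (preS t k); lia.
Qed.

Lemma freeyE t : A t k.+1 = freey k t + matchedp k t.
Proof.
rewrite /freey; case: t => [|t] /=; first by rewrite subn0 addn0.
rewrite /matched; case: ifP => [/ss0|]; last by rewrite subn0 addn0.
by rewrite (preS _ k.+1); lia.
Qed.

Lemma psum_matchedp t : psum (matchedp k) t.+1 = psum (matched k) t.
Proof.
elim: t => [|t IH]; first by rewrite psumS !psum0.
by rewrite psumS IH psumS.
Qed.

Lemma psum_freex t : psum (A^~ k) t = psum (freex k) t + psum (matched k) t.
Proof. by rewrite -psumD; apply: eq_psum => i _; apply: freexE. Qed.

Lemma psum_freey t :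
  psum (A^~ k.+1) t.+1 = psum (freey k) t.+1 + psum (matched k) t.
Proof.
by rewrite -psum_matchedp -psumD; apply: eq_psum => i _; apply: freeyE.
Qed.

(** A matched pair has its k in row t and its k+1 in row t+1, so it adds the same amount to both
    sides of the inequality; only the free letters decide. *)
Lemma violE t : viol t k = (psum (freex k) t < psum (freey k) t.+1).
Proof. by rewrite /viol psum_freex psum_freey ltn_add2r. Qed.

Lemma first_viol t0 : (forall t, t < t0 -> ~~ viol t k) ->
  psum (freey k) t0 <= psum (freex k) t0.
Proof.
case: t0 => [|t] h; first by rewrite !psum0.
have := h t (ltnSn t); rewrite violE -leqNgt => /leq_trans; apply.
exact: leq_psum.
Qed.

End Ss.

End LetterSwap.

Section SwapProps.

Variables (A : nat -> nat -> nat) (B : nat -> nat) (lk : pred nat).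
Variables (t0 k : nat).
Hypotheses (ss0 : ssat A B lk k) (ss1 : ssat A B lk k.+1).
Hypothesis before : forall t, t < t0 -> ~~ viol A t k.
Hypothesis at_t0 : viol A t0 k.

Let A' := swapA A B lk t0 k.
Let x := freex A B lk k.
Let y := freey A B lk k.

Let fv : psum y t0 <= psum x t0 := first_viol ss0 ss1 before.
Let av : psum x t0 < psum y t0.+1.
Proof. by rewrite -violE. Qed.

Lemma swapA_same t : A' t k = swapx x y t0 t + matched A B lk k t.
Proof. by rewrite /A' /swapA eqxx. Qed.

Lemma swapA_next t : A' t k.+1 = swapy x y t0 t + matchedp A B lk k t.
Proof. by rewrite /A' /swapA gtn_eqF // eqxx. Qed.

Lemma swapA_other t j : j != k -> j != k.+1 -> A' t j = A t j.
Proof. by rewrite /A' /swapA => /negbTE-> /negbTE->. Qed.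

Lemma swapA_pair t : A' t k + A' t k.+1 = A t k + A t k.+1.
Proof.
rewrite swapA_same swapA_next (freexE ss1 t) (freeyE ss0 t).
by have := swapD fv av t; rewrite -/x -/y; lia.
Qed.

Lemma psum_swapA t j : j != k.+1 -> psum (A' t) j = psum (A t) j.
Proof.
have low i : i <= k -> psum (A' t) i = psum (A t) i.
  by move=> le_i; apply: eq_psum => z lt_z; rewrite swapA_other //; lia.
have [/low // | lt_k] := leqP j k.
move=> ne; have {ne lt_k} : k.+2 <= j by lia.
move=> /subnKC <-; elim: (j - k.+2) => [|d IH].
  by rewrite addn0 !psumS low // -!addnA swapA_pair.
by rewrite addnS psumS (psumS (A t)) IH swapA_other //; lia.
Qed.

Lemma pre_swapA t j : j != k.+1 -> pre A' B t j = pre A B t j.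
Proof. by move=> ne; rewrite /pre psum_swapA. Qed.

Lemma matched_swapA t : matched A' B lk k t = matched A B lk k t.
Proof. by rewrite /matched !pre_swapA //; lia. Qed.

Lemma matchedp_swapA t : matchedp A' B lk k t = matchedp A B lk k t.
Proof. by case: t => //= t; apply: matched_swapA. Qed.

(** Only the border between k and k+1 moves within a row. In row t the kept matched k still reach
    [pre t.+1 k.+2], which secures the condition for k+1. In row t+1 only the kept matched k+1
    extend beyond [pre t k], so the letters up to k end before it, whatever the new distribution of
    the free letters. *)
Lemma ssat_swapA j : ssat A B lk j -> ssat A' B lk j.
Proof.
move=> ssj t lkt; have [ej|nej] := eqVneq j k; last first.
  have [ej|nej'] := eqVneq j k.+1; last by rewrite !pre_swapA //; apply: ssj.
  rewrite ej (pre_swapA t.+1) ?preS; last by lia.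
  rewrite swapA_same pre_swapA; last by lia.
  by rewrite /matched lkt !preS; lia.
have := swapD fv av t.+1; rewrite ej preS !pre_swapA; last by lia. 2: lia.
rewrite swapA_same => e.
have := freexE ss1 t.+1; have := freeyE ss0 t.+1; rewrite -/x -/y /= => e1 e2.
have : x t.+1 + y t.+1 + matched A B lk k t.+1 + matched A B lk k t =
   A t.+1 k + A t.+1 k.+1 by lia.
have := ss0 lkt; rewrite /matched lkt !preS; lia.
Qed.

Lemma freex_swapA : freex A' B lk k =1 swapx x y t0.
Proof. by move=> t; rewrite /freex matched_swapA swapA_same addnK. Qed.

Lemma freey_swapA : freey A' B lk k =1 swapy x y t0.
Proof. by move=> t; rewrite /freey matchedp_swapA swapA_next addnK. Qed.

Lemma swapA_invol t j : swapA A' B lk t0 k t j = A t j.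
Proof.
have fav : psum y t0 <= psum x t0 < psum y t0.+1 by rewrite fv av.
rewrite {1}/swapA (eq_swapx _ freex_swapA freey_swapA).
rewrite (eq_swapy _ freex_swapA freey_swapA).
rewrite matched_swapA matchedp_swapA swapx_invol // swapy_invol //.
case: eqP => [->|/eqP ne]; first by rewrite (freexE ss1 t).
by case: eqP => [->|/eqP ne']; [rewrite (freeyE ss0 t) | apply: swapA_other].
Qed.

Lemma swapA_before t j : t < t0 -> A' t j = A t j.
Proof.
move=> lt_t; have [->|ne] := eqVneq j k.
  by rewrite swapA_same /swapx lt_t -freexE.
have [->|ne'] := eqVneq j k.+1; last by rewrite swapA_other.
by rewrite swapA_next /swapy lt_t -freeyE.
Qed.

Lemma psum_swapA_before t j : t <= t0 -> psum (A'^~ j) t = psum (A^~ j) t.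
Proof.
by move=> le_t; apply: eq_psum => i lt_i; apply: swapA_before; apply: leq_trans le_t.
Qed.

Lemma viol_swapA_before t j : t < t0 -> viol A' t j = viol A t j.
Proof. by move=> lt_t; rewrite /viol !psum_swapA_before // ltnW. Qed.

(** For [j = k.+1] the altered column k+1 enters only with its rows before [t0], where nothing has
    changed. The condition for k-1 would involve the altered entry of column k in row [t0], so at a
    fixed row the scan has to go from large letters to small ones. *)
Lemma viol_swapA_above j : k < j -> viol A' t0 j = viol A t0 j.
Proof.
move=> lt_j; rewrite /viol psum_swapA_before // !(psumS _ t0).
rewrite psum_swapA_before // swapA_other //; lia.
Qed.

Lemma viol_swapA_at : viol A' t0 k.
Proof.
rewrite (violE (ssat_swapA ss0) (ssat_swapA ss1)).
rewrite (eq_psum (fun i _ => freex_swapA i)) (eq_psum (fun i _ => freey_swapA i)).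
by rewrite psum_swapy_after // psum_swapx_before // psumS; lia.
Qed.

Variable N : nat.
Hypotheses (lt_t0 : t0 < N) (lkN : ~~ lk N.-1).

(** No link leaves the last row, so no k is matched there and the columns k and k+1 contain equally
    many matched letters; the totals then change as those of the free letters do. *)
Lemma swapA_total_same : (psum (A'^~ k) N).+1 = psum (A^~ k.+1) N.
Proof.
have ssA0 := ssat_swapA ss0; have ssA1 := ssat_swapA ss1.
case: N lt_t0 lkN => // M lt_M /= lkM.
rewrite (psum_freex ssA1) (psum_freey ss0).
rewrite (eq_psum (fun i _ => freex_swapA i)) (eq_psum (fun i _ => matched_swapA i)).
have := psum_swapx_after fv av lt_M; rewrite -/x -/y.
by rewrite (psumS (matched _ _ _ _)) /(matched _ _ _ _ M) (negbTE lkM); lia.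
Qed.

Lemma swapA_total_next : psum (A'^~ k.+1) N = (psum (A^~ k) N).+1.
Proof.
have ssA0 := ssat_swapA ss0; have ssA1 := ssat_swapA ss1.
case: N lt_t0 lkN => // M lt_M /= lkM.
rewrite (psum_freex ss1) (psum_freey ssA0).
rewrite (eq_psum (fun i _ => freey_swapA i)) (eq_psum (fun i _ => matched_swapA i)).
have := psum_swapy_after fv av lt_M; rewrite -/x -/y.
by rewrite (psumS (matched _ _ _ _)) /(matched _ _ _ _ M) (negbTE lkM); lia.
Qed.

Lemma swapA_total_other j : j != k -> j != k.+1 ->
  psum (A'^~ j) N = psum (A^~ j) N.
Proof. by move=> ne ne'; apply: eq_psum => i _; apply: swapA_other. Qed.

End SwapProps.

(** * Alternating sums over the symmetric group *)

Definition rho l j := l - j.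

Section Alternant.

Variable l : nat.

Definition dotmatch (lam M : 'I_l -> nat) (sigma : 'S_l) :=
  [forall j, M j + rho l j == lam (sigma j) + rho l (sigma j)].

(** The coefficient of the monomial with exponent M + rho in the antisymmetrized monomial of lam +
    rho. Equivalently, it is the signed number of terms of the Jacobi-Trudi determinant of lam whose
    column j carries h with index [M j]. *)
Definition alternant (lam M : 'I_l -> nat) : algC :=
  (\sum_(sigma : 'S_l | dotmatch lam M sigma) (-1) ^+ sigma)%R.

Lemma eq_alternant lam M M' : M =1 M' -> alternant lam M = alternant lam M'.
Proof.
by move=> e; apply: eq_bigl => sigma; apply: eq_forallb => j; rewrite e.
Qed.

(** The hypotheses say that M' + rho is M + rho with the values at [k] and [k'] exchanged, so
    composing with a transposition matches the terms with opposite signs. *)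
Lemma alternant_swap lam M M' (k k' : 'I_l) : k' = k.+1 :> nat ->
  (M' k).+1 = M k' -> M' k' = (M k).+1 ->
  (forall j, j != k -> j != k' -> M' j = M j) ->
  alternant lam M' = (- alternant lam M)%R.
Proof.
move=> ek e1 e2 e3; have nek : k != k' by rewrite -val_eqE /= ek; lia.
rewrite /alternant (reindex_inj (mulgI (tperm k k'))) /=.
have key j : M' j + rho l j = M (tperm k k' j) + rho l (tperm k k' j).
  have := ltn_ord k'; rewrite /rho; case: tpermP => [->|->|/eqP nk /eqP nk'].
  - by rewrite -e1 ek; lia.
  - by rewrite e2 ek; lia.
  - by rewrite e3.
rewrite (eq_bigl (dotmatch lam M)); last first.
  move=> sigma; apply/forallP/forallP => h j.
    by have := h (tperm k k' j); rewrite key permM tpermK.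
  by rewrite key permM; apply: h.
rewrite -sumrN; apply: eq_bigr => sigma _.
by rewrite odd_mul_tperm nek addTb signrN.
Qed.

End Alternant.

Lemma increasing_perm l (sigma : 'S_l) :
  (forall i j : 'I_l, i < j -> sigma i < sigma j) -> sigma = 1%g.
Proof.
move=> h; have le_sigma m (lt_m : m < l) : m <= sigma (Ordinal lt_m).
  elim: m lt_m => // m IH lt_m; have := IH (ltnW lt_m).
  by move/leq_ltn_trans; apply; apply: h.
have le (i : 'I_l) : i <= sigma i by case: i => m lt_m; apply: le_sigma.
have := leqif_sum (fun i (_ : true) => conj (le i) (erefl (val i == sigma i))).
case=> _; rewrite [X in _ == X](reindex_inj (@perm_inj _ sigma^-1%g)) /=.
under [X in _ == X]eq_bigr do rewrite permKV.
rewrite eqxx => /esym/forallP eq_sigma.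
by apply/permP => i; apply/val_inj; rewrite perm1; apply/esym/eqP/(eq_sigma i).
Qed.

(** Two strictly decreasing sequences that are rearrangements of each other coincide, so no
    permutation but the identity can contribute. *)
Lemma alternant_decreasing l (lam M : 'I_l -> nat) :
  (forall i j : 'I_l, i <= j -> lam j <= lam i) ->
  (forall i j : 'I_l, i <= j -> M j <= M i) ->
  alternant lam M = ([forall j, M j == lam j]%:R)%R.
Proof.
move=> dlam dM; have incr sigma : dotmatch lam M sigma -> sigma = 1%g.
  move/forallP=> h; apply: increasing_perm => i j lt_ij.
  rewrite ltnNge; apply/negP => le_s; have := dlam _ _ le_s.
  have := dM _ _ (ltnW lt_ij); move: (eqP (h i)) (eqP (h j)); rewrite /rho.
  by have := ltn_ord j; have := ltn_ord (sigma i); lia.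
rewrite /alternant; case: (boolP [forall j, M j == lam j]) => h.
  rewrite (big_pred1 1%g) ?odd_perm1 // => sigma; rewrite pred1E.
  apply/idP/eqP => [/incr //|<-]; apply/forallP => j.
  by rewrite perm1 (eqP (forallP h j)).
rewrite big_pred0 // => sigma; apply/negbTE/negP => hs; move: (hs).
rewrite (incr _ hs) => {hs}/forallP hs; case/negP: h; apply/forallP => j.
by have := hs j; rewrite perm1 eqn_add2r.
Qed.

(** * The sign-reversing involution on finite arrays *)

Section Cancellation.

Variables (T : finType) (pos : T -> nat) (l b : nat).
Hypotheses (pos_inj : injective pos) (pos_lt : forall x, pos x < #|T|).

Local Notation N := #|T|.
Local Notation array := {ffun T * 'I_l -> 'I_b.+1}.
Implicit Type a : array.

Lemma pos_surj t : t < N -> exists x, pos x = t.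
Proof.
move=> lt_t; have inj : injective (fun x => Ordinal (pos_lt x)).
  by move=> x y [/pos_inj].
have le : #|'I_N| <= #|T| by rewrite card_ord.
have [g _ gK] := inj_card_bij inj le.
by exists (g (Ordinal lt_t)); have /(congr1 val) := gK (Ordinal lt_t).
Qed.

(** Extension by zero, with the rows ordered by [pos], so that the exchange of letters can be stated
    with unbounded numerical indices. *)
Definition natof a t k : nat :=
  \sum_(p : T * 'I_l | (pos p.1 == t) && (p.2 == k :> nat)) a p.

Lemma natofE a x (k : 'I_l) : natof a (pos x) k = a (x, k).
Proof.
rewrite /natof (big_pred1 (x, k)) // => [[y j]] /=.
by rewrite (inj_eq pos_inj) val_eqE -pair_eqE.
Qed.

Lemma natof_rect a t k : (N <= t) || (l <= k) -> natof a t k = 0.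
Proof.
move=> h; rewrite /natof big_pred0 // => [[y j]] /=; apply/negbTE/negP.
by case/andP=> /eqP e1 /eqP e2; have := pos_lt y; have := ltn_ord j; lia.
Qed.

Lemma psum_row a x : psum (natof a (pos x)) l = \sum_(k < l) a (x, k).
Proof. by apply: eq_bigr => k _; apply: natofE. Qed.

Lemma sum_pos_lt (F : nat -> nat) t :
  t <= N -> \sum_(x | pos x < t) F (pos x) = psum F t.
Proof.
elim: t => [|t IH] lt_t; first by rewrite psum0 big_pred0.
have [x ex] := pos_surj lt_t.
rewrite psumS -IH ?(ltnW lt_t) // (bigD1 x) /= ?ex // addnC; congr (_ + _).
by apply: eq_bigl => y; rewrite -(inj_eq pos_inj) ex; lia.
Qed.

Lemma psum_col a t (k : 'I_l) : t <= N ->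
  psum (natof a ^~ k) t = \sum_(x | pos x < t) a (x, k).
Proof.
move=> le_t; rewrite -sum_pos_lt //.
by apply: eq_bigr => x _; rewrite natofE.
Qed.

Definition colsum a (k : 'I_l) : nat := \sum_x a (x, k).

Lemma colsumE a k : colsum a k = psum (natof a ^~ k) N.
Proof. by rewrite psum_col //; apply: eq_bigl => x; rewrite pos_lt. Qed.

Definition ofnat (A : nat -> nat -> nat) : array :=
  [ffun p : T * 'I_l => inord (A (pos p.1) p.2)].

Lemma ofnatK A : (forall t k, A t k <= b) ->
  (forall t k, (N <= t) || (l <= k) -> A t k = 0) ->
  forall t k, natof (ofnat A) t k = A t k.
Proof.
move=> Ab A0 t k; have [h|] := boolP ((N <= t) || (l <= k)).
  by rewrite natof_rect // A0.
rewrite negb_or -!ltnNge => /andP[lt_t lt_k]; have [x <-] := pos_surj lt_t.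
by rewrite (natofE _ x (Ordinal lt_k)) ffunE /= inordK // ltnS.
Qed.

Lemma natof_inj a a' : (forall t k, natof a t k = natof a' t k) -> a = a'.
Proof.
by move=> e; apply/ffunP => -[x k]; apply: val_inj; rewrite /= -!natofE e.
Qed.

Variables (s : T -> nat) (B : nat -> nat) (lk : pred nat).
Hypotheses (s_le : forall x, s x <= b) (lk_lt : forall t, lk t -> t.+1 < N).

Definition rowsums a := [forall x, \sum_(k < l) a (x, k) == s x].

Definition semistd a :=
  [forall t : 'I_N, forall k : 'I_l,
    lk t ==> (pre (natof a) B t.+1 k.+1 <= pre (natof a) B t k)].

Definition lattice a := [forall t : 'I_N, forall k : 'I_l, ~~ viol (natof a) t k].

Lemma semistdP a : semistd a -> forall k, k < l -> ssat (natof a) B lk k.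
Proof.
move=> /forallP h k lt_k t lkt; have lt_t := ltnW (lk_lt lkt).
by have /forallP/(_ (Ordinal lt_k))/implyP := h (Ordinal lt_t); apply.
Qed.

Lemma rowsumsP a t : rowsums a -> psum (natof a t) l <= b.
Proof.
move=> /forallP h; have [lt_t|le_t] := ltnP t N.
  by have [x <-] := pos_surj lt_t; rewrite psum_row (eqP (h x)).
by rewrite /psum big1 // => i _; rewrite natof_rect // le_t.
Qed.

(* Pairs (t, k) are scanned by increasing t, then decreasing k. *)
Definition violn a c := viol (natof a) (c %/ l) (l.-1 - c %% l).

Definition firstviol a := find (violn a) (iota 0 (N * l)).

Lemma violn_code a t k : k < l -> violn a (t * l + (l.-1 - k)) = viol (natof a) t k.
Proof.
move=> lt_k; rewrite /violn divnMDl ?divn_small ?addn0 1?modnMDl ?modn_small; try lia.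
by congr viol; lia.
Qed.

Lemma find_iota (p : pred nat) m c : c < m -> p c ->
  (forall c', c' < c -> ~~ p c') -> find p (iota 0 m) = c.
Proof.
move=> lt_c pc h; apply/eqP; rewrite eqn_leq; apply/andP; split.
  rewrite leqNgt; apply/negP => /(before_find 0).
  by rewrite nth_iota // pc.
rewrite leqNgt; apply/negP => lt_f.
have hp : has p (iota 0 m) by apply/hasP; exists c; rewrite ?mem_iota.
by have := nth_find 0 hp; rewrite nth_iota; [apply/negP/h | lia].
Qed.

Lemma firstviolP a : ~~ lattice a ->
  let c := firstviol a in let t := c %/ l in let k := l.-1 - c %% l in
  [/\ c < N * l, t < N, k.+1 < l, viol (natof a) t k
    & forall c', c' < c -> ~~ violn a c'].
Proof.
move=> /forallPn[t1 /forallPn[k1]] /negPn v1 c.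
have lt_k1 := ltn_ord k1; have lt_t1 := ltn_ord t1.
have hv : has (violn a) (iota 0 (N * l)).
  apply/hasP; exists (t1 * l + (l.-1 - k1)); last by rewrite violn_code.
  by rewrite mem_iota; nia.
have lt_c : c < N * l by rewrite -[N * l](size_iota 0) -has_find.
have vc : violn a c by have := nth_find 0 hv; rewrite nth_iota.
have lt_t : c %/ l < N by rewrite ltn_divLR //; lia.
split=> //.
  rewrite ltnNge; apply/negP => le_k; move: vc.
  rewrite /violn /viol [X in _ < X]big1 // => i _.
  by rewrite natof_rect // le_k orbT.
move=> c' lt_c'; have := before_find 0 lt_c'.
by rewrite nth_iota ?add0n => [->|] //; apply: ltn_trans lt_c.
Qed.

Definition swapinv a :=
  let c := firstviol a in ofnat (swapA (natof a) B lk (c %/ l) (l.-1 - c %% l)).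

Section Involution.

Variable a : array.
Hypotheses (ra : rowsums a) (sa : semistd a) (la : ~~ lattice a).

Let c := firstviol a.
Let t := c %/ l.
Let k := l.-1 - c %% l.
Let A := natof a.
Let A' := swapA A B lk t k.

Let lt_c : c < N * l. Proof. by case: (firstviolP la). Qed.
Let lt_t : t < N. Proof. by case: (firstviolP la). Qed.
Let lt_k : k.+1 < l. Proof. by case: (firstviolP la). Qed.
Let vtk : viol A t k. Proof. by case: (firstviolP la). Qed.
Let noviol c' : c' < c -> ~~ violn a c'.
Proof. by case: (firstviolP la) => _ _ _ _; apply. Qed.
Let ss0 : ssat A B lk k. Proof. exact: (semistdP sa (ltnW lt_k)). Qed.
Let ss1 : ssat A B lk k.+1. Proof. exact: (semistdP sa lt_k). Qed.
Let before t' : t' < t -> ~~ viol A t' k.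
Proof.
move=> lt_t'; rewrite -violn_code ?(ltnW lt_k) //; apply: noviol.
by have := divn_eq c l; rewrite -/t; nia.
Qed.

(** The exchange keeps the sum of the entries k and k+1 of every row, so each new entry is at most a
    row sum and hence at most [b]: the truncation in [ofnat] loses nothing. *)
Lemma natof_swapinv t' j : natof (swapinv a) t' j = A' t' j.
Proof.
have pair := swapA_pair ss0 ss1 before vtk.
have row0 t1 j1 : A' t1 j1 <= psum (A t1) l.
  have Aj j2 : j2 < l -> A t1 j2 <= psum (A t1) l.
    by move=> lt_j; apply: leq_trans (leq_psum _ lt_j); rewrite psumS leq_addl.
  have kk : A t1 k + A t1 k.+1 <= psum (A t1) l.
    by apply: leq_trans (leq_psum _ lt_k); rewrite !psumS; lia.
  have [->|ne] := eqVneq j1 k; first by have := pair t1; rewrite -/A'; lia.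
  have [->|ne'] := eqVneq j1 k.+1; first by have := pair t1; rewrite -/A'; lia.
  rewrite /A' swapA_other //; have [/Aj //|le_j] := ltnP j1 l.
  by rewrite /A natof_rect // le_j orbT.
apply: ofnatK => {t' j} t' j; first exact: leq_trans (row0 t' j) (rowsumsP t' ra).
case: ltnP => [lt_t' /= le_j|le_t' _].
  rewrite -/c -/t -/k -/A -/A' /A' swapA_other; try lia.
  by rewrite /A natof_rect // le_j orbT.
apply/eqP; rewrite -leqn0; apply: leq_trans (row0 t' j) _.
by rewrite /psum big1 // => i _; rewrite /A natof_rect // le_t'.
Qed.

Let viol_swapinv t' j : viol (natof (swapinv a)) t' j = viol A' t' j.
Proof.
by rewrite /viol; congr (_ < _); apply: eq_psum => i _; rewrite natof_swapinv.
Qed.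

Let pre_swapinv t' j : pre (natof (swapinv a)) B t' j = pre A' B t' j.
Proof. by congr (_ + _); apply: eq_psum => i _; rewrite natof_swapinv. Qed.

Lemma rowsums_swapinv : rowsums (swapinv a).
Proof.
apply/forallP => x; rewrite -psum_row -(eqP (forallP ra x)) -psum_row.
rewrite (eq_psum (fun i _ => natof_swapinv (pos x) i)).
by rewrite (psum_swapA ss0 ss1 before vtk) //; lia.
Qed.

Lemma semistd_swapinv : semistd (swapinv a).
Proof.
apply/forallP => t'; apply/forallP => j; apply/implyP => lkt.
rewrite !pre_swapinv; apply: (ssat_swapA ss0 ss1 before vtk) lkt.
exact: (semistdP sa).
Qed.

(** The rows before t are untouched, and in row t only letters above k precede k in the scan, so no
    earlier violation appears; the one at [c] survives. The second application therefore acts at the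
    same place as the first. *)
Lemma firstviol_swapinv : firstviol (swapinv a) = c.
Proof.
apply: find_iota => //.
  by rewrite /violn viol_swapinv; apply: (viol_swapA_at ss0 ss1 before vtk).
move=> c' lt_c'; rewrite /violn viol_swapinv.
have := noviol lt_c'; rewrite /violn -/A.
have e := divn_eq c l; have e' := divn_eq c' l.
have lm' : c' %% l < l by rewrite ltn_mod; lia.
have [lt_d|le_d] := ltnP (c' %/ l) t.
  by rewrite (viol_swapA_before ss0 ss1).
have {le_d} ed : c' %/ l = t.
  apply/eqP; rewrite eqn_leq le_d andbT -ltnS ltn_divLR; last by lia.
  by apply: leq_trans lt_c' _; rewrite e -/t mulSn; have := ltn_pmod c (ltn_trans (ltn0Sn _) lt_k); lia.
rewrite ed (viol_swapA_above ss0 ss1) //.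
rewrite -/t in e; rewrite ed in e'.
have lm : c %% l < l by rewrite ltn_mod; lia.
by rewrite /k; lia.
Qed.

Lemma lattice_swapinv : ~~ lattice (swapinv a).
Proof.
apply/forallPn; exists (Ordinal lt_t); apply/forallPn; exists (Ordinal (ltnW lt_k)).
by rewrite negbK viol_swapinv; apply: (viol_swapA_at ss0 ss1 before vtk).
Qed.

Lemma swapinvK : swapinv (swapinv a) = a.
Proof.
apply: natof_inj => t' j; rewrite -[RHS]/(A t' j) -(swapA_invol ss0 ss1 before vtk).
rewrite {1}/swapinv firstviol_swapinv -/t -/k -/A'.
have eqA' := fun t1 k1 => natof_swapinv t1 k1.
have e : swapA (natof (swapinv a)) B lk t k =2 swapA A' B lk t k.
  move=> t1 j1; have em t2 : matched (natof (swapinv a)) B lk k t2 = matched A' B lk k t2.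
    by rewrite /matched !pre_swapinv.
  have em' t2 : matchedp (natof (swapinv a)) B lk k t2 = matchedp A' B lk k t2.
    by case: t2 => //= t2; apply: em.
  have ex : freex (natof (swapinv a)) B lk k =1 freex A' B lk k.
    by move=> t2; rewrite /freex eqA' em.
  have ey : freey (natof (swapinv a)) B lk k =1 freey A' B lk k.
    by move=> t2; rewrite /freey eqA' em'.
  by rewrite /swapA (eq_swapx _ ex ey) (eq_swapy _ ex ey) em em' eqA'.
rewrite ofnatK ?e // => t1 j1; rewrite e (swapA_invol ss0 ss1 before vtk).
  have [lt_j|le_j] := ltnP j1 l; last by rewrite /A natof_rect // le_j orbT.
  apply: leq_trans (rowsumsP t1 ra); apply: leq_trans (leq_psum _ lt_j).
  by rewrite psumS leq_addl.
exact: natof_rect.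
Qed.

Lemma alternant_swapinv lam :
  alternant lam (colsum (swapinv a)) = (- alternant lam (colsum a))%R.
Proof.
have lkN : ~~ lk N.-1 by apply/negP => /lk_lt; lia.
have col j : colsum (swapinv a) j = psum (A'^~ j) N.
  by rewrite colsumE; apply: eq_psum => i _; rewrite natof_swapinv.
apply: (@alternant_swap _ _ _ _ (Ordinal (ltnW lt_k)) (Ordinal lt_k)) => //.
- by rewrite col colsumE; apply: (swapA_total_same ss0 ss1 before vtk).
- by rewrite col colsumE; apply: (swapA_total_next ss0 ss1 before vtk).
- move=> j; rewrite -!val_eqE /= => ne ne'; rewrite col colsumE.
  exact: swapA_total_other.
Qed.

End Involution.

Lemma lattice_decreasing a (i j : 'I_l) :
  lattice a -> i <= j -> colsum a j <= colsum a i.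
Proof.
move=> la; have step m (lt_m : m.+1 < l) :
    psum (natof a ^~ m.+1) N <= psum (natof a ^~ m) N.
  case EN : N => [|M]; first by rewrite !psum0.
  have lt_M : M < N by rewrite EN.
  have /forallP/(_ (Ordinal lt_M))/forallP/(_ (Ordinal (ltnW lt_m))) := la.
  by rewrite /viol -leqNgt /= => /leq_trans; apply; rewrite leq_psum.
have chain d m : m + d < l -> psum (natof a ^~ (m + d)) N <= psum (natof a ^~ m) N.
  elim: d => [|d IH] lt_m; first by rewrite addn0.
  by rewrite addnS in lt_m *; apply: leq_trans (step _ lt_m) (IH (ltnW lt_m)).
move=> le_ij; rewrite !colsumE -(subnKC le_ij); apply: chain.
by rewrite subnKC.
Qed.

Theorem cancellation (lam : 'I_l -> nat) :
  (forall i j : 'I_l, i <= j -> lam j <= lam i) ->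
  (\sum_(a : array | rowsums a && semistd a) alternant lam (colsum a) =
   #|[set a : array | [&& rowsums a, semistd a, lattice a
                       & [forall k, colsum a k == lam k]]]|%:R)%R.
Proof.
move=> dlam; rewrite (bigID lattice) /=.
rewrite [X in (_ + X)%R](_ : _ = 0%R) ?addr0; last first.
  (* The sum over the arrays that are not lattice equals its own opposite, which also covers
     possible fixed points of the involution. *)
  set S := (\sum_(a | _) _)%R; have : S = (- S)%R; last first.
    by move/esym/eqP; rewrite Num.Theory.eqNr => /eqP.
  rewrite {1}/S (reindex_onto swapinv swapinv) /=; last first.
    by move=> a /andP[/andP[ra sa] la]; apply: swapinvK.
  pose F a := rowsums a && semistd a && ~~ lattice a.
  have fam a : F a -> F (swapinv a).
    case/andP=> /andP[ra sa] la; apply/andP; split; last exact: lattice_swapinv.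
    by apply/andP; split; [apply: rowsums_swapinv | apply: semistd_swapinv].
  rewrite -sumrN; apply: eq_big => [a|a].
    rewrite -/(F a) -/(F (swapinv a)).
    apply/andP/idP => [[/fam h /eqP e]|Fa]; first by rewrite e in h.
    split; first exact: fam.
    by case/andP: Fa => /andP[ra sa] la; rewrite swapinvK.
  rewrite -/(F (swapinv a)) => /andP[/fam Fa /eqP e]; rewrite e in Fa.
  by case/andP: Fa => /andP[ra sa] la; rewrite alternant_swapinv.
rewrite -sum1_card natr_sum (eq_bigr (fun a => ([forall k, colsum a k == lam k]%:R)%R)).
  rewrite big_mkcond [RHS]big_mkcond; apply: eq_bigr => a _ /=.
  by rewrite inE; do 3![case: (_ a) => //=]; case: ifP.
move=> a /andP[_ la]; apply: alternant_decreasing => // i j.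
exact: lattice_decreasing.
Qed.

End Cancellation.

Local Open Scope ring_scope.

(** * Class functions on words and the characters X_lam *)

Lemma cfmulE (gT : finGroupType) (G : {group gT}) (phi psi : 'CF(G)) w :
  (phi * psi) w = phi w * psi w.
Proof. by rewrite cfunE. Qed.

Section Words.

Variables (n : nat) (K : finType).
Implicit Types (f : {ffun 'I_n -> K}) (u w : 'S_n) (Phi : {ffun K -> nat} -> algC).

Definition fixes w f := [forall x, f (w x) == f x].
Definition content f : {ffun K -> nat} := [ffun k => #|[set x | f x == k]|].
Definition precomp u f : {ffun 'I_n -> K} := [ffun x => f (u x)].

Lemma precompM u w f : precomp w (precomp u f) = precomp (w * u)%g f.
Proof. by apply/ffunP => x; rewrite !ffunE permM. Qed.

Lemma precomp1 f : precomp 1%g f = f.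
Proof. by apply/ffunP => x; rewrite !ffunE perm1. Qed.

Lemma precompK u : cancel (precomp u) (precomp u^-1%g).
Proof. by move=> f; rewrite precompM mulVg precomp1. Qed.

Lemma precompKV u : cancel (precomp u^-1%g) (precomp u).
Proof. by move=> f; rewrite precompM mulgV precomp1. Qed.

Lemma content_precomp u f : content (precomp u f) = content f.
Proof.
apply/ffunP => k; rewrite !ffunE -[RHS](card_imset _ (@perm_inj _ u^-1%g)).
apply: eq_card => x; rewrite !inE ffunE; apply/idP/imsetP => [fx|[y]].
  by exists (u x); rewrite ?inE ?permK.
by rewrite inE => fy ->; rewrite permKV.
Qed.

Lemma fixesE w f : fixes w f = (precomp w f == f).
Proof.
apply/forallP/eqP => [h|e x]; last by rewrite -[in X in _ == X]e ffunE.
by apply/ffunP => x; rewrite ffunE; apply/eqP.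
Qed.

Lemma fixesJ u w f : fixes (w ^ u)%g f = fixes w (precomp u f).
Proof.
rewrite !fixesE precompM conjgE -(can_eq (precompK u)) !precompM.
by rewrite !mulgA mulgV mul1g.
Qed.

Lemma theta_class_fun Phi :
  is_class_fun <<[set: 'S_n]>>%g [ffun w : 'S_n => \sum_(f | fixes w f) Phi (content f)].
Proof.
rewrite genGid; apply: intro_class_fun => [w u _ _ | u]; last by rewrite inE.
rewrite [RHS](reindex_inj (can_inj (precompK u))) /=.
by apply: eq_big => [f|f _]; rewrite ?fixesJ ?content_precomp.
Qed.

(** S_n permutes the positions of words of length n, and weighting the fixed words by a function of
    their content gives a class function. This class of functions is closed under products and its
    inner products are finite sums over contents, so every character below is brought into this
    form. *)
Definition theta Phi : 'CF([set: 'S_n]) := Cfun 0 (theta_class_fun Phi).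

Lemma thetaE Phi w : theta Phi w = \sum_(f | fixes w f) Phi (content f).
Proof. by rewrite cfunE. Qed.

Lemma eq_theta Phi Psi : Phi =1 Psi -> theta Phi = theta Psi.
Proof. by move=> e; apply/cfunP => w; rewrite !thetaE; apply: eq_bigr. Qed.

Lemma content_eq_precomp f f0 : content f = content f0 -> exists u, f = precomp u f0.
Proof.
move=> e; pose tup (g : {ffun 'I_n -> K}) := [tuple g i | i < n].
have cnt g k : count_mem k (tup g) = content g k.
  rewrite ffunE -sum1dep_card -sum1_count big_tuple.
  by apply: eq_bigl => i; rewrite tnth_mktuple.
have : perm_eq (tup f) (tup f0).
  by apply/allP => k _ /=; rewrite !cnt e.
case/tuple_permP => u eu; exists u; apply/ffunP => i; rewrite ffunE.
have -> : f i = tnth (tup f) i by rewrite tnth_mktuple.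
by rewrite (val_inj eu) !tnth_mktuple.
Qed.

Lemma sum_content f : (\sum_k content f k = n)%N.
Proof.
under eq_bigr do rewrite ffunE -sum1dep_card.
rewrite (exchange_big_dep predT) //= -[RHS]card_ord -sum1_card.
by apply: eq_bigr => i _; rewrite (big_pred1 (f i)) // => k; rewrite eq_sym.
Qed.

Lemma content_exists (M : {ffun K -> nat}) : (\sum_k M k = n)%N ->
  exists f, content f = M.
Proof.
move=> eM; pose s := flatten [seq nseq (M k) k | k <- enum K].
have ss : size s == n.
  rewrite size_flatten /shape -map_comp sumnE big_map big_enum /=.
  by rewrite -[X in _ == X]eM; apply/eqP/eq_bigr => k _; rewrite size_nseq.
exists [ffun i => tnth (Tuple ss) i]; apply/ffunP => k; rewrite ffunE.
rewrite -sum1dep_card; under eq_bigl do rewrite ffunE.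
rewrite -(big_tuple _ _ (Tuple ss) (pred1 k) (fun=> 1%N)) /= sum1_count.
rewrite /s count_flatten sumnE -map_comp big_map big_enum /= (bigD1 k) //= big1 ?addn0.
  by rewrite count_nseq /= eqxx mul1n.
by move=> j ne; rewrite count_nseq /= (negbTE ne).
Qed.

(** The words of one content form a single orbit, and each group element carries [f0] to exactly one
    word of the orbit. *)
Lemma sum_stab f0 :
  (\sum_(f | content f == content f0) #|[set w | fixes w f]| = n`!)%N.
Proof.
have -> : (n`! = #|[set: 'S_n]|)%N by rewrite cardsT card_Sn.
rewrite -sum1_card (partition_big (fun v => precomp v f0)
  (fun f => content f == content f0)) /=; last by move=> v _; rewrite content_precomp.
apply: eq_bigr => f /eqP/content_eq_precomp[u ->].
rewrite sum1dep_card -[RHS](card_imset _ (@mulIg _ u^-1%g)).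
apply: eq_card => w; rewrite !inE fixesE precompM; apply/eqP/imsetP => [e|[v]].
  by exists (w * u)%g; rewrite ?mulgK // !inE e eqxx.
by rewrite !inE /= => /eqP e ->; rewrite mulgKV.
Qed.

(** Burnside counting: every content is one orbit and contributes its weight once. Contents are
    bounded by n, which makes the index type finite. *)
Lemma theta_dot1 Phi :
  '[theta Phi, 1] = \sum_(M : {ffun K -> 'I_n.+1} | (\sum_k M k)%N == n)
                      Phi [ffun k => M k : nat].
Proof.
pose cM f : {ffun K -> 'I_n.+1} := [ffun k => inord (content f k)].
have cME f : [ffun k => cM f k : nat] = content f.
  apply/ffunP => k; rewrite !ffunE inordK // ltnS.
  by rewrite -[X in (_ <= X)%N]card_ord; apply: max_card.
rewrite cfdotE cardsT card_Sn.
under eq_bigr do rewrite cfun1E inE /= rmorph1 mulr1 thetaE.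
rewrite (eq_bigl xpredT) => [|w]; last by rewrite inE.
rewrite (exchange_big_dep xpredT) //=.
rewrite (partition_big cM (fun M => (\sum_k M k)%N == n)) /=; last first.
  move=> f _; rewrite -[X in _ == X](sum_content f); apply/eqP/eq_bigr => k _.
  by have /ffunP/(_ k) := cME f; rewrite ffunE.
rewrite mulr_sumr; apply: eq_bigr => M sM.
have [f0 ef0] : exists f0, content f0 = [ffun k => M k : nat].
  by apply: content_exists; under eq_bigr do rewrite ffunE; apply/eqP.
rewrite (eq_bigl (fun f => content f == content f0)); last first.
  move=> f; rewrite ef0 -cME; apply/eqP/eqP => [->//|/ffunP e].
  by apply/ffunP => k; have := e k; rewrite !ffunE => /val_inj.
rewrite (eq_bigr (fun f => Phi [ffun k => M k : nat] *+ #|[set w | fixes w f]|)).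
  rewrite sumrMnr sum_stab -[Phi _ *+ _]mulr_natl mulKf //.
  by rewrite pnatr_eq0 -lt0n fact_gt0.
move=> f /eqP ->; rewrite ef0 -sum1dep_card -sumrMnr.
by apply: eq_bigr => w _.
Qed.

End Words.

Local Notation natfun M := (fun p => nat_of_ord (fun_of_fin M p)).

Section PairWords.

Variables (n : nat) (K K' : finType).

Definition rowmarg (M : K * K' -> nat) : {ffun K -> nat} :=
  [ffun k => (\sum_k' M (k, k'))%N].
Definition colmarg (M : K * K' -> nat) : {ffun K' -> nat} :=
  [ffun k' => (\sum_k M (k, k'))%N].

Lemma rowmarg_content (f : {ffun 'I_n -> K * K'}) :
  rowmarg (content f) = content [ffun x => (f x).1].
Proof.
apply/ffunP => k; rewrite !ffunE -sum1dep_card.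
rewrite (partition_big (fun x => (f x).2) predT) //=; apply: eq_bigr => k' _.
rewrite ffunE -sum1dep_card; apply: eq_bigl => x; rewrite ffunE.
by case: (f x) => ? ?; rewrite xpair_eqE.
Qed.

Lemma colmarg_content (f : {ffun 'I_n -> K * K'}) :
  colmarg (content f) = content [ffun x => (f x).2].
Proof.
apply/ffunP => k; rewrite !ffunE -sum1dep_card.
rewrite (partition_big (fun x => (f x).1) predT) //=; apply: eq_bigr => k' _.
rewrite ffunE -sum1dep_card; apply: eq_bigl => x; rewrite ffunE andbC.
by case: (f x) => ? ?; rewrite xpair_eqE.
Qed.

(** A pair of words fixed by w is a fixed word over the alphabet of pairs, and the two contents are
    the marginals of its content. *)
Lemma theta_mul (Phi : {ffun K -> nat} -> algC) (Psi : {ffun K' -> nat} -> algC) :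
  theta n Phi * theta n Psi =
  theta n (fun M : {ffun K * K' -> nat} => Phi (rowmarg M) * Psi (colmarg M)).
Proof.
apply/cfunP => w; rewrite cfmulE !thetaE big_distrlr /= pair_big /=.
pose split (f : {ffun 'I_n -> K * K'}) :=
  ([ffun x => (f x).1] : {ffun 'I_n -> K}, [ffun x => (f x).2] : {ffun 'I_n -> K'}).
rewrite (reindex split) /=; last first.
  exists (fun p : {ffun 'I_n -> K} * {ffun 'I_n -> K'} =>
          [ffun x => (p.1 x, p.2 x)]) => [f _|[f g] _].
    by apply/ffunP => x; rewrite !ffunE; case: (f x).
  by congr (_, _); apply/ffunP => x; rewrite !ffunE.
apply: eq_big => [f|f _]; last by rewrite rowmarg_content colmarg_content.
apply/andP/forallP => [[/forallP h1 /forallP h2] x|h].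
  have := h1 x; have := h2 x; rewrite !ffunE.
  by case: (f x) (f (w x)) => [? ?] [? ?] /= /eqP-> /eqP->.
by split; apply/forallP => x; rewrite !ffunE (eqP (h x)).
Qed.

Lemma theta_dot (Phi : {ffun K -> nat} -> algC) (Psi : {ffun K' -> nat} -> algC) :
  (forall M, (Psi M)^* = Psi M) ->
  '[theta n Phi, theta n Psi] =
  \sum_(M : {ffun K * K' -> 'I_n.+1} | (\sum_p M p)%N == n)
     Phi (rowmarg (natfun M)) * Psi (colmarg (natfun M)).
Proof.
move=> Psi_real.
have -> : '[theta n Phi, theta n Psi] = '[theta n Phi * theta n Psi, 1].
  rewrite !cfdotE; congr (_ * _); apply: eq_bigr => w _.
  rewrite cfmulE cfun1E inE rmorph1 mulr1; congr (_ * _).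
  by rewrite thetaE rmorph_sum; apply: eq_bigr => f _; apply: Psi_real.
rewrite theta_mul theta_dot1; apply: eq_bigr => M _.
by congr (Phi _ * Psi _); apply/ffunP => k; rewrite !ffunE; apply: eq_bigr => k' _;
  rewrite ffunE.
Qed.

End PairWords.

Lemma alternant_conj l (lam M : 'I_l -> nat) : (alternant lam M)^* = alternant lam M.
Proof.
rewrite /alternant rmorph_sum; apply: eq_bigr => sigma _.
by rewrite rmorphXn rmorphN1.
Qed.

(** * Inner products and orthonormality of the X_lam *)

Section SpechtCharacters.

Variable n : nat.
Implicit Types (lam gam : 'I_n -> nat).

Definition decr lam := forall i j : 'I_n, (i <= j)%N -> (lam j <= lam i)%N.

Definition spechtX lam : 'CF([set: 'S_n]) :=
  theta n (fun M : {ffun 'I_n -> nat} => alternant lam M).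

Section DotX.

Variables (K : finType) (pos : K -> nat).
Hypotheses (pos_inj : injective pos) (pos_lt : forall x, (pos x < #|K|)%N).

(** Once the arrays are sorted by their row sums [s], each class is an instance of [cancellation]
    with no links at all, where [semistd] holds vacuously and the weight [Phi] is constant. *)
Lemma theta_dotX (Phi : {ffun K -> nat} -> algC) lam : decr lam ->
  '[theta n Phi, spechtX lam] =
  \sum_(M : {ffun K * 'I_n -> 'I_n.+1} |
        [&& (\sum_p M p)%N == n, lattice pos M & [forall k, colsum M k == lam k]])
     Phi (rowmarg (natfun M)).
Proof.
move=> dlam; rewrite theta_dot; last by move=> M; apply: alternant_conj.
pose rowM (M : {ffun K * 'I_n -> 'I_n.+1}) : {ffun K -> 'I_n.+1} :=
  [ffun x => inord (\sum_(k < n) M (x, k))%N].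
have sumM (M : {ffun K * 'I_n -> 'I_n.+1}) :
    (\sum_p M p = \sum_x \sum_(k < n) M (x, k))%N.
  by rewrite pair_bigA; apply: eq_bigr => -[].
have rowME (M : {ffun K * 'I_n -> 'I_n.+1}) (s : {ffun K -> 'I_n.+1}) :
    ((\sum_p M p)%N == n) && (rowM M == s) =
    ((\sum_x s x)%N == n) && rowsums (natfun s) M.
  apply/andP/andP => [[/eqP sM /eqP <-]|[/eqP ss /forallP rs]].
    have e x : rowM M x = (\sum_(k < n) M (x, k))%N :> nat.
      by rewrite ffunE inordK // ltnS -[X in (_ <= X)%N]sM sumM (bigD1 x) //= leq_addr.
    split; last by apply/forallP => x; rewrite e.
    by under eq_bigr do rewrite e; rewrite -sumM sM.
  split; first by rewrite sumM -[X in _ == X]ss; apply/eqP/eq_bigr => x _; apply/eqP.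
  apply/eqP/ffunP => x; apply: val_inj; rewrite ffunE /= (eqP (rs x)).
  by rewrite inordK.
have Phirow (M : {ffun K * 'I_n -> 'I_n.+1}) (s : {ffun K -> 'I_n.+1}) :
    rowsums (natfun s) M -> Phi (rowmarg (natfun M)) = Phi [ffun x => s x : nat].
  by move=> /forallP rs; congr Phi; apply/ffunP => x; rewrite !ffunE (eqP (rs x)).
rewrite (partition_big rowM predT) //= [RHS](partition_big rowM predT) //=.
apply: eq_bigr => s _; rewrite (eq_bigl _ _ (rowME^~ s)).
have -> : \sum_(M : {ffun K * 'I_n -> 'I_n.+1} |
   [&& (\sum_p M p)%N == n, lattice pos M & [forall k, colsum M k == lam k]] &&
   (rowM M == s)) Phi (rowmarg (natfun M)) =
  \sum_(M : {ffun K * 'I_n -> 'I_n.+1} | ((\sum_x s x)%N == n) &&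
   (M \in [set a : {ffun K * 'I_n -> 'I_n.+1} | [&& rowsums (natfun s) a,
      semistd pos (fun=> 0%N) pred0 a, lattice pos a
     & [forall k, colsum a k == lam k]]])) Phi [ffun x => s x : nat].
  apply: eq_big => [M|M].
    rewrite andbAC rowME inE; have -> : semistd pos (fun=> 0%N) pred0 M.
      by apply/forallP => t; apply/forallP.
    by rewrite -!andbA.
  by rewrite andbAC rowME -!andbA => /and4P[_ /Phirow].
case: eqP => [ss /=|_]; last by rewrite !big_pred0.
have s_le x : (s x <= n)%N by rewrite -ltnS.
have lk_lt t : pred0 t -> (t.+1 < #|K|)%N by [].
have := cancellation pos_inj pos_lt (fun=> 0%N) s_le lk_lt dlam.
set S := [set a | _] => e.
rewrite big_const iter_addr_0 -mulr_natr -e mulr_sumr.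
apply: eq_big => [M|M /Phirow->].
  have -> : semistd pos (fun=> 0%N) pred0 M by apply/forallP => t; apply/forallP.
  by rewrite andbT.
by congr (_ * _); apply: eq_alternant => k; rewrite ffunE.
Qed.

End DotX.

Definition part (b : 'I_n -> nat) t := (\sum_(j < n | (j < t)%N) b j)%N.

Lemma partS b (j : 'I_n) : (part b j.+1 = part b j + b j)%N.
Proof.
rewrite /part (bigD1 j) //= addnC; congr (_ + _)%N; apply: eq_bigl => i.
by rewrite -val_eqE /=; lia.
Qed.

Lemma part_inj b c : (forall t, (t <= n)%N -> part b t = part c t) -> b =1 c.
Proof.
move=> e j; have := e _ (ltn_ord j); rewrite !partS (e j) ?(ltnW (ltn_ord j)) //.
by move/addnI.
Qed.

(** A numerical stand-in for dominance: by [rhowtE] it adds up all partial sums, so it is monotone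
    for the dominance order, and two comparable compositions with equal weight are equal. *)
Definition rhowt (b : 'I_n -> nat) := (\sum_(j < n) rho n j * b j)%N.

Lemma rhowtE b : rhowt b = (\sum_(t < n) part b t.+1)%N.
Proof.
rewrite /part (exchange_big_dep xpredT) //=; apply: eq_bigr => j _.
rewrite sum_nat_const; congr (_ * _)%N; rewrite -sum1_card.
rewrite (eq_bigl (fun t : 'I_n => true && (j <= t)%N)) //.
by rewrite -(big_geq_mkord _ _ xpredT (fun=> 1%N)) sum_nat_const_nat muln1.
Qed.

Lemma rhowt_dom b c : (forall t, (t <= n)%N -> (part b t <= part c t)%N) ->
  (rhowt b <= rhowt c)%N /\ ((rhowt c <= rhowt b)%N -> b =1 c).
Proof.
move=> h; rewrite !rhowtE; have h' (t : 'I_n) : (part b t.+1 <= part c t.+1)%N by apply: h.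
have [le eqc] := leqif_sum (fun t (_ : true) => conj (h' t) (erefl (part b t.+1 == part c t.+1))).
split=> // ge; have {}ge : [forall t : 'I_n, part b t.+1 == part c t.+1].
  by rewrite -eqc eqn_leq le.
apply: part_inj => -[|t] lt_t; first by rewrite /part !big_pred0.
exact/eqP/(forallP ge (Ordinal lt_t)).
Qed.

Definition xi (K : finType) (b : {ffun K -> nat}) : 'CF([set: 'S_n]) :=
  theta n (fun M : {ffun K -> nat} => (M == b)%:R).

Definition is_kostka lam (M : {ffun 'I_n * 'I_n -> 'I_n.+1}) :=
  [&& (\sum_p M p)%N == n, lattice val M & [forall k, colsum M k == lam k]].

(** An entry (t, k) of such a matrix is the number of letters t in row k of a semistandard tableau
    of shape lam, the lattice condition being column strictness; so this is the Kostka number of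
    shape lam and content b. *)
Definition kostka lam (b : {ffun 'I_n -> nat}) : nat :=
  #|[set M | is_kostka lam M && (rowmarg (natfun M) == b)]|.

Lemma ord_pos_lt (j : 'I_n) : (val j < #|'I_n|)%N.
Proof. by rewrite card_ord; apply: ltn_ord. Qed.

Lemma xi_dotX (b : {ffun 'I_n -> nat}) lam : decr lam ->
  '[xi b, spechtX lam] = (kostka lam b)%:R.
Proof.
move=> dlam; rewrite (theta_dotX val_inj ord_pos_lt) // /kostka -sum1dep_card natr_sum.
rewrite big_mkcond [RHS]big_mkcond /=; apply: eq_bigr => M _; rewrite -/(is_kostka lam M).
by case: (is_kostka _ _) => //=; case: ifP.
Qed.

Section KostkaMatrix.

Variables (lam : 'I_n -> nat) (M : {ffun 'I_n * 'I_n -> 'I_n.+1}).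
Hypothesis kM : is_kostka lam M.

Let A := natof val M.

Lemma kostka_lattice t k : (t < n)%N -> (psum (A^~ k.+1) t.+1 <= psum (A^~ k) t)%N.
Proof.
move=> lt_t; have [lt_k|le_k] := ltnP k n; last first.
  by rewrite {1}/psum big1 // => i _; rewrite /A natof_rect ?(leqW le_k) ?orbT // => j; apply: ord_pos_lt.
have /and3P[_ /forallP la _] := kM; rewrite -(card_ord n) in lt_t.
by have /forallP/(_ (Ordinal lt_k)) := la (Ordinal lt_t); rewrite /viol -leqNgt.
Qed.

(** In a semistandard tableau the entries of row k are at least k, counting both from 0. *)
Lemma kostka_upper t k : (t <= n)%N -> (t <= k)%N -> psum (A^~ k) t = 0%N.
Proof.
elim: t k => [|t IH] [|k] // lt_t lt_k; first exact: psum0.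
  exact: psum0.
by apply/eqP; rewrite -leqn0 -(IH k) ?kostka_lattice // ltnW.
Qed.

Lemma kostka_col t (k : 'I_n) : (t <= n)%N -> (psum (A^~ k) t <= lam k)%N.
Proof.
move=> le_t; have /and3P[_ _ /forallP/(_ k)/eqP <-] := kM.
rewrite (colsumE val_inj ord_pos_lt); apply: leq_psum.
by rewrite card_ord.
Qed.

Lemma kostka_part t : (t <= n)%N ->
  part (rowmarg (natfun M)) t = (\sum_(k < n | (k < t)%N) psum (A^~ k) t)%N.
Proof.
move=> le_t; have -> : (\sum_(k < n | (k < t)%N) psum (A^~ k) t = \sum_(k < n) psum (A^~ k) t)%N.
  rewrite [RHS](bigID (fun k : 'I_n => (k < t)%N)) /= [X in (_ + X)%N]big1 ?addn0 //.
  by move=> k; rewrite -leqNgt => /kostka_upper->.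
rewrite /part; under eq_bigr do rewrite ffunE.
rewrite exchange_big; apply: eq_bigr => k _.
by rewrite (psum_col val_inj ord_pos_lt) // card_ord.
Qed.

Lemma kostka_dom t : (t <= n)%N -> (part (rowmarg (natfun M)) t <= part lam t)%N.
Proof. by move=> le_t; rewrite kostka_part //; apply: leq_sum => k _; apply: kostka_col. Qed.

Lemma kostka_diagE : rowmarg (natfun M) =1 lam ->
  M = [ffun p => if p.1 == p.2 then inord (lam p.1) else ord0].
Proof.
move=> e; have colE t (k : 'I_n) : (t <= n)%N ->
    psum (A^~ k) t = if (k < t)%N then lam k else 0%N.
  move=> le_t; case: ltnP => [lt_k|/kostka_upper->//].
  have h (i : 'I_n) : (i < t)%N -> (psum (A^~ i) t <= lam i)%N by move=> _; apply: kostka_col.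
  have [_] := leqif_sum (fun i hi => conj (h i hi) (erefl (psum (A^~ i) t == lam i))).
  rewrite -kostka_part // /part (eq_bigr lam) => [|i _]; last exact: e.
  by rewrite eqxx => /esym/forallP/(_ k)/implyP/(_ lt_k)/eqP.
apply/ffunP => -[t k]; apply: val_inj; rewrite ffunE /=.
have := colE t.+1 k (ltn_ord t); rewrite psumS colE ?(ltnW (ltn_ord t)) //.
rewrite /A -[X in (_ + X)%N]/(natof val M (val t) k) (natofE val_inj).
case: eqP => [<-|ne]; last first.
  have {}ne : (t : nat) <> k by move/val_inj.
  rewrite -[nat_of_ord ord0]/0%N; case: (ltnP k t) => h1; case: (ltnP k t.+1) => h2 h3 //; try lia.
  by apply/eqP; rewrite -(eqn_add2l (lam k)) h3 addn0.
by rewrite ltnn ltnSn add0n => <-; rewrite inord_val.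
Qed.

End KostkaMatrix.

Lemma kostka_diag lam (b : {ffun 'I_n -> nat}) : decr lam -> (\sum_k lam k = n)%N ->
  b =1 lam -> kostka lam b = 1%N.
Proof.
move=> dlam sumlam eb.
pose M0 : {ffun 'I_n * 'I_n -> 'I_n.+1} :=
  [ffun p => if p.1 == p.2 then inord (lam p.1) else ord0].
have M0E i j : M0 (i, j) = (if i == j then lam i else 0)%N :> nat.
  rewrite ffunE /=; case: ifP => // _; rewrite inordK // ltnS -[X in (_ <= X)%N]sumlam.
  by rewrite (bigD1 i) //= leq_addr.
have row0 i : (\sum_j M0 (i, j) = lam i)%N.
  rewrite (bigD1 i) //= M0E eqxx big1 ?addn0 // => j ne.
  by rewrite M0E eq_sym (negbTE ne).
have kM0 : is_kostka lam M0.
  apply/and3P; split; last first.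
  - apply/forallP => k; rewrite /colsum (bigD1 k) //= M0E eqxx big1 ?addn0 // => j ne.
    by rewrite M0E (negbTE ne).
  - apply/forallP => -[t lt_t]; apply/forallP => k; rewrite /viol /= -leqNgt.
    rewrite card_ord in lt_t; have [lt_k|le_k] := ltnP k.+1 n; last first.
      by rewrite {1}/psum big1 // => i _; rewrite natof_rect ?le_k ?orbT // => j; apply: ord_pos_lt.
    rewrite (psum_col val_inj ord_pos_lt _ k) ?card_ord ?(ltnW lt_t) //.
    rewrite (psum_col val_inj ord_pos_lt _ (Ordinal lt_k)) ?card_ord //.
    under eq_bigr do rewrite M0E; under [X in (_ <= X)%N]eq_bigr do rewrite M0E.
    rewrite -!big_mkcondr.
    have [lt_kt|le_tk] := ltnP k t; last first.
      rewrite big_pred0 // => i; apply/negbTE/negP => /andP[lt_i /eqP ei].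
      by move: lt_i; rewrite ei /=; lia.
    rewrite (big_pred1 (Ordinal lt_k)) => [|i]; last first.
      by rewrite /= andbC; case: eqP => [->|] //=; rewrite ltnS lt_kt.
    rewrite (big_pred1 k) => [|i].
      by apply: dlam; apply: leqnSn.
    by rewrite /= andbC; case: eqP => [->|] //=; rewrite lt_kt.
  - have -> : (\sum_p M0 p = \sum_i \sum_j M0 (i, j))%N.
      by rewrite pair_bigA; apply: eq_bigr => -[].
    by rewrite (eq_bigr _ (fun i _ => row0 i)) sumlam.
apply/eqP/cards1P; exists M0; apply/setP => M; rewrite !inE.
apply/andP/eqP => [[kM /eqP eM]|->].
  by apply: (kostka_diagE kM) => k; rewrite eM.
by split=> //; apply/eqP/ffunP => i; rewrite ffunE row0 eb.
Qed.

(** The Jacobi-Trudi term [M j] = lam j - j + sigma j. Compared with [dotmatch], sigma is inverted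
    and M relabelled, so that M and lam can be compared index by index. *)
Definition altmatch lam (M : 'I_n -> nat) (sigma : 'S_n) :=
  [forall j, M j + rho n (sigma j) == lam j + rho n j]%N.

Definition alternant' lam (M : 'I_n -> nat) : algC :=
  \sum_(sigma : 'S_n | altmatch lam M sigma) (-1) ^+ sigma.

(** Renaming the letters of a word does not change the permutations that fix it, so for each sigma
    the sum over words may be reindexed by the renaming sigma. *)
Lemma spechtX_alt lam :
  spechtX lam = theta n (fun M : {ffun 'I_n -> nat} => alternant' lam M).
Proof.
apply/cfunP => w; rewrite !thetaE /alternant /alternant'.
under eq_bigr do rewrite big_mkcond; under [RHS]eq_bigr do rewrite big_mkcond.
rewrite exchange_big [RHS]exchange_big (reindex_inj invg_inj) /=.
apply: eq_bigr => sigma _; rewrite odd_permV.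
pose relab (s : 'S_n) (f : {ffun 'I_n -> 'I_n}) : {ffun 'I_n -> 'I_n} := [ffun x => s (f x)].
have relabK s : cancel (relab s) (relab s^-1%g).
  by move=> f; apply/ffunP => x; rewrite !ffunE permK.
rewrite (reindex_inj (can_inj (relabK sigma))) /=.
have cont f j : content (relab sigma f) j = content f ((sigma^-1)%g j).
  by rewrite !ffunE; apply: eq_card => x; rewrite !inE ffunE (can2_eq (permK _) (permKV _)).
apply: eq_big => [f|f _].
  apply/forallP/forallP => h x; have := h x; rewrite !ffunE; last by move/eqP->.
  by rewrite (inj_eq perm_inj).
congr (if _ then _ else _); apply/forallP/forallP => h j.
  by have := h (sigma j); rewrite cont permK.
by rewrite cont; have := h ((sigma^-1)%g j); rewrite permKV.
Qed.

(** This is the rearrangement inequality for [rho] against its permutation by sigma, obtained from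
    2xy <= x^2 + y^2 term by term; equality forces [rho] to agree at j and sigma j, and [rho] is
    injective. *)
Lemma altmatch_rhowt lam M sigma : altmatch lam M sigma ->
  (rhowt lam <= rhowt M)%N /\ ((rhowt M <= rhowt lam)%N -> sigma = 1%g).
Proof.
move=> /forallP h.
have e : (rhowt M + \sum_(j < n) rho n j * rho n (sigma j) =
          rhowt lam + \sum_(j < n) rho n j * rho n j)%N.
  by rewrite -!big_split; apply: eq_bigr => j _ /=; rewrite -!mulnDr (eqP (h j)).
have rearr (j : 'I_n) : (2 * (rho n j * rho n (sigma j)) <=
    rho n j * rho n j + rho n (sigma j) * rho n (sigma j)
    ?= iff (rho n j == rho n (sigma j)))%N.
  by rewrite !mulnn; apply: nat_Cauchy.
have [le eqc] : (\sum_(j < n) 2 * (rho n j * rho n (sigma j)) <=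
    \sum_(j < n) (rho n j * rho n j + rho n (sigma j) * rho n (sigma j))
    ?= iff [forall j : 'I_n, rho n j == rho n (sigma j)])%N.
  by apply: leqif_sum => j _; apply: rearr.
have e2 : (\sum_(j < n) 2 * (rho n j * rho n (sigma j)) =
           2 * \sum_(j < n) rho n j * rho n (sigma j))%N by rewrite big_distrr.
have e3 : (\sum_(j < n) (rho n j * rho n j + rho n (sigma j) * rho n (sigma j)) =
           2 * \sum_(j < n) rho n j * rho n j)%N.
  rewrite big_split mul2n -addnn; congr (_ + _)%N.
  by rewrite [RHS](reindex_inj (@perm_inj _ sigma)).
move: le eqc; rewrite e2 e3.
move=> le eqc; split=> [|ge]; first by lia.
have {}eqc : [forall j : 'I_n, rho n j == rho n (sigma j)] by rewrite -eqc; lia.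
apply/permP => j; rewrite perm1; apply: val_inj => /=.
by have := eqP (forallP eqc j); rewrite /rho; have := ltn_ord j; have := ltn_ord (sigma j); lia.
Qed.

Lemma spechtX_dot_rhowt mu lam : decr lam -> '[spechtX mu, spechtX lam] != 0 ->
  exists M sigma, [/\ is_kostka lam M, altmatch mu (rowmarg (natfun M)) sigma
    & (rhowt mu <= rhowt lam)%N].
Proof.
move=> dlam; rewrite spechtX_alt (theta_dotX val_inj ord_pos_lt) // => /eqP ne0.
have [/existsP[M /andP[kM /existsP[sigma ms]]]|none] :=
  boolP [exists M : {ffun 'I_n * 'I_n -> 'I_n.+1}, is_kostka lam M &&
    [exists sigma, altmatch mu (rowmarg (natfun M)) sigma]].
  exists M, sigma; split=> //.
  have [le _] := altmatch_rhowt ms; apply: leq_trans le _.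
  by have [] := rhowt_dom (fun t => @kostka_dom _ _ kM t).
case: ne0; apply: big1 => M kM; rewrite /alternant' big_pred0 // => sigma.
apply/negbTE/negP => ms; case/negP: none; apply/existsP; exists M.
by rewrite /is_kostka kM; apply/existsP; exists sigma.
Qed.

(** A nonzero product yields a chain of weights from mu through a row marginal M to lam, and by
    conjugate symmetry also a bound in the other direction. Equality throughout forces sigma = 1 and
    mu = M = lam. *)
Lemma spechtX_orth mu lam : decr mu -> decr lam ->
  '[spechtX mu, spechtX lam] != 0 -> mu =1 lam.
Proof.
move=> dmu dlam ne0; have [M [sigma [kM ms le1]]] := spechtX_dot_rhowt dlam ne0.
have ne0' : '[spechtX lam, spechtX mu] != 0 by rewrite cfdotC fmorph_eq0.
have [_ [_ [_ _ le2]]] := spechtX_dot_rhowt dmu ne0'.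
have [le3 eq3] := altmatch_rhowt ms.
have [le4 eq4] := rhowt_dom (fun t => @kostka_dom _ _ kM t).
have s1 : sigma = 1%g by apply: eq3; apply: leq_trans le4 _.
move=> j; rewrite -eq4; last by apply: leq_trans le2 _.
by have /forallP/(_ j) := ms; rewrite s1 perm1 eqn_add2r => /eqP.
Qed.

(** Both ends of the weight chain agree, so the only surviving contribution is the diagonal matrix
    together with the identity permutation. *)
Lemma spechtX_norm lam : decr lam -> (\sum_k lam k = n)%N -> '[spechtX lam] = 1.
Proof.
move=> dlam sumlam; rewrite {1}spechtX_alt (theta_dotX val_inj ord_pos_lt) //.
have kd := kostka_diag (b := [ffun k => lam k]) dlam sumlam (ffunE _).
have -> : 1 = (kostka lam [ffun k => lam k])%:R :> algC by rewrite kd.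
rewrite /kostka -sum1dep_card natr_sum (bigID (fun M : {ffun 'I_n * 'I_n -> 'I_n.+1} => rowmarg (natfun M) == [ffun k => lam k])) /=.
rewrite [X in _ + X]big1 ?addr0 => [|M /andP[kM ne]].
  apply: eq_bigr => M /andP[kM /eqP e]; rewrite /alternant' (big_pred1 1%g) ?odd_perm1 // => sigma.
  rewrite pred1E; apply/idP/eqP => [|<-]; last first.
    by apply/forallP => j; rewrite e ffunE perm1.
  case/altmatch_rhowt => _ <- //; rewrite e /rhowt.
  by under eq_bigr do rewrite ffunE.
rewrite /alternant' big_pred0 // => sigma; apply/negbTE/negP => ms.
have [le3 eq3] := altmatch_rhowt ms.
have [le4 eq4] := rhowt_dom (fun t => @kostka_dom _ _ kM t).
by case/eqP: ne; apply/ffunP => j; rewrite eq4 // ffunE.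
Qed.

End SpechtCharacters.

(** * Irreducibility and completeness *)

Section Induced.

Variable n : nat.

Lemma Ind1_xi (K : finType) (H : {group 'S_n}) (f0 : {ffun 'I_n -> K}) :
  (forall w, (w \in H) = fixes w f0) -> 'Ind[[set: 'S_n]] (1 : 'CF(H)) = xi n (content f0).
Proof.
move=> HE; apply/cfunP => w; rewrite cfIndE ?subsetT // thetaE.
have cosetH f : content f == content f0 -> #|[set y | precomp y f0 == f]| = #|H|.
  move/eqP/content_eq_precomp => [u ->]; rewrite -(card_imset H (mulgI u)).
  apply: eq_card => y; rewrite !inE; apply/eqP/imsetP => [e|[h]].
    exists (u^-1 * y)%g; last by rewrite mulKVg.
    by rewrite HE fixesE -precompM e precompK eqxx.
  by rewrite HE fixesE => /eqP e ->; rewrite -precompM e.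
rewrite (eq_bigr (fun y => (fixes w (precomp y f0))%:R)); last first.
  by move=> y _; rewrite cfun1E HE fixesJ.
rewrite (eq_bigl xpredT) => [|y]; last by rewrite inE.
rewrite (partition_big (fun y => precomp y f0) (fun f => content f == content f0)) /=; last first.
  by move=> y _; rewrite content_precomp.
rewrite mulr_sumr big_mkcond [RHS]big_mkcond /=; apply: eq_bigr => f _.
case: ifP => [cf|_]; last by case: ifP.
rewrite (eq_bigr (fun=> (fixes w f)%:R)) => [|y /eqP-> //].
rewrite sumr_const -(cosetH f cf) cardsE -[X in _ * X]mulr_natl mulKf; first by case: ifP.
by rewrite pnatr_eq0 -cardsE (cosetH f cf) -lt0n cardG_gt0.
Qed.

Lemma stab_group_set (K : finType) (f0 : {ffun 'I_n -> K}) :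
  group_set [set w : 'S_n | fixes w f0].
Proof.
apply/group_setP; split=> [|u v]; first by rewrite inE fixesE precomp1.
by rewrite !inE !fixesE => /eqP eu /eqP ev; rewrite -precompM ev eu.
Qed.

Definition stab_group (K : finType) (f0 : {ffun 'I_n -> K}) := Group (stab_group_set f0).

Lemma xi_char (K : finType) (b : {ffun K -> nat}) :
  (\sum_k b k = n)%N -> (xi n b : 'CF([set: 'S_n])) \is a character.
Proof.
move=> /content_exists[f0 <-]; rewrite -(@Ind1_xi _ (stab_group f0)) => [|w].
  by rewrite cfInd_char ?rpred1.
by rewrite inE.
Qed.

(** Replacing each letter by a position at which it occurs gives a word over ['I_n] with the same
    stabilizer, and the permutation character depends on the stabilizer only. *)
Lemma xi_ord (K : finType) (b : {ffun K -> nat}) : (\sum_k b k = n)%N ->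
  exists2 c : {ffun 'I_n -> nat}, (\sum_k c k = n)%N & xi n b = xi n c :> 'CF([set: 'S_n]).
Proof.
move=> /content_exists[f0 <-].
pose f1 : {ffun 'I_n -> 'I_n} := [ffun x => odflt x [pick y | f0 y == f0 x]].
have f01 x : f0 (f1 x) = f0 x.
  by rewrite ffunE; case: pickP => [y /eqP|] //=.
have f1E x y : (f1 x == f1 y) = (f0 x == f0 y).
  apply/eqP/eqP => [e|e]; first by rewrite -f01 e f01.
  rewrite !ffunE (eq_pick (fun z => congr1 (eq_op (f0 z)) e)).
  by case: pickP => //= /(_ y); rewrite eqxx.
exists (content f1); first exact: sum_content.
rewrite -(@Ind1_xi _ (stab_group f0)) => [|w]; last by rewrite inE.
apply: Ind1_xi => w; rewrite inE.
by apply/forallP/forallP => h x; have := h x; rewrite f1E.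
Qed.

Lemma theta_xi (K : finType) (Phi : {ffun K -> nat} -> algC) :
  theta n Phi = \sum_(M : {ffun K -> 'I_n.+1} | (\sum_k M k)%N == n)
    Phi [ffun k => M k : nat] *: xi n [ffun k => M k : nat].
Proof.
apply/cfunP => w; rewrite sum_cfunE thetaE.
under [RHS]eq_bigr do rewrite cfunE thetaE mulr_sumr.
rewrite exchange_big /=; apply: eq_bigr => f _.
have le k : (content f k < n.+1)%N.
  by rewrite ltnS -[X in (_ <= X)%N](sum_content f) (bigD1 k) //= leq_addr.
pose M0 : {ffun K -> 'I_n.+1} := [ffun k => inord (content f k)].
have M0E : [ffun k => M0 k : nat] = content f.
  by apply/ffunP => k; rewrite [LHS]ffunE [M0 k]ffunE inordK.
rewrite (bigD1 M0) /=; last first.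
  by rewrite -[X in _ == X](sum_content f) -M0E; apply/eqP/eq_bigr => k _; rewrite ffunE.
rewrite M0E eqxx mulr1 big1 ?addr0 // => M /andP[_ ne].
case: eqP => [e|]; last by rewrite mulr0.
by case/eqP: ne; apply/ffunP => k; apply: val_inj; rewrite [M0 k]ffunE e ffunE inord_val.
Qed.

Lemma alternant_int l (lam M : 'I_l -> nat) : alternant lam M \in Num.int.
Proof. by apply: rpred_sum => sigma _; rewrite rpredX // rpredN1. Qed.

Lemma spechtX_vchar lam : (spechtX lam : 'CF([set: 'S_n])) \in 'Z[irr [set: 'S_n]]%g.
Proof.
rewrite /spechtX theta_xi; apply: rpred_sum => M /eqP sM.
apply: scale_zchar; first exact: alternant_int.
by apply: char_vchar; apply: xi_char; under eq_bigr do rewrite ffunE.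
Qed.

(** A virtual character of norm 1 is irreducible up to sign. The minus sign is excluded by the inner
    product 1 with the genuine character [xi] of content lam. *)
Lemma spechtX_irr lam : decr lam -> (\sum_k lam k = n)%N ->
  exists i, spechtX lam = 'chi[[set: 'S_n]]_i.
Proof.
move=> dlam sumlam; have [b [i e]] := vchar_norm1P (spechtX_vchar lam) (spechtX_norm dlam sumlam).
exists i; case: b e => /= e; last by rewrite e scale1r.
have sb : (\sum_k [ffun k : 'I_n => lam k] k = n)%N by under eq_bigr do rewrite ffunE.
have := xi_dotX [ffun k => lam k] dlam; rewrite kostka_diag //; last exact: ffunE.
rewrite e expr1 cfdotZr rmorphN1 mulN1r => /eqP; rewrite eqr_oppLR => /eqP h.
have := Cnat_cfdot_char_irr i (xi_char sb); rewrite h => /natr_ge0.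
by rewrite oppr_ge0 ler10.
Qed.

Lemma xi_perm (b : {ffun 'I_n -> nat}) (s : 'S_n) : xi n [ffun j => b (s j)] = xi n b :> 'CF([set: 'S_n]).
Proof.
apply/cfunP => w; rewrite !thetaE.
pose relab (s : 'S_n) (f : {ffun 'I_n -> 'I_n}) : {ffun 'I_n -> 'I_n} := [ffun x => s (f x)].
have relabK u : cancel (relab u) (relab u^-1%g).
  by move=> f; apply/ffunP => x; rewrite !ffunE permK.
rewrite [RHS](reindex_inj (can_inj (relabK s))) /=.
have cont f j : content (relab s f) j = content f ((s^-1)%g j).
  by rewrite !ffunE; apply: eq_card => x; rewrite !inE ffunE (can2_eq (permK _) (permKV _)).
apply: eq_big => [f|f _].
  apply/forallP/forallP => h x; have := h x; rewrite !ffunE; first by move/eqP->.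
  by rewrite (inj_eq perm_inj).
congr ((nat_of_bool _)%:R); apply/idP/idP => /eqP/ffunP e; apply/eqP/ffunP => j.
  by rewrite cont e ffunE permKV.
by have := e (s j); rewrite cont permK => ->; rewrite ffunE.
Qed.

End Induced.

Section Span.

Variables (n : nat) (phi : 'CF([set: 'S_n])).
Hypothesis phi_orth : forall lam : {ffun 'I_n -> 'I_n.+1}, decr (natfun lam) ->
  (\sum_k lam k = n)%N -> '[spechtX (natfun lam), phi] = 0.

Lemma rhowt_le (b : 'I_n -> nat) : (\sum_k b k = n)%N -> (rhowt b <= n * n)%N.
Proof.
move=> sb; rewrite -{3}sb big_distrr /=; apply: leq_sum => j _.
by rewrite leq_mul2r leq_subr orbT.
Qed.

(** Downward induction on [rhowt], which is at most n * n. Moving a larger part forward raises the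
    weight and keeps [xi]; for a decreasing content the Jacobi-Trudi expansion of X_b is [xi] of b
    plus terms of strictly larger weight. *)
Lemma xi_orth (b : {ffun 'I_n -> nat}) : (\sum_k b k = n)%N -> '[xi n b, phi] = 0.
Proof.
have [m] := ubnP (n * n - rhowt b)%N; elim: m b => // m IH b lt_m sb.
have IH' (c : {ffun 'I_n -> nat}) : (rhowt b < rhowt c)%N -> (\sum_k c k = n)%N ->
    '[xi n c, phi] = 0.
  by move=> lt_c sc; apply: IH => //; have := rhowt_le sb; have := rhowt_le sc; lia.
have [/existsP[i /existsP[j /andP[lt_ij lt_b]]]|ndec] :=
    boolP [exists i : 'I_n, exists j : 'I_n, (i < j)%N && (b i < b j)%N].
  rewrite -(xi_perm b (tperm i j)); apply: IH'; last first.
    under eq_bigr do rewrite ffunE; rewrite -[RHS]sb.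
    by rewrite [RHS](reindex_inj (@perm_inj _ (tperm i j))).
  rewrite /rhowt; have ne : j != i by rewrite -val_eqE gtn_eqF.
  rewrite (bigD1 i) // (bigD1 j) //= [X in (_ < X)%N](bigD1 i) // (bigD1 j) //=.
  rewrite !ffunE tpermL tpermR.
  under [X in (_ < _ + (_ + X))%N]eq_bigr => k /andP[ki kj] do rewrite ffunE tpermD 1?eq_sym //.
  have lt_rho : (rho n j < rho n i)%N by rewrite /rho; have := ltn_ord j; lia.
  by rewrite !addnA ltn_add2r; nia.
have dec : decr b.
  move=> i j; rewrite leq_eqVlt => /orP[/eqP/val_inj-> //|lt_ij].
  rewrite leqNgt; apply/negP => lt_b; case/existsP: ndec.
  by exists i; apply/existsP; exists j; rewrite lt_ij.
have lb k : (b k < n.+1)%N by rewrite ltnS -[X in (_ <= X)%N]sb (bigD1 k) //= leq_addr.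
pose lam : {ffun 'I_n -> 'I_n.+1} := [ffun k => inord (b k)].
have lamE k : lam k = b k :> nat by rewrite ffunE inordK.
have dlam : decr (natfun lam) by move=> i j; rewrite !lamE; apply: dec.
have slam : (\sum_k lam k = n)%N by under eq_bigr do rewrite lamE.
have := phi_orth dlam slam; rewrite spechtX_alt theta_xi cfdot_suml.
rewrite (bigD1 lam) ?slam //= => e.
have natlam : [ffun k => lam k : nat] = b by apply/ffunP => k; rewrite ffunE lamE.
have eqw : rhowt (natfun lam) = rhowt b by apply: eq_bigr => k _; rewrite lamE.
move: e; rewrite natlam big1 ?addr0 => [|M /andP[/eqP sM neM]].
  rewrite cfdotZl /alternant' (big_pred1 1%g) ?odd_perm1 ?mul1r // => s.
  rewrite pred1E; apply/idP/eqP => [ms|<-]; last first.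
    by apply/forallP => k; rewrite perm1 lamE.
  apply/esym; apply: (altmatch_rhowt ms).2.
  by rewrite eqw.
rewrite cfdotZl; set M' := [ffun k => _].
have [/existsP[s ms]|none] := boolP [exists s, altmatch (natfun lam) M' s]; last first.
  rewrite /alternant' big_pred0 ?mul0r // => s; apply/negbTE/negP => ms.
  by case/existsP: none; exists s.
rewrite IH' ?mulr0 //; last by under eq_bigr do rewrite ffunE.
rewrite ltnNge; apply/negP => le; case/eqP: neM; apply/ffunP => k; apply: val_inj.
have := forallP ms k; rewrite ((altmatch_rhowt ms).2 _) ?eqw // perm1 eqn_add2r.
by rewrite ffunE => /eqP.
Qed.

Lemma theta_orth (K : finType) (Phi : {ffun K -> nat} -> algC) : '[theta n Phi, phi] = 0.
Proof.
rewrite theta_xi cfdot_suml big1 // => M /eqP sM; rewrite cfdotZl.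
have [|c sc ->] := @xi_ord n K [ffun k => M k : nat].
  by under eq_bigr do rewrite ffunE.
by rewrite xi_orth ?mulr0.
Qed.

End Span.

Section SignInduced.

Variables (n : nat) (K : finType) (H : {group 'S_n}) (f1 : {ffun 'I_n -> K}).
Hypothesis HE : forall w, (w \in H) = fixes w f1.

Definition blockinj (K' : finType) (f : {ffun 'I_n -> K'}) :=
  [forall x, forall y, (f1 x == f1 y) && (f x == f y) ==> (x == y)].

Lemma sign_cfunE w : sign_cfun n w = (-1) ^+ w.
Proof. by rewrite cfunE. Qed.

Lemma sign_char : sign_cfun n \is a character.
Proof.
have sgR : mx_repr [set: 'S_n] (fun w : 'S_n => ((-1) ^+ w)%:M : 'M[algC]_1).
  split=> [|u v _ _]; first by rewrite odd_perm1.
  by rewrite odd_permM signr_addb scalar_mxM.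
suff -> : sign_cfun n = cfRepr (MxRepresentation sgR) by apply: cfRepr_char.
apply/cfunP => w; rewrite sign_cfunE cfunE inE /= mulr1n.
by rewrite mxtrace_scalar.
Qed.

(** Frobenius reciprocity leaves, for each word f, the sum of the signs of the elements of H fixing
    f. If f repeats a letter within a block, the transposition of the two positions cancels these
    signs in pairs; otherwise only the identity fixes f. *)
Lemma xi_dot_sign (b : {ffun 'I_n -> nat}) :
  '[xi n b, 'Ind[[set: 'S_n]] ('Res[H] (sign_cfun n))] =
  #|[set f : {ffun 'I_n -> 'I_n} | (content f == b) && blockinj f]|%:R / #|H|%:R.
Proof.
rewrite -cfdot_Res_l cfdotE mulrC; congr (_ * _).
rewrite (eq_bigr (fun w => \sum_(f : {ffun 'I_n -> 'I_n} | (content f == b) && fixes w f) (-1) ^+ w)); last first.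
  move=> w Hw; rewrite !cfResE ?subsetT // sign_cfunE thetaE rmorphXn rmorphN1 mulr_suml.
  rewrite big_mkcond [RHS]big_mkcond; apply: eq_bigr => f _; rewrite andbC.
  by case: (fixes w f) => //=; case: (content f == b); rewrite ?mul1r ?mul0r.
rewrite (exchange_big_dep (fun f : {ffun 'I_n -> 'I_n} => content f == b)) /=; last by move=> w f _ /andP[].
rewrite -sum1dep_card natr_sum big_mkcondr; apply: eq_bigr => f /eqP cf.
case: ifP => [/forallP bf|/negbT/forallPn[x /forallPn[y]]].
  rewrite (big_pred1 1%g) ?odd_perm1 // => w; rewrite pred1E cf eqxx /= HE.
  apply/andP/eqP => [[/forallP h1 /forallP h2]|<-]; last by rewrite !fixesE !precomp1.
  apply/permP => x; rewrite perm1; have /forallP/(_ (w x)) := bf x.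
  by rewrite [f1 x == _]eq_sym h1 [f x == _]eq_sym h2 => /eqP.
rewrite negb_imply => /andP[/andP[/eqP e1 /eqP e2] ne].
have fixt (K' : finType) (g : {ffun 'I_n -> K'}) : g x = g y -> precomp (tperm x y) g = g.
  by move=> e; apply/ffunP => z; rewrite ffunE; case: tpermP => [->|->|].
set S := \sum_(w | _) _; suff : S = - S by move/esym/eqP; rewrite eqNr => /eqP.
rewrite {1}/S (reindex_inj (mulgI (tperm x y))) -sumrN; apply: eq_big => [w|w _].
  by rewrite !HE !fixesE -!precompM !(can2_eq (precompK _) (precompKV _)) tpermV !fixt.
by rewrite odd_mul_tperm ne addTb signrN.
Qed.

End SignInduced.

(** * Identification with the Specht characters *)

Lemma iota0_index n : iota 0 n = index_iota 0 n.
Proof. by rewrite /index_iota subn0. Qed.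

Lemma sum_reshape (sh : seq nat) (F : nat -> nat -> nat) n : sumn sh = n ->
  (\sum_(x < n) F (reshape_index sh x) (reshape_offset sh x) =
   \sum_(i < size sh) \sum_(j < nth 0 sh i) F i j)%N.
Proof.
move=> <-; pose ss := [seq [seq (i, j) | j <- iota 0 (nth 0%N sh i)] | i <- iota 0 (size sh)].
have shE : shape ss = sh.
  apply: (@eq_from_nth _ 0%N) => [|i]; rewrite /shape !size_map size_iota // => lt_i.
  rewrite (nth_map [::]) ?size_map ?size_iota //.
  by rewrite (nth_map 0%N) ?size_iota // nth_iota // size_map size_iota.
have nthE (x : 'I_(sumn sh)) :
    nth (0, 0)%N (flatten ss) x = (reshape_index sh x, reshape_offset sh x).
  rewrite nth_flatten shE; have lt_i := reshape_indexP (ltn_ord x).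
  have lt_o := reshape_offsetP (ltn_ord x).
  rewrite (nth_map 0%N) ?size_iota // nth_iota // add0n.
  by rewrite (nth_map 0%N) ?size_iota // nth_iota // add0n.
transitivity (\sum_(p <- flatten ss) F p.1 p.2)%N.
  rewrite (big_nth (0, 0)%N) big_mkord size_flatten shE.
  by apply: eq_bigr => x _; rewrite nthE.
rewrite big_flatten big_map iota0_index big_mkord.
apply: eq_bigr => i _; rewrite big_map.
by rewrite iota0_index big_mkord.
Qed.

Lemma sorted_geq_nth (s : seq nat) i j : sorted geq s -> (i <= j)%N ->
  (nth 0 s j <= nth 0 s i)%N.
Proof.
move=> srt le_ij; have [lt_j|le_j] := ltnP j (size s); last by rewrite nth_default.
have trg : transitive geq by move=> a b c /= h1 h2; apply: leq_trans h2 h1.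
change (geq (nth 0%N s i) (nth 0%N s j)).
by apply: (sorted_leq_nth trg leqnn 0%N srt); rewrite ?inE //; apply: leq_ltn_trans lt_j.
Qed.

(** Both sides say that the cell in row k and column i belongs to the diagram, seen by columns on
    the left and by rows on the right. *)
Lemma lt_count_sorted (s : seq nat) i k : sorted geq s ->
  (k < count (fun x => i < x) s)%N = (i < nth 0 s k)%N.
Proof.
elim: s k => [|a s IH] k; first by rewrite nth_nil ltn0.
move=> srt; have srt' := path_sorted srt; case: k => [|k] /=.
  have [lt_i|le_i] := ltnP i a; first by [].
  by rewrite add0n (IH 0%N srt'); have := sorted_geq_nth srt (leq0n 1); rewrite /=; lia.
have [lt_i|le_i] := ltnP i a; first by rewrite add1n ltnS IH.
have h1 := IH k srt'; have h0 := sorted_geq_nth srt (leq0n k.+1); rewrite /= in h0.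
have h2 := IH 0%N srt'; have h3 := sorted_geq_nth srt (leq0n 1); rewrite /= in h3.
by apply/idP/idP; lia.
Qed.

Lemma sum_nth_sumn (s : seq nat) n : (size s <= n)%N ->
  (\sum_(j < n) nth 0 s j = sumn s)%N.
Proof.
move=> le_s; rewrite sumnE (big_nth 0%N) big_mkord.
rewrite (big_ord_widen _ (fun i => nth 0%N s i) le_s) [RHS]big_mkcond /=.
by apply: eq_bigr => i _; case: ltnP => // h; rewrite nth_default.
Qed.

Lemma sum_ltn_minn m t : (\sum_(j < m) (j < t) = minn m t)%N.
Proof.
elim: m => [|m IH]; first by rewrite big_ord0 min0n.
by rewrite big_ord_recr /= IH; case: ltnP; lia.
Qed.

Section SpechtIndex.

Variables (n : nat) (nu : seq nat).
Hypotheses (pnu : is_part nu) (snu : sumn nu = n).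

Let srt : sorted geq nu. Proof. by case/andP: pnu. Qed.

Let pos_nth i : (i < size nu)%N -> (0 < nth 0 nu i)%N.
Proof.
move=> lt_i; case/andP: pnu => _; rewrite lt0n; apply: contraNneq => <-.
exact: mem_nth.
Qed.

Lemma size_part_le : (size nu <= n)%N.
Proof.
rewrite -snu sumnE (big_nth 0%N) big_mkord -[X in (X <= _)%N]card_ord -sum1_card.
by apply: leq_sum => i _; apply: pos_nth.
Qed.

Definition partfun (j : 'I_n) : nat := nth 0%N nu j.

Lemma partfun_decr : decr partfun.
Proof. by move=> i j; apply: sorted_geq_nth. Qed.

Lemma partfun_sum : (\sum_j partfun j = n)%N.
Proof. by rewrite -[RHS]snu; apply: sum_nth_sumn; apply: size_part_le. Qed.

Let nuc := conj_part nu.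

Let size_nuc : size nuc = nth 0%N nu 0.
Proof. by rewrite /nuc size_map size_iota /first_part nth0. Qed.

Let nth_nuc i : (i < size nuc)%N -> nth 0%N nuc i = count (fun x => i < x)%N nu.
Proof.
rewrite size_map size_iota => lt_i.
by rewrite /nuc (nth_map 0%N) ?size_iota // nth_iota.
Qed.

Let le_first i : (nth 0 nu i <= nth 0 nu 0)%N.
Proof. exact: sorted_geq_nth. Qed.

Let snuc : sumn nuc = n.
Proof.
rewrite sumnE big_map iota0_index big_mkord.
under eq_bigr do rewrite -sum1_count big_mkcond.
rewrite exchange_big /= -[RHS]snu sumnE big_seq [RHS]big_seq; apply: eq_bigr => x.
move=> /(nthP 0%N)[k lt_k <-]; have := sum_ltn_minn (first_part nu) (nth 0%N nu k).
rewrite /first_part -nth0 (minn_idPr (le_first k)) => e; rewrite -[RHS]e.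
by apply: eq_bigr => i _; case: ifP.
Qed.

Let size_nuc_le : (size nuc <= n)%N.
Proof.
rewrite size_nuc -snu; case: (nu) => //= a s; exact: leq_addr.
Qed.

Let nth_nuc_le i : (nth 0 nuc i <= n)%N.
Proof.
have [lt_i|le_i] := ltnP i (size nuc); last by rewrite nth_default.
by rewrite nth_nuc // (leq_trans (count_size _ _)) // size_part_le.
Qed.

(** [f0] and [f1] give the block of a position for nu and for its conjugate, so the Young subgroups
    are their stabilizers. [f2] is the offset inside a conjugate block: it has content nu and is
    injective on the blocks of [f1]. All these values lie below n, so the default of [insubd] is
    never taken. *)
Let f0 : {ffun 'I_n -> 'I_n} := [ffun x : 'I_n => insubd x (reshape_index nu x)].
Let f1 : {ffun 'I_n -> 'I_n} := [ffun x : 'I_n => insubd x (reshape_index nuc x)].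
Let f2 : {ffun 'I_n -> 'I_n} := [ffun x : 'I_n => insubd x (reshape_offset nuc x)].

Let f0E x : f0 x = reshape_index nu x :> nat.
Proof.
rewrite ffunE insubdK // -topredE /=; apply: leq_trans size_part_le.
by apply: reshape_indexP; rewrite snu.
Qed.

Let f1E x : f1 x = reshape_index nuc x :> nat.
Proof.
rewrite ffunE insubdK // -topredE /=; apply: leq_trans size_nuc_le.
by apply: reshape_indexP; rewrite snuc.
Qed.

Let f2E x : f2 x = reshape_offset nuc x :> nat.
Proof.
rewrite ffunE insubdK // -topredE /=; apply: leq_trans (nth_nuc_le (reshape_index nuc x)).
by apply: reshape_offsetP; rewrite snuc.
Qed.

Let content0 : content f0 =1 partfun.
Proof.
move=> k; rewrite ffunE -sum1dep_card big_mkcond /=.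
rewrite (eq_bigr (fun x : 'I_n => (reshape_index nu x == k) : nat)); last first.
  by move=> x _; rewrite -val_eqE /= f0E; case: eqP.
rewrite (sum_reshape (fun i j => (i == k) : nat) snu) /partfun.
under eq_bigr do rewrite sum_nat_const card_ord.
have [lt_k|le_k] := ltnP k (size nu).
  rewrite (bigD1 (Ordinal lt_k)) //= eqxx muln1 big1 ?addn0 // => i.
  by rewrite -val_eqE /= => /negbTE->; rewrite muln0.
rewrite nth_default // big1 // => i _; case: eqP => [e|]; last by rewrite muln0.
by have := ltn_ord i; rewrite e ltnNge le_k.
Qed.

Let content2 : content f2 =1 partfun.
Proof.
move=> k; rewrite ffunE -sum1dep_card big_mkcond /=.
rewrite (eq_bigr (fun x : 'I_n => (reshape_offset nuc x == k) : nat)); last first.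
  by move=> x _; rewrite -val_eqE /= f2E; case: eqP.
rewrite (sum_reshape (fun i j => (j == k) : nat) snuc) /partfun.
rewrite (eq_bigr (fun i : 'I_(size nuc) => (i < nth 0%N nu k) : nat)%N).
  by rewrite sum_ltn_minn size_nuc; apply/minn_idPr.
move=> i _; rewrite -lt_count_sorted // -nth_nuc //.
have [lt_k|le_k] := ltnP k (nth 0%N nuc i).
  rewrite (bigD1 (Ordinal lt_k)) //= eqxx big1 // => j.
  by rewrite -val_eqE /= => /negbTE->.
by rewrite big1 // => j _; case: eqP => // e; have := ltn_ord j; rewrite e ltnNge le_k.
Qed.

Let blockinj2 : blockinj f1 f2.
Proof.
apply/forallP => x; apply/forallP => y; apply/implyP.
rewrite -!val_eqE /= !f1E !f2E => /andP[/eqP e1 /eqP e2].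
by rewrite -(reshape_indexK nuc x) -(reshape_indexK nuc y) e1 e2.
Qed.

Let part_contentE (f : {ffun 'I_n -> 'I_n}) t :
  part (content f) t = (\sum_(i < n) #|[set x | (f1 x == i) && (f x < t)%N]|)%N.
Proof.
rewrite /part; under eq_bigr do rewrite ffunE -sum1dep_card.
under [RHS]eq_bigr do rewrite -sum1dep_card.
transitivity (\sum_(x < n | (f x < t)%N) 1)%N.
  rewrite [RHS](partition_big f (fun j : 'I_n => (j < t)%N)) //=.
  by apply: eq_bigr => j lt_j; apply: eq_bigl => x; case: eqP => [->|]; rewrite ?lt_j ?andbF.
rewrite (partition_big f1 predT) //=.
by apply: eq_bigr => j _; apply: eq_bigl => x; rewrite andbC.
Qed.

Let block2 (i : 'I_n) t :
  #|[set x | (f1 x == i) && (f2 x < t)%N]| = minn (nth 0%N nuc i) t.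
Proof.
rewrite -sum1dep_card big_mkcond /=.
rewrite (eq_bigr (fun x : 'I_n =>
  ((reshape_index nuc x == i) && (reshape_offset nuc x < t)%N) : nat)); last first.
  by move=> x _; rewrite -val_eqE /= f1E f2E; case: ifP.
rewrite (sum_reshape (fun i' j => ((i' == i) && (j < t)%N) : nat) snuc).
have [lt_i|le_i] := ltnP i (size nuc).
  rewrite (bigD1 (Ordinal lt_i)) //= [X in (_ + X)%N]big1 ?addn0 => [|j].
    by rewrite -sum_ltn_minn; apply: eq_bigr => j _; rewrite eqxx.
  by rewrite -val_eqE /= => /negbTE->; rewrite big1.
rewrite nth_default // min0n big1 // => j _; rewrite big1 // => j' _.
by case: eqP => // e; exfalso; move: le_i; rewrite -e leqNgt ltn_ord.
Qed.

Let block_le (f : {ffun 'I_n -> 'I_n}) (i : 'I_n) t : blockinj f1 f ->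
  (#|[set x | (f1 x == i) && (f x < t)%N]| <= minn (nth 0%N nuc i) t)%N.
Proof.
move=> bf; rewrite leq_min; apply/andP; split.
  have <- : #|[set x | (f1 x == i) && (f2 x < n)%N]| = nth 0%N nuc i.
    by rewrite block2; apply/minn_idPl.
  by apply: subset_leq_card; apply/subsetP => x; rewrite !inE ltn_ord => /andP[->].
have [lt_t|le_t] := ltnP 0 t; last first.
  rewrite leqn0 in le_t; rewrite (eqP le_t) leqn0 cards_eq0; apply/eqP/setP => x.
  by rewrite !inE ltn0 andbF.
case: t lt_t => // t _; pose g (x : 'I_n) : 'I_t.+1 := inord (f x).
rewrite -[X in (_ <= X)%N](card_ord t.+1) -(card_in_imset (f := g)); first exact: max_card.
move=> x y; rewrite !inE => /andP[/eqP ex lx] /andP[/eqP ey ly] /(congr1 val).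
rewrite /g /= !inordK // => e; apply/eqP.
have /forallP/(_ x)/forallP/(_ y)/implyP := bf; apply.
by rewrite ex ey eqxx /=; apply/eqP/val_inj.
Qed.

(** A word injective on the blocks has at most min(block size, t) values below t in each block, a
    bound attained by [f2] in every block at once; adding up the blocks gives dominance by nu. *)
Let blockinj_dom (f : {ffun 'I_n -> 'I_n}) t : blockinj f1 f ->
  (part (content f) t <= part partfun t)%N.
Proof.
move=> bf; have -> : part partfun t = part (content f2) t.
  by apply: eq_bigr => j _; rewrite content2.
by rewrite !part_contentE; apply: leq_sum => i _; rewrite block2 block_le.
Qed.

Let youngE w : (w \in young n nu) = fixes w f0.
Proof. by rewrite inE; apply: eq_forallb => x; rewrite -val_eqE /= !f0E. Qed.

Let youngcE w : (w \in young n nuc) = fixes w f1.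
Proof. by rewrite inE; apply: eq_forallb => x; rewrite -val_eqE /= !f1E. Qed.

Let psi : 'CF([set: 'S_n]) := 'Ind[[set: 'S_n]] ('Res[young n nuc] (sign_cfun n)).

Let psi_char : psi \is a character.
Proof. by rewrite cfInd_char // cfRes_char // sign_char. Qed.

Lemma dot_char_neq0 (phi phi' : 'CF([set: 'S_n])) i : phi \is a character ->
  phi' \is a character -> i \in irr_constt phi -> i \in irr_constt phi' -> '[phi, phi'] != 0.
Proof.
move=> cphi cphi' ci ci'; rewrite cfdot_sum_irr.
have ge0 j : 0 <= '[phi, 'chi_j] * '[phi', 'chi_j]^*.
  by rewrite mulr_ge0 // ?conjC_ge0; apply: natr_ge0; apply: Cnat_cfdot_char_irr.
apply/eqP => /(psumr_eq0P (fun j _ => ge0 j))/(_ i isT)/eqP.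
by rewrite mulf_eq0 fmorph_eq0 => /orP[]; apply/negP.
Qed.

(** A character orthogonal to all X_lam would be orthogonal to the permutation character it occurs
    in, so the constituent is some X_lam. Its occurrence in the induced trivial character makes lam
    dominate nu through a Kostka matrix, and its occurrence in the induced sign character makes nu
    dominate lam. *)
Lemma specht_index_spechtX i : is_Specht_index nu i -> 'chi_i = spechtX partfun.
Proof.
case/andP; rewrite (Ind1_xi youngE) -/nuc -/psi => ci cpsi.
have [/existsP[lam /and3P[/forallP dl /eqP sl nz]]|none] :=
  boolP [exists lam : {ffun 'I_n -> 'I_n.+1}, [&& [forall i : 'I_n, [forall j : 'I_n,
     (i <= j)%N ==> (lam j <= lam i)%N]], (\sum_k lam k)%N == n
     & '[spechtX (natfun lam), 'chi_i] != 0]]; last first.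
  move: ci; rewrite irr_consttE => /eqP[]; apply: xi_orth; last exact: sum_content.
  move=> lam dl sl; apply/eqP; apply: contraNT none => nz; apply/existsP; exists lam.
  rewrite nz sl eqxx !andbT; apply/forallP => j; apply/forallP => k; apply/implyP; exact: dl.
have {}dl : decr (natfun lam).
  by move=> j k; have /forallP/(_ k)/implyP := dl j; apply.
have [j ej] := spechtX_irr dl sl; have {j ej nz} ei : 'chi_i = spechtX (natfun lam).
  by move: nz; rewrite ej cfdot_irr; have [->|_] := eqVneq j i; rewrite ?eqxx.
rewrite ei; suff e : natfun lam =1 partfun.
  by apply: eq_theta => M; apply: eq_bigl => s; apply: eq_forallb => k; rewrite !e.
apply: part_inj => t le_t; apply/eqP; rewrite eqn_leq; apply/andP; split.
  pose b : {ffun 'I_n -> nat} := [ffun k => lam k : nat].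
  have sb : (\sum_k b k = n)%N by under eq_bigr do rewrite ffunE.
  have cb : i \in irr_constt (xi n b).
    by rewrite irr_consttE ei xi_dotX // kostka_diag ?oner_eq0 // => k; rewrite ffunE.
  have := dot_char_neq0 (xi_char sb) psi_char cb cpsi.
  rewrite (xi_dot_sign youngcE) mulf_eq0 negb_or pnatr_eq0 -lt0n => /andP[].
  case/card_gt0P => f; rewrite inE => /andP[/eqP cf bf] _.
  have -> : part (natfun lam) t = part (content f) t.
    by apply: eq_bigr => k _; rewrite cf ffunE.
  exact: blockinj_dom.
move: ci; rewrite irr_consttE ei xi_dotX // pnatr_eq0 -lt0n => /card_gt0P[M].
rewrite inE => /andP[kM /eqP eM].
have -> : part partfun t = part (rowmarg (natfun M)) t.
  by apply: eq_bigr => k _; rewrite eM content0.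
exact: kostka_dom.
Qed.

(** Were there no common constituent, the two induced characters would be orthogonal; the word [f2]
    shows that their inner product is nonzero. *)
Lemma irr_char_SnE : irr_char_Sn n nu = spechtX partfun.
Proof.
rewrite /irr_char_Sn; case: pickP => [i|none]; first exact: specht_index_spechtX.
have : '[xi n (content f0), psi] != 0.
  rewrite (xi_dot_sign youngcE) mulf_neq0 // ?invr_eq0 pnatr_eq0 -lt0n ?cardG_gt0 //.
  apply/card_gt0P; exists f2; rewrite inE blockinj2 andbT; apply/eqP/ffunP => k.
  by rewrite content2 content0.
rewrite cfdot_sum_irr big1 ?eqxx // => i _; have := none i.
rewrite /is_Specht_index (Ind1_xi youngE) -/nuc -/psi !irr_consttE.
by case: eqP => [->|_] /=; rewrite ?mul0r // => /negbFE/eqP->; rewrite rmorph0 mulr0.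
Qed.

End SpechtIndex.

(** * Kronecker products *)

Section Kronecker.

Variables (n L : nat) (E : finType) (rk : E -> nat).
Hypotheses (rk_inj : injective rk) (rk_lt : forall e, (rk e < #|E|)%N).
Variables (wt : E -> 'I_L -> nat) (alpha : 'I_L -> nat).

Local Notation array := {ffun (E * 'I_n) * 'I_n -> 'I_n.+1}.
Implicit Type a : array.

Definition lexpos (x : E * 'I_n) : nat := (rk x.1 * n + x.2)%N.

Lemma epos_div x : (lexpos x %/ n = rk x.1)%N.
Proof.
case: x => e r /=; have := ltn_ord r => lt_r; rewrite /lexpos divnMDl; last by lia.
by rewrite divn_small ?addn0.
Qed.

Lemma epos_mod x : (lexpos x %% n = x.2)%N.
Proof. by rewrite /lexpos modnMDl modn_small. Qed.

Lemma epos_inj : injective lexpos.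
Proof.
move=> x y e; have := epos_div x; rewrite e epos_div => /rk_inj e1.
have := epos_mod x; rewrite e epos_mod => /val_inj e2.
by case: x y e1 e2 {e} => ? ? [? ?] /= -> ->.
Qed.

Lemma epos_lt x : (lexpos x < #|{: E * 'I_n}|)%N.
Proof.
rewrite card_prod card_ord /lexpos; have := rk_lt x.1; have := ltn_ord x.2; nia.
Qed.

Definition transp a : array := [ffun p => a ((p.1.1, p.2), p.1.2)].

Lemma transpK : involutive transp.
Proof. by move=> a; apply/ffunP => -[[e k] r]; rewrite !ffunE. Qed.

(** When [a ((e, r), k)] is read as the number of cells of row r with label (e, k), this counts the
    cells of row r whose label precedes (e, k). *)
Definition rowcum a (e : E) (r : 'I_n) (k : nat) : nat :=
  (\sum_(e' | (rk e' < rk e)%N) \sum_(k' < n) a ((e', r), k') +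
   \sum_(k' < n | (k' < k)%N) a ((e, r), k'))%N.

Lemma psum_transp a e (r : 'I_n) k : (k <= n)%N ->
  psum (natof lexpos (transp a) ^~ r) (rk e * n + k) = rowcum a e r k.
Proof.
move=> le_k; rewrite (psum_col epos_inj epos_lt); last first.
  by rewrite card_prod card_ord; have := rk_lt e; nia.
rewrite (bigID (fun x : E * 'I_n => (rk x.1 < rk e)%N)) /=; congr (_ + _)%N.
  rewrite (pair_big_dep (fun e' => (rk e' < rk e)%N) (fun _ _ => true)
            (fun e' k' => nat_of_ord (a ((e', r), k')))) /=.
  apply: eq_big => [[e' k']|[e' k'] _]; last by rewrite ffunE.
  by rewrite /= andbT /lexpos /=; have := ltn_ord k'; nia.
rewrite (reindex_onto (fun k' : 'I_n => (e, k')) snd) /=; last first.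
  move=> [e' k'] /andP[lt_p]; rewrite -leqNgt => le_e /=; congr (_, _).
  apply: rk_inj; apply/eqP; rewrite eqn_leq le_e leqNgt; apply/negP => lt_e.
  have : ((rk e).+1 * n <= rk e' * n)%N by rewrite leq_mul2r lt_e orbT.
  by move: lt_p; rewrite /lexpos mulSn /=; lia.
apply: eq_big => [k'|k' _]; last by rewrite ffunE.
by rewrite ltnn eqxx andbT /lexpos /= ltn_add2l andbT.
Qed.

Section Rows.

Variables (s : E * 'I_n -> nat) (a : array).
Hypothesis rs : rowsums s a.

(** The stretch of row r labelled by e starts after all cells of row r with smaller first component.
    Their number depends only on the row sums [s], which the involution preserves. [rowlink] joins
    (e, r) to (e, r+1) only, never the last row of one e to the first row of the next. *)
Definition rowbase (t : nat) : nat :=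
  (\sum_(x : E * 'I_n | (rk x.1 < t %/ n)%N && (x.2 == t %% n :> nat)) s x)%N.

Definition rowlink (t : nat) : bool :=
  (t.+1 %% n != 0)%N && (t.+1 < #|{: E * 'I_n}|)%N.

Lemma pre_rowbase e (r : 'I_n) k : (k <= n)%N ->
  pre (natof lexpos a) rowbase (lexpos (e, r)) k = rowcum a e r k.
Proof.
move=> le_k; rewrite /pre /rowbase epos_div epos_mod; congr (_ + _)%N.
  rewrite (eq_bigl (fun x : E * 'I_n => (rk x.1 < rk e)%N && (x.2 == r))) //.
  rewrite (reindex_onto (fun e' : E => (e', r)) fst) /= => [|[e' r'] /andP[_ /= /eqP-> //]].
  apply: eq_big => [e'|e' _]; first by rewrite !eqxx !andbT.
  by rewrite -(eqP (forallP rs (e', r))).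
rewrite /psum (big_ord_widen n (fun k' => natof lexpos a (lexpos (e, r)) k') le_k).
by apply: eq_bigr => k' _; rewrite (natofE epos_inj).
Qed.

End Rows.

Definition rowlat a := [forall e, forall r : 'I_n, forall r' : 'I_n, forall k : 'I_n,
  (r' == r.+1 :> nat) ==> (rowcum a e r' k.+1 <= rowcum a e r k)%N].

Lemma lattice_transp a : lattice lexpos (transp a) = rowlat a.
Proof.
apply/forallP/forallP => [h e|h [t lt_t]].
  apply/forallP => r; apply/forallP => r'; apply/forallP => k; apply/implyP => /eqP er.
  have lt_p := epos_lt (e, k); have /forallP/(_ r) := h (Ordinal lt_p).
  rewrite /viol -leqNgt /= -er /lexpos /= -addnS psum_transp // psum_transp //.
  exact: ltnW.
apply/forallP => r; rewrite /viol -leqNgt /=.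
have [[e k] <-] := pos_surj epos_inj epos_lt lt_t.
have [lt_r|le_r] := ltnP r.+1 n; last first.
  by rewrite {1}/psum big1 // => i _; rewrite natof_rect ?le_r ?orbT //; apply: epos_lt.
have := h e; move/forallP/(_ r)/forallP/(_ (Ordinal lt_r))/forallP/(_ k)/implyP => /(_ (eqxx _)).
rewrite /lexpos /= -addnS -[r.+1]/(val (Ordinal lt_r)) !psum_transp //; exact: ltnW.
Qed.

(** The inequalities between values of [rowcum] that express the lattice condition of the transposed
    array are here the column strictness of [a] itself over the offsets [rowbase s]. *)
Lemma semistd_rowlat s a : rowsums s a -> semistd lexpos (rowbase s) rowlink a = rowlat a.
Proof.
move=> rs; apply/forallP/forallP => [h e|h [t lt_t]].
  apply/forallP => r; apply/forallP => r'; apply/forallP => k; apply/implyP => /eqP er.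
  have lt_p := epos_lt (e, r).
  have : rowlink (lexpos (e, r)) -> (pre (natof lexpos a) (rowbase s) (lexpos (e, r)).+1 k.+1 <=
      pre (natof lexpos a) (rowbase s) (lexpos (e, r)) k)%N.
    by apply/implyP; apply: (forallP (h (Ordinal lt_p)) k).
  have eS : (lexpos (e, r)).+1 = lexpos (e, r') by rewrite /lexpos /= er addnS.
  rewrite eS !(pre_rowbase rs) ?(ltnW (ltn_ord k)) //; apply.
  by rewrite /rowlink eS epos_mod epos_lt er.
apply/forallP => k; apply/implyP; rewrite /rowlink /= => /andP[nz lt_S].
have [[e r] et] := pos_surj epos_inj epos_lt lt_t.
have [[e' r'] eS] := pos_surj epos_inj epos_lt lt_S.
have er : r' = r.+1 :> nat.
  have e1 : (t.+1 %% n = r')%N by rewrite -eS epos_mod.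
  have e2 : (t %% n = r)%N by rewrite -et epos_mod.
  by move: nz; rewrite -e1 modnS -e2; case: ifP.
have ee : e' = e.
  apply: rk_inj; move: eS; rewrite -et /lexpos /= er addnS => -[]; have := ltn_ord r; nia.
move: eS; rewrite ee => <-; rewrite -et !(pre_rowbase rs) ?(ltnW (ltn_ord k)) //.
have := h e; move/forallP/(_ r)/forallP/(_ r')/forallP/(_ k)/implyP; apply.
by rewrite er.
Qed.

Definition weighted (M : {ffun E -> nat}) := [forall j, (\sum_e M e * wt e j)%N == alpha j].

Definition thetaH : 'CF([set: 'S_n]) := theta n (fun M : {ffun E -> nat} => (weighted M)%:R).

Definition totals a : {ffun E -> nat} := [ffun e => (\sum_(r < n) \sum_(k < n) a ((e, r), k))%N].

Definition kron_array (lam gam : 'I_n -> nat) a :=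
  [&& (\sum_p a p)%N == n, weighted (totals a), rowlat a, rowlat (transp a),
      [forall k, colsum a k == lam k] & [forall k, colsum (transp a) k == gam k]].

(** The determinant of gam is cancelled inside [theta_dotX], and transposition turns the resulting
    lattice condition into [rowlat]. On arrays with fixed row sums this is a semistandard condition,
    so [cancellation] applies a second time, to the determinant of lam. *)
Theorem kronecker (lam gam : 'I_n -> nat) : decr lam -> decr gam ->
  '[thetaH * spechtX lam, spechtX gam] = #|[set a | kron_array lam gam a]|%:R.
Proof.
move=> dlam dgam; rewrite theta_mul (theta_dotX epos_inj epos_lt) //.
rewrite (reindex_inj (inv_inj transpK)) /=.
pose P a := [&& (\sum_p a p)%N == n, weighted (totals a) & [forall k, colsum (transp a) k == gam k]].
have totE a : rowmarg (rowmarg (natfun (transp a))) = totals a.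
  apply/ffunP => e; rewrite !ffunE exchange_big; apply: eq_bigr => k _.
  by rewrite ffunE; apply: eq_bigr => r _; rewrite ffunE.
have colE a k : colmarg (rowmarg (natfun (transp a))) k = colsum a k.
  rewrite ffunE /colsum (eq_bigr (fun e => \sum_(r < n) a ((e, r), k))%N) => [|e _].
    by rewrite pair_bigA; apply: eq_bigr => -[].
  by rewrite ffunE; apply: eq_bigr => r _; rewrite ffunE.
transitivity (\sum_(a | P a && rowlat a) alternant lam (colsum a)).
  rewrite big_mkcond [RHS]big_mkcond; apply: eq_bigr => a _; rewrite /P lattice_transp totE.
  have -> : (\sum_p transp a p = \sum_p a p)%N.
    rewrite [RHS](reindex (fun p : E * 'I_n * 'I_n => ((p.1.1, p.2), p.1.2))) /=.
      by apply: eq_bigr => p _; rewrite ffunE.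
    by exists (fun p : E * 'I_n * 'I_n => ((p.1.1, p.2), p.1.2)) => -[[? ?] ?].
  rewrite (eq_alternant lam (colE a)); case: (_ == n) => //=.
  case: (weighted _); rewrite ?mul1r ?mul0r /= ?if_same //.
  by rewrite andbC.
pose rowM a : {ffun E * 'I_n -> 'I_n.+1} := [ffun x => inord (\sum_(k < n) a (x, k))%N].
have sumM a : (\sum_p a p = \sum_x \sum_(k < n) a (x, k))%N.
  by rewrite pair_bigA; apply: eq_bigr => -[].
(* All conditions in [P] depend on the row sums only; [Q] is the same condition read off from
   them. *)
pose Q (s : {ffun E * 'I_n -> 'I_n.+1}) := [&& (\sum_x s x)%N == n,
   weighted [ffun e => (\sum_(r < n) s (e, r))%N]
   & [forall r : 'I_n, (\sum_e s (e, r))%N == gam r]].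
have PQ a s : P a && (rowM a == s) = Q s && rowsums (natfun s) a.
  have PE : rowsums (natfun s) a -> P a = Q s.
    move=> /forallP rs; rewrite /P /Q; congr [&& _, _ & _].
    - by rewrite sumM; congr (_ == _); apply: eq_bigr => x _; apply/eqP.
    - congr weighted; apply/ffunP => e; rewrite !ffunE; apply: eq_bigr => r _.
      exact/eqP/(rs (e, r)).
    - apply: eq_forallb => r; congr (_ == _).
      rewrite /colsum (eq_bigr (fun x : E * 'I_n => nat_of_ord (a ((x.1, r), x.2)))) => [|x _].
        rewrite -(pair_bigA _ (fun e k => nat_of_ord (a ((e, r), k)))).
        by apply: eq_bigr => e _; apply/eqP/(rs (e, r)).
      by rewrite ffunE.
  have [/eqP sn|nsn] := boolP ((\sum_p a p)%N == n); last first.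
    rewrite /P (negbTE nsn) /=; apply/esym/negP => /andP[Qs rs]; case/negP: nsn.
    by case/andP: Qs => /eqP e _; rewrite -[X in _ == X]e sumM; apply/eqP/eq_bigr => x _; apply/eqP/(forallP rs).
  have rowE : (rowM a == s) = rowsums (natfun s) a.
    have e x : rowM a x = (\sum_(k < n) a (x, k))%N :> nat.
      by rewrite ffunE inordK // ltnS -[X in (_ <= X)%N]sn sumM (bigD1 x) //= leq_addr.
    apply/eqP/forallP => [<- x|h]; first by rewrite e.
    by apply/ffunP => x; apply: val_inj; rewrite /= e; apply/eqP.
  by rewrite rowE; case: (boolP (rowsums _ _)) => [/PE->|_] //; rewrite !andbF.
rewrite (partition_big rowM Q) /=; last first.
  by move=> a /andP[Pa _]; have := PQ a (rowM a); rewrite Pa eqxx => /esym/andP[].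
have cardE : #|[set a | kron_array lam gam a]| =
  (\sum_(s | Q s) #|[set a : array | [&& rowsums (natfun s) a,
     semistd lexpos (rowbase (natfun s)) rowlink a, lattice lexpos a
     & [forall k, colsum a k == lam k]]]|)%N.
  rewrite -sum1dep_card (partition_big rowM Q) /=; last first.
    move=> a /and3P[sn w /and4P[_ _ _ cg]]; have := PQ a (rowM a).
    by rewrite /P sn w cg eqxx => /esym/andP[].
  apply: eq_bigr => s Qs; rewrite -sum1dep_card; apply: eq_bigl => a.
  have := PQ a s; rewrite Qs /= /kron_array /P -(transpK a) lattice_transp transpK.
  case: (boolP (rowsums (natfun s) a)) => [rs|_] /=; last first.
    by move=> h; apply/negP => /andP[/and3P[h1 h2 /and4P[_ _ _ h3]] h4]; rewrite h1 h2 h3 h4 in h.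
  rewrite (semistd_rowlat rs) => /andP[/and3P[-> -> ->] ->].
  by rewrite !andbT.
rewrite cardE natr_sum; apply: eq_bigr => s Qs.
have s_le x : (s x <= n)%N by rewrite -ltnS.
have lk_lt t : rowlink t -> (t.+1 < #|{: E * 'I_n}|)%N by case/andP.
rewrite -(cancellation epos_inj epos_lt (rowbase (natfun s)) s_le lk_lt dlam).
apply: eq_bigl => a; rewrite andbAC PQ Qs /=.
by case: (boolP (rowsums (natfun s) a)) => //= rs; rewrite (semistd_rowlat rs).
Qed.

End Kronecker.

(** * Vanishing of symmetric polynomials at roots of unity *)

(** Inversion permutes the roots of unity, so the product is a scalar multiple of X^m - 1;
    evaluation at 0 determines the scalar. *)
Lemma prod_roots_of_unity m : (0 < m)%N ->
  \prod_(z <- roots_of_unity m) (1 - z *: 'X) = 1 - 'X^m :> {poly algC}.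
Proof.
move=> m_gt0; have nz z : z \in roots_of_unity m -> z != 0.
  rewrite mem_roots_of_unity // => /eqP e; apply: contraTneq (oner_neq0 algC) => z0.
  by rewrite -e z0 expr0n gtn_eqF // eqxx.
have perm_inv : perm_eq [seq z^-1 | z <- roots_of_unity m] (roots_of_unity m).
  apply: uniq_perm; rewrite ?map_inj_uniq ?uniq_roots_of_unity //; first exact: invr_inj.
  move=> z; apply/mapP/idP => [[y]|]; rewrite !mem_roots_of_unity //.
    by move=> /eqP e ->; rewrite exprVn e invr1.
  move=> /eqP e; exists z^-1; rewrite ?invrK //.
  by rewrite mem_roots_of_unity // exprVn e invr1.
have [c ec] : exists c, \prod_(z <- roots_of_unity m) (1 - z *: 'X) = c *: ('X^m - 1) :> {poly algC}.
  exists (\prod_(z <- roots_of_unity m) - z^-1).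
  rewrite [in RHS]roots_of_unityE // -scaler_prod /=.
  rewrite -[RHS](perm_big _ perm_inv) big_map.
  apply: eq_big_seq => z /nz z0; rewrite invrK scaleNr scalerBr opprB; congr (_ - _).
  by rewrite -mul_polyC -polyCM mulfV.
have := congr1 (horner^~ 0) ec; rewrite horner_prod big1 => [|z _]; last first.
  by rewrite hornerD hornerN hornerZ hornerX hornerC mulr0 subr0.
rewrite hornerZ hornerD hornerN hornerXn hornerC expr0n gtn_eqF // add0r mulrN1 => e1.
by rewrite ec -[c]opprK -e1 scaleN1r opprB.
Qed.

Definition setat (c : nat -> nat) k x i := if i == k then x else c i.

Section TriangularGrid.

Variables (n : nat) (R : idomainType) (P : {mpoly R[n]}) (b : 'I_n -> nat).
Variable phi : (nat -> nat) -> 'I_n -> R.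

Definition ingrid (c : nat -> nat) := forall i : 'I_n, (c i < b i)%N.

Hypothesis b_bound : forall m i, m \in msupp P -> (m i < b i)%N.
Hypothesis phi_tri : forall c (k i : 'I_n) x, ingrid c -> (x < b k)%N -> (i < k)%N ->
  phi (setat c k x) i = phi c i.
Hypothesis phi_inj : forall c (k : 'I_n) x y, ingrid c -> (x < b k)%N -> (y < b k)%N ->
  phi (setat c k x) k = phi (setat c k y) k -> x = y.
Hypothesis P_vanish : forall c, ingrid c -> P.@[phi c] = 0.

Definition tailmatch k (tau : 'I_n -> nat) (m : 'X_{1..n}) :=
  [forall i : 'I_n, (k <= i)%N ==> (m i == tau i)].

(** The coefficient of the monomial with exponents [tau] in the variables from k on, a polynomial in
    the first k variables, evaluated at [v]. *)
Definition tailsum k tau (v : 'I_n -> R) :=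
  \sum_(m <- msupp P | tailmatch k tau m) P@_m * \prod_(i < n | (i < k)%N) v i ^+ m i.

(** The variables are eliminated from the last one down. The polynomial [Q] in variable q has degree
    less than [b q] and vanishes at [b q] distinct points, since varying [c] at q moves coordinate q
    injectively without disturbing the coordinates before it. *)
Lemma tailsum0 k tau c : (k <= n)%N -> ingrid c -> tailsum k tau (phi c) = 0.
Proof.
move=> le_k; rewrite -(subKn le_k); elim: (n - k)%N tau c => [|j IH] tau c gc.
  rewrite subn0 /tailsum -[RHS](P_vanish gc) mevalE.
  apply: eq_big => [m|m _]; first by apply/forallP => i; rewrite leqNgt ltn_ord.
  by congr (_ * _); apply: eq_bigl => i; rewrite ltn_ord.
have [lt_j|le_j] := ltnP j n; last first.
  by have := IH tau c gc; rewrite (eqP (_ : n - j == n - j.+1)%N) //; lia.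
have lt_q : (n - j.+1 < n)%N by lia.
pose q : 'I_n := Ordinal lt_q; have eS : (n - j = q.+1)%N by rewrite /=; lia.
rewrite -[(n - j.+1)%N]/(val q); rewrite eS in IH.
pose tauj x (i : 'I_n) := if i == q then x else tau i.
have tauE : tauj (tau q) =1 tau by move=> i; rewrite /tauj; case: eqP => [->|].
have tailE x m : tailmatch q (tauj x) m = tailmatch q.+1 tau m && (m q == x).
  apply/forallP/andP => [h|[/forallP h /eqP e] i].
    split; last by have /implyP/(_ (leqnn _)) := h q; rewrite /tauj eqxx.
    apply/forallP => i; apply/implyP => lt_i; have /implyP/(_ (ltnW lt_i)) := h i.
    by rewrite /tauj ifN // -val_eqE gtn_eqF.
  apply/implyP => le_i; rewrite /tauj; have [->|ne] := eqVneq i q; first by rewrite e.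
  by have /implyP := h i; apply; rewrite ltn_neqAle le_i andbT eq_sym.
pose Q := \poly_(x < b q) tailsum q (tauj x) (phi c).
have gc' x : (x < b q)%N -> ingrid (setat c q x).
  by move=> lt_x i; rewrite /setat; case: eqP => [/val_inj->|_] //; apply: gc.
have Q0 : Q = 0.
  apply: (@roots_geq_poly_eq0 _ _ [seq phi (setat c q x) q | x <- iota 0 (b q)]).
  - apply/allP => _ /mapP[x + ->]; rewrite mem_iota /= add0n => lt_x.
    rewrite rootE horner_poly -[X in _ == X](IH tau _ (gc' x lt_x)); apply/eqP.
    set v := phi _ q; pose F (m : 'X_{1..n}) := P@_m * \prod_(i < n | (i < q)%N) phi c i ^+ m i * v ^+ m q.
    transitivity (\sum_(y < b q) \sum_(m <- msupp P | tailmatch q.+1 tau m && (m q == y :> nat)) F m).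
      apply: eq_bigr => y _; rewrite /tailsum mulr_suml; apply: eq_big => [m|m]; first exact: tailE.
      by rewrite tailE => /andP[_ /eqP e]; rewrite /F e.
    rewrite (exchange_big_dep (tailmatch q.+1 tau)) /=; last by move=> y m _ /andP[].
    rewrite /tailsum big_seq_cond [RHS]big_seq_cond; apply: eq_bigr => m /andP[mP tm].
    rewrite (big_pred1 (Ordinal (b_bound q mP))) => [|y]; last by rewrite tm /= eq_sym.
    rewrite /F -mulrA; congr (_ * _); rewrite [RHS](bigD1 q) //= mulrC; congr (_ * _).
    apply: eq_big => [i|i lt_i]; first by rewrite -val_eqE /=; lia.
    by rewrite (phi_tri gc lt_x).
  - rewrite map_inj_in_uniq ?iota_uniq // => x y; rewrite !mem_iota /= !add0n => lx ly.
    exact: (phi_inj (k := q) gc lx ly).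
  - by rewrite size_map size_iota size_poly.
have -> : tailsum q tau (phi c) = tailsum q (tauj (tau q)) (phi c).
  by apply: eq_bigl => m; apply: eq_forallb => i; rewrite tauE.
have [lt_t|le_t] := ltnP (tau q) (b q).
  by have := congr1 (fun p : {poly R} => p`_(tau q)) Q0; rewrite coef0 coef_poly lt_t.
rewrite /tailsum big_seq_cond big_pred0 // => m; apply/negbTE/negP => /andP[mP].
by rewrite tailE => /andP[_ /eqP e]; have := b_bound q mP; rewrite e ltnNge le_t.
Qed.

Lemma grid_vanish : P = 0.
Proof.
apply/eqP; rewrite -msupp_eq0; case E : (msupp P) => [//|m0 s].
have m0P : m0 \in msupp P by rewrite E mem_head.
have g0 : ingrid (fun=> 0%N) by move=> i; apply: leq_ltn_trans (b_bound i m0P).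
have := tailsum0 m0 (leq0n n) g0; rewrite /tailsum (big_rem m0) //=.
have -> : tailmatch 0 m0 m0 by apply/forallP => i; rewrite eqxx implybT.
rewrite big_pred0 // mulr1 big_seq_cond big_pred0 ?addr0 => [|m].
  by move/eqP; rewrite mcoeff_eq0 m0P.
apply/negbTE/negP => /andP[]; rewrite mem_rem_uniq ?msupp_uniq // inE => /andP[ne _].
by move=> /forallP h; case/eqP: ne; apply/mnmP => i; apply/eqP; apply: (implyP (h i)).
Qed.

End TriangularGrid.

(** * Elementary symmetric functions at roots of unity and a grid of cycle types *)

Lemma mmap_comp_mpoly n k (P : {mpoly rat[n]}) (lq : n.-tuple {mpoly rat[k]})
    (z : 'I_k -> algC) (v : 'I_n -> rat) :
  (forall i, mmap (ratr : rat -> algC) z (tnth lq i) = ratr (v i)) ->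
  mmap (ratr : rat -> algC) z (P \mPo lq) = ratr P.@[v].
Proof.
move=> e; rewrite comp_mpolyEX mevalE !raddf_sum /=; apply: eq_bigr => m _.
rewrite mmapZ rmorphM comp_mpolyX !rmorph_prod /=; congr (_ * _); apply: eq_bigr => i _.
by rewrite !rmorphXn /= e.
Qed.

Lemma prod_1subX n (z : 'I_n -> algC) k :
  (\prod_i (1 - z i *: 'X))`_k = (-1) ^+ k * mmap (ratr : rat -> algC) z (mesym n rat k).
Proof.
have -> : \prod_i (1 - z i *: 'X) = \prod_i \sum_(c : bool) (if c then - z i *: 'X else 1 : {poly algC}).
  by apply: eq_bigr => i _; rewrite big_bool /= scaleNr addrC.
rewrite bigA_distr_bigA coef_sum /=.
rewrite (reindex (fun h : {set 'I_n} => [ffun i => i \in h])) /=; last first.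
  exists (fun f : {ffun 'I_n -> bool} => [set i | f i]) => [h _|f _].
    by apply/setP => i; rewrite inE ffunE.
  by apply/ffunP => i; rewrite ffunE inE.
rewrite /mesym raddf_sum mulr_sumr [RHS]big_mkcond /=; apply: eq_bigr => h _.
under eq_bigr do rewrite ffunE; rewrite -big_mkcond /=.
rewrite (eq_bigr (fun i => (- z i)%:P * 'X)) => [|i _]; last by rewrite mul_polyC.
rewrite big_split -rmorph_prod /= prodr_const coefCM coefXn eq_sym.
have [<-|_] := eqVneq #|h| k; rewrite ?mulr0 // mulr1 prodrN rmorph_prod /=; congr (_ * _).
by apply: eq_bigr => i _; rewrite mmapX mmap1U.
Qed.

Definition epoly (s : seq nat) : {poly rat} := \prod_(m <- s) (1 - 'X^m).

Lemma mesym_Xi n mu k : is_part mu -> part_size mu = n ->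
  mmap (ratr : rat -> algC) (fun i : 'I_n => nth 0 (Xi mu) i) (mesym n rat k) =
  ratr ((-1) ^+ k * (epoly mu)`_k).
Proof.
move=> pmu smu; set z := fun i => _; have := prod_1subX z k.
have -> : \prod_i (1 - z i *: 'X) = map_poly ratr (epoly mu).
  rewrite rmorph_prod /z.
  rewrite -(big_mkord xpredT (fun i => 1 - nth 0 (Xi mu) i *: 'X : {poly algC})).
  rewrite -smu -(size_Xi pmu).
  rewrite -(big_nth 0 xpredT (fun y => 1 - y *: 'X : {poly algC})).
  rewrite /Xi big_flatten big_map; case/andP: pmu => _ mu0; apply: eq_big_seq => m m_mu.
  rewrite prod_roots_of_unity ?rmorphB ?rmorph1 /= ?map_polyXn //.
  by rewrite lt0n; apply: contraNneq mu0 => <-.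
rewrite coef_map /= => e; rewrite rmorphM rmorphXn rmorphN1 /= e.
by rewrite signrMK.
Qed.

Lemma coef_mul_low (A : {poly rat}) m c k : (k < m)%N -> (A * (1 - 'X^m) ^+ c)`_k = A`_k.
Proof.
move=> lt_k; elim: c => [|c IH]; first by rewrite mulr1.
by rewrite exprSr mulrA mulrBr mulr1 coefB coefMXn lt_k subr0.
Qed.

Lemma coef_mul_at (A : {poly rat}) m c : (0 < m)%N ->
  (A * (1 - 'X^m) ^+ c)`_m = A`_m - c%:R * A`_0.
Proof.
move=> m_gt0; elim: c => [|c IH]; first by rewrite mulr1 mul0r subr0.
rewrite exprSr mulrA mulrBr mulr1 coefB coefMXn ltnn subnn IH coef_mul_low //.
by rewrite -natr1 mulrDl mul1r opprD addrA.
Qed.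

Definition cyclepoly d (c : nat -> nat) : {poly rat} := \prod_(i < d) (1 - 'X^(i.+1)) ^+ c i.

Lemma cyclepoly_coef0 d c : (cyclepoly d c)`_0 = 1.
Proof.
elim: d => [|d IH]; first by rewrite /cyclepoly big_ord0 coef1.
by rewrite /cyclepoly big_ord_recr /= coef_mul_low.
Qed.

(** Factors with exponent above k+1 cannot reach this coefficient, and the factor with exponent k+1
    reaches it only linearly. Hence the (k+1)-st elementary symmetric function determines [c k] once
    the smaller multiplicities are known: the grid is triangular. *)
Lemma cyclepoly_coef d c k : (k < d)%N ->
  (cyclepoly d c)`_k.+1 = (cyclepoly k c)`_k.+1 - (c k)%:R.
Proof.
elim: d => // d IH; rewrite ltnS leq_eqVlt => /orP[/eqP->|lt_k].
  by rewrite {1}/cyclepoly big_ord_recr /= coef_mul_at // cyclepoly_coef0 mulr1.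
by rewrite {1}/cyclepoly big_ord_recr /= coef_mul_low ?ltnS // IH.
Qed.

Lemma eq_cyclepoly d c c' : (forall i, (i < d)%N -> c i = c' i) -> cyclepoly d c = cyclepoly d c'.
Proof. by move=> e; apply: eq_bigr => i _; rewrite e. Qed.

Lemma prod_nseq (R : pzRingType) (F : nat -> R) k m :
  \prod_(x <- nseq k m) F x = F m ^+ k.
Proof.
by elim: k => [|k IHk]; rewrite ?big_nil ?expr0 //= big_cons IHk exprS.
Qed.

Section GridPartition.

Variables (d n : nat).
Hypothesis lt_n : (d * d * d + d < n)%N.

Definition gridcell (c : nat -> nat) := forall i, (i < d)%N -> (c i < d)%N.

Definition gridsum (c : nat -> nat) := (\sum_(i < d) i.+1 * c i)%N.

(** [c i] parts equal to i+1, completed to size n by one further part. For multiplicities below d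
    the small parts use at most d * d * d cells, so the bound on n makes the last part exceed d and
    its factor does not affect the coefficients up to degree d. *)
Definition gridpart c :=
  sort geq ((n - gridsum c)%N :: flatten [seq nseq (c i) i.+1 | i <- iota 0 d]).

Lemma gridsum_le c : gridcell c -> (gridsum c <= d * d * d)%N.
Proof.
move=> gc; rewrite /gridsum; apply: (@leq_trans (\sum_(i < d) d * d)%N).
  by apply: leq_sum => i _; apply: leq_mul; rewrite // ltnW // gc.
by rewrite sum_nat_const card_ord mulnA.
Qed.

Lemma gridpart_part c : gridcell c -> is_part (gridpart c).
Proof.
move=> gc; apply/andP; split; first by apply: sort_sorted => x y; apply: leq_total.
rewrite mem_sort inE negb_or; apply/andP; split.
  by have := gridsum_le gc; lia.
by apply/negP => /flatten_mapP[i _]; rewrite mem_nseq => /andP[_ /eqP].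
Qed.

Lemma gridpart_size c : gridcell c -> part_size (gridpart c) = n.
Proof.
move=> gc; have := gridsum_le gc; rewrite /part_size (perm_sumn (permEl (perm_sort _ _))) /=.
rewrite sumn_flatten -map_comp sumnE big_map -[iota 0 d]/(iota 0 d).
have -> : (\sum_(i <- iota 0 d) (sumn \o (fun i => nseq (c i) i.+1)) i = gridsum c)%N.
  rewrite /gridsum -(big_mkord xpredT (fun i => i.+1 * c i)%N) /index_iota subn0.
  by apply: eq_bigr => i _ /=; rewrite sumn_nseq.
by lia.
Qed.

Lemma gridpart_coef c k : gridcell c -> (k < d)%N ->
  (epoly (gridpart c))`_k.+1 = (cyclepoly k c)`_k.+1 - (c k)%:R.
Proof.
move=> gc lt_k; rewrite -(cyclepoly_coef c lt_k) /epoly (perm_big _ (permEl (perm_sort _ _))).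
rewrite big_cons /= mulrC -[1 - 'X^_]expr1 coef_mul_low; last by have := gridsum_le gc; lia.
congr ((_ : {poly rat})`__); rewrite big_flatten big_map /cyclepoly.
rewrite -(big_mkord xpredT (fun i => (1 - 'X^(i.+1)) ^+ c i)) /index_iota subn0.
by apply: eq_bigr => i _; apply: prod_nseq.
Qed.

Lemma eq_gridpart c c' : (forall i, (i < d)%N -> c i = c' i) -> gridpart c = gridpart c'.
Proof.
move=> e; rewrite /gridpart; congr (sort _ (_ :: flatten _)).
  by congr (_ - _)%N; apply: eq_bigr => i _; rewrite e.
by apply/eq_in_map => i; rewrite mem_iota /= add0n => lt_i; rewrite e.
Qed.

Lemma sympoly_vanish (p : {mpoly rat[n]}) : p \is symmetric -> (msize p <= d)%N ->
  (forall mu, is_part mu -> part_size mu = n ->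
     mmap (ratr : rat -> algC) (fun i => nth 0 (Xi mu) i) p = 0) -> p = 0.
Proof.
move=> sym_p size_p vanish; have [P [eP wP]] := sym_fundamental sym_p.
rewrite -eP; suff -> : P = 0 by rewrite comp_mpoly0.
(* The (i+1)-st elementary function has weight i+1 and every monomial of P has weight below d. So
   exponents stay below d, and variables with i >= d do not occur. *)
pose b (i : 'I_n) := if (i < d)%N then d else 1%N.
pose phi c (i : 'I_n) : rat := (-1) ^+ i.+1 * (epoly (gridpart c))`_i.+1.
have cell c : ingrid b c -> gridcell c.
  move=> gc i lt_i; have lt_in : (i < n)%N by lia.
  by have := gc (Ordinal lt_in); rewrite /b /= lt_i.
have phiE c (i : 'I_n) : gridcell c -> (i < d)%N ->
    phi c i = (-1) ^+ i.+1 * ((cyclepoly i c)`_i.+1 - (c i)%:R).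
  by move=> gc lt_i; rewrite /phi gridpart_coef.
have cellset c (k : 'I_n) x : gridcell c -> (x < b k)%N -> gridcell (setat c k x).
  by move=> gc; rewrite /b => lt_x i lt_i; rewrite /setat; case: eqP => [e|_]; rewrite ?gc //; move: lt_x; rewrite -e lt_i.
apply: (@grid_vanish n rat P b phi).
- move=> m i mP; have := leq_trans (mmeasure_mnm_lt _ mP) (leq_trans wP size_p).
  rewrite /= /mnmwgt (bigD1 i) //= /b; case: ifP => [_|/negbT]; nia.
- move=> c k i x /cell gc lt_x lt_i; have [lt_k|le_k] := ltnP k d.
    rewrite !phiE ?(ltn_trans lt_i lt_k) //; last exact: cellset.
    congr (_ * (_ - _)); last by rewrite /setat ltn_eqF.
    by congr ((_ : {poly rat})`__); apply: eq_cyclepoly => j lt_j; rewrite /setat ltn_eqF // (ltn_trans lt_j).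
  rewrite /phi (@eq_gridpart _ c) // => j lt_j; rewrite /setat ltn_eqF //.
  exact: leq_trans le_k.
- move=> c k x y /cell gc lt_x lt_y; have [lt_k|le_k] := ltnP k d; last first.
    by move: lt_x lt_y; rewrite /b [(k < d)%N]ltnNge le_k /=; case: x y => [|x] [|y].
  rewrite !phiE //; try exact: cellset.
  have -> : cyclepoly k (setat c k x) = cyclepoly k (setat c k y).
    by apply: eq_cyclepoly => j lt_j; rewrite /setat ltn_eqF.
  move=> /(can_inj (signrMK _))/addrI/oppr_inj/eqP; rewrite /setat eqxx eqr_nat.
  by move/eqP.
- move=> c /cell gc; have pc := gridpart_part gc; have sc := gridpart_size gc.
  apply: (fmorph_inj (ratr : rat -> algC)); rewrite rmorph0 -[RHS](vanish _ pc sc).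
  rewrite -eP; apply/esym/mmap_comp_mpoly => i; rewrite tnth_mktuple.
  exact: mesym_Xi.
Qed.

End GridPartition.

(** * Evaluation of complete homogeneous polynomials *)

Section Truncation.

Variable N : nat.

Definition eqmodX (P Q : {poly algC}) := exists R, P = Q + R * 'X^N.

Lemma eqmodX_refl P : eqmodX P P.
Proof. by exists 0; rewrite mul0r addr0. Qed.

Lemma eqmodX_sym P Q : eqmodX P Q -> eqmodX Q P.
Proof. by case=> R ->; exists (- R); rewrite mulNr addrK. Qed.

Lemma eqmodX_trans P Q R : eqmodX P Q -> eqmodX Q R -> eqmodX P R.
Proof. by case=> U -> [V ->]; exists (V + U); rewrite mulrDl addrA. Qed.

Lemma eqmodXM P P' Q Q' : eqmodX P P' -> eqmodX Q Q' -> eqmodX (P * Q) (P' * Q').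
Proof.
case=> U -> [V ->]; exists (P' * V + U * Q' + U * V * 'X^N); ring.
Qed.

Lemma eqmodX_prod (I : Type) (r : seq I) (Pr : pred I) (F G : I -> {poly algC}) :
  (forall i, Pr i -> eqmodX (F i) (G i)) ->
  eqmodX (\prod_(i <- r | Pr i) F i) (\prod_(i <- r | Pr i) G i).
Proof.
by move=> h; apply: (big_ind2 eqmodX) => //; [apply: eqmodX_refl | move=> *; apply: eqmodXM].
Qed.

Lemma eqmodX_coef P Q k : (k < N)%N -> eqmodX P Q -> P`_k = Q`_k.
Proof. by move=> lt_k [R ->]; rewrite coefD coefMXn lt_k addr0. Qed.

Definition geomz (z : algC) : {poly algC} := \sum_(k < N) z ^+ k *: 'X^k.
Definition geomX (m : nat) : {poly algC} := \sum_(k < N) 'X^(m * k).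

Lemma geomzM z : eqmodX (geomz z * (1 - z *: 'X)) 1.
Proof.
exists (- (z ^+ N)%:P).
have -> : geomz z = \sum_(k < N) (z *: 'X) ^+ k by apply: eq_bigr => k _; rewrite exprZn.
rewrite mulrC -[1 - z *: 'X]opprB mulNr -subrX1 opprB exprZn.
by rewrite -mul_polyC mulNr.
Qed.

Lemma geomXM m : (0 < m)%N -> eqmodX (geomX m * (1 - 'X^m)) 1.
Proof.
case: m => // m _; exists (- 'X^(m * N)).
have -> : geomX m.+1 = \sum_(k < N) ('X^(m.+1)) ^+ k by apply: eq_bigr => k _; rewrite exprM.
rewrite mulrC -[1 - 'X^(m.+1)]opprB mulNr -subrX1 opprB.
by rewrite mulNr -exprD -exprM mulSn addnC.
Qed.

(** Both sides are inverses of 1 - X^m modulo X^N. *)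
Lemma geom_roots m : (0 < m)%N ->
  eqmodX (\prod_(z <- roots_of_unity m) geomz z) (geomX m).
Proof.
move=> m_gt0; set G := \prod_(z <- _) _.
have e1 : eqmodX (G * (1 - 'X^m)) 1.
  rewrite -prod_roots_of_unity // -big_split /=.
  have := @eqmodX_prod _ (roots_of_unity m) xpredT _ (fun=> 1) (fun z _ => geomzM z).
  by rewrite big1_eq.
have e2 := geomXM m_gt0.
apply: (@eqmodX_trans _ (G * (geomX m * (1 - 'X^m)))).
  rewrite -{1}[G]mulr1; apply: eqmodXM; first exact: eqmodX_refl.
  exact: eqmodX_sym.
rewrite mulrCA -{2}[geomX m]mulr1; apply: eqmodXM => //; exact: eqmodX_refl.
Qed.

Lemma geom_Xi mu : is_part mu ->
  eqmodX (\prod_(z <- Xi mu) geomz z) (\prod_(m <- mu) geomX m).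
Proof.
case/andP=> _ mu0; rewrite /Xi big_flatten big_map.
rewrite big_seq [X in eqmodX _ X]big_seq; apply: eqmodX_prod => m m_mu.
by apply: geom_roots; rewrite lt0n; apply: contraNneq mu0 => <-.
Qed.

Lemma prod_geomz n (z : 'I_n -> algC) k :
  (\prod_i geomz (z i))`_k =
  \sum_(g : {ffun 'I_n -> 'I_N} | (\sum_i g i)%N == k) \prod_i z i ^+ g i.
Proof.
rewrite /geomz bigA_distr_bigA /= coef_sum [RHS]big_mkcond; apply: eq_bigr => g _.
rewrite (eq_bigr (fun i => (z i ^+ g i)%:P * 'X^(g i))); last by move=> i _; rewrite mul_polyC.
rewrite big_split -rmorph_prod /= prodrXr coefCM coefXn eq_sym.
by case: eqP => _; rewrite ?mulr1 ?mulr0.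
Qed.

End Truncation.

Lemma fixes_porbit (K : finType) n (w : 'S_n) (g : {ffun 'I_n -> K}) x y :
  fixes w g -> y \in porbit w x -> g y = g x.
Proof.
move=> /forallP fg /porbitP[i ->]; elim: i => [|i IH]; first by rewrite expg0 perm1.
by rewrite expgSr permM (eqP (fg _)).
Qed.

(** A word fixed by w is constant on cycles, so it is a choice of one value per cycle, counted with
    the length of the cycle. *)
Lemma prod_geomX b n (w : 'S_n) k :
  (\prod_(O in porbits w) geomX b.+1 #|O|)`_k =
  #|[set g : {ffun 'I_n -> 'I_b.+1} | fixes w g && ((\sum_x g x)%N == k)]|%:R.
Proof.
rewrite /geomX (big_distr_big ord0) coef_sum.
pose fwd (f : {ffun {set 'I_n} -> 'I_b.+1}) : {ffun 'I_n -> 'I_b.+1} :=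
  [ffun x => f (porbit w x)].
(* The value [ord0] off the set of cycles matches the support condition in the expanded product. *)
pose bwd (g : {ffun 'I_n -> 'I_b.+1}) : {ffun {set 'I_n} -> 'I_b.+1} :=
  [ffun O : {set 'I_n} => if [pick x in O] is Some x then
     (if O \in porbits w then g x else ord0) else ord0].
have porb x : porbit w x \in porbits w by apply: imset_f.
have sumE f : (\sum_x fwd f x = \sum_(O in porbits w) #|O| * f O)%N.
  rewrite (partition_big (porbit w) (mem (porbits w))) //=; apply: eq_bigr => O /imsetP[x0 _ ->].
  rewrite (eq_bigr (fun=> nat_of_ord (f (porbit w x0)))) => [|x /eqP e]; last by rewrite ffunE e.
  by rewrite sum_nat_const; congr (_ * _)%N; apply: eq_card => x; rewrite -eq_porbit_mem.
rewrite -sum1dep_card natr_sum (reindex_onto fwd bwd) /=; last first.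
  move=> g /andP[fg _]; apply/ffunP => x; rewrite !ffunE porb.
  case: pickP => [y|/(_ x)]; last by rewrite porbit_id.
  exact: fixes_porbit.
have fixf f : fixes w (fwd f).
  by apply/forallP => x; have := porbit_perm w 1 x; rewrite expg1 !ffunE => ->.
have supp f : (bwd (fwd f) == f) = (f \in pffun_on ord0 (mem (porbits w)) predT).
  apply/eqP/pffun_onP => [<-|[/subsetP sf _]].
    split=> //; apply/subsetP => O; rewrite inE ffunE; case: pickP => [x _|]; last by rewrite eqxx.
    by case: ifP => // _; rewrite eqxx.
  apply/ffunP => O; rewrite ffunE; case: (boolP (O \in porbits w)) => [/imsetP[x0 _ ->]|nO].
    case: pickP => [x|/(_ x0)]; last by rewrite porbit_id.
    by rewrite -eq_porbit_mem => /eqP e; rewrite ffunE e.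
  have -> : f O = ord0 by apply/eqP; apply: contraNT nO => /(sf O).
  by case: pickP.
rewrite big_mkcond [RHS]big_mkcond /=; apply: eq_bigr => f _.
rewrite fixf supp andbC sumE /=; case: ifP => //= _.
rewrite prodrXr coefXn eq_sym; by case: eqP.
Qed.

(** The generating function of the h_a at [Xi mu] is the product of the series 1/(1 - X^m) over the
    cycles. Exponents in degree a are at most a, hence at most b, so truncation at b+1 is
    harmless. *)
Lemma hsym_eval b n (w : 'S_n) (z : 'I_n -> algC) a mu :
  is_part mu -> cycle_type w = mu -> part_size mu = n -> (a <= b)%N ->
  (forall i, z i = nth 0 (Xi mu) i) ->
  mmap (ratr : rat -> algC) z (hsym a n) =
  #|[set g : {ffun 'I_n -> 'I_b.+1} | fixes w g && ((\sum_x g x)%N == a)]|%:R.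
Proof.
move=> pmu cmu smu le_a zE; rewrite -prod_geomX.
have -> : \prod_(O in porbits w) geomX b.+1 #|O| = \prod_(m <- mu) geomX b.+1 m.
  rewrite -cmu /cycle_type (perm_big _ (permEl (perm_sort _ _))) big_map big_enum /=.
  by apply: eq_bigl => O.
rewrite -(eqmodX_coef _ (geom_Xi b.+1 pmu)) ?ltnS //.
rewrite (big_nth 0) big_mkord size_Xi // smu.
under eq_bigr do rewrite -zE; rewrite prod_geomz.
rewrite /hsym raddf_sum /=.
pose h (g : {ffun 'I_n -> 'I_b.+1}) : 'X_{1..n < a.+1} := insubd bm0 [multinom nat_of_ord (g i) | i < n].
pose h' (m : 'X_{1..n < a.+1}) : {ffun 'I_n -> 'I_b.+1} := [ffun i => inord (m i)].
have hE (g : {ffun 'I_n -> 'I_b.+1}) : (\sum_i g i)%N == a -> h g = [multinom nat_of_ord (g i) | i < n] :> 'X_{1..n}.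
  move=> /eqP sg; rewrite /h insubdK // -topredE /= mdegE.
  by under eq_bigr do rewrite mnmE; rewrite sg.
rewrite (reindex_onto h h') /=; last first.
  move=> m /eqP dm; have le_m i : (m i < b.+1)%N.
    by rewrite ltnS; apply: leq_trans le_a; rewrite -[X in (_ <= X)%N]dm mdegE (bigD1 i) //= leq_addr.
  apply: val_inj => /=; rewrite hE.
    by apply/mnmP => i; rewrite mnmE ffunE inordK.
  by rewrite -[X in _ == X]dm mdegE; apply/eqP/eq_bigr => i _; rewrite ffunE inordK.
have key (g : {ffun 'I_n -> 'I_b.+1}) : (mdeg (h g) == a) && (h' (h g) == g) = ((\sum_i g i)%N == a).
  have [sg|nsg] := boolP ((\sum_i g i)%N == a).
    rewrite hE // mdegE; under eq_bigr do rewrite mnmE.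
    by rewrite sg /=; apply/eqP/ffunP => i; rewrite ffunE hE // mnmE inord_val.
  apply/negbTE/negP => /andP[/eqP dg /eqP e]; case/negP: nsg.
  rewrite -[X in _ == X]dg mdegE; apply/eqP/eq_bigr => i _; rewrite -{1}e ffunE inordK // ltnS.
  by apply: leq_trans le_a; rewrite -[X in (_ <= X)%N]dg mdegE (bigD1 i) //= leq_addr.
apply: eq_big => [g|g]; rewrite key // => sg.
by rewrite mmapX /mmap1; apply: eq_bigr => i _; rewrite hE // mnmE.
Qed.

Section HProduct.

Variables (alpha : seq nat) (b n : nat) (w : 'S_n) (mu : seq nat).
Hypotheses (pmu : is_part mu) (cmu : cycle_type w = mu) (smu : part_size mu = n).
Hypothesis alpha_le : forall a, a \in alpha -> (a <= b)%N.

Definition expvec := {ffun 'I_(size alpha) -> 'I_b.+1}.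
Definition expwt (e : expvec) (j : 'I_(size alpha)) : nat := e j.
Definition alphafun (j : 'I_(size alpha)) : nat := nth 0%N alpha j.

Lemma hprod_eval :
  mmap (ratr : rat -> algC) (fun i : 'I_n => nth 0 (Xi mu) i) (\prod_(a <- alpha) hsym a n) =
  thetaH n expwt alphafun w.
Proof.
rewrite rmorph_prod /= (big_nth 0%N) big_mkord.
rewrite (eq_bigr (fun j : 'I_(size alpha) => \sum_(g : {ffun 'I_n -> 'I_b.+1})
   (fixes w g && ((\sum_x g x)%N == alphafun j))%:R)); last first.
  move=> j _; rewrite (hsym_eval (b := b) pmu cmu smu _ (fun=> erefl)) ?alpha_le ?mem_nth //.
  rewrite -sum1dep_card natr_sum big_mkcond; apply: eq_bigr => g _; by case: ifP.
rewrite bigA_distr_bigA thetaE.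
pose flip (G : {ffun 'I_(size alpha) -> {ffun 'I_n -> 'I_b.+1}}) : {ffun 'I_n -> expvec} :=
  [ffun x => [ffun j => G j x]].
pose flop (g : {ffun 'I_n -> expvec}) : {ffun 'I_(size alpha) -> {ffun 'I_n -> 'I_b.+1}} :=
  [ffun j => [ffun x => g x j]].
rewrite [RHS]big_mkcond (reindex flop) /=; last first.
  exists flip => g _; first by apply/ffunP => x; apply/ffunP => j; rewrite !ffunE.
  by apply/ffunP => x; apply/ffunP => j; rewrite !ffunE.
apply: eq_bigr => g _.
have wtE j : (\sum_e content g e * expwt e j = \sum_x flop g j x)%N.
  rewrite (partition_big g predT) //=; apply: eq_bigr => e _.
  rewrite (eq_bigr (fun=> expwt e j)) => [|x /eqP <-]; last by rewrite !ffunE.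
  by rewrite sum_nat_const ffunE cardsE.
have [fg|nfg] := boolP (fixes w g).
  have fj j : fixes w (flop g j).
    by apply/forallP => x; rewrite !ffunE (eqP (forallP fg x)).
  have [/forallP wg|/forallPn[j nj]] := boolP (weighted _ _ _).
    by rewrite big1 // => j _; rewrite fj -wtE wg.
  by rewrite (bigD1 j) //= fj -wtE (negbTE nj) mul0r.
have [x nx] := forallPn nfg.
have /eqfunP/forallPn[j nj] : ~ (g (w x) =1 g x) by move/ffunP/eqP; apply/negP.
rewrite (bigD1 j) //= [fixes _ _](_ : _ = false) ?mul0r //.
by apply/negP => /forallP/(_ x); rewrite !ffunE; apply/negP.
Qed.

End HProduct.

(** * A permutation of prescribed cycle type *)

Section CycleType.

Variable mu : seq nat.
Hypothesis pmu : is_part mu.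

Local Notation n := (part_size mu).

(** Each block of consecutive positions is rotated cyclically by one, so that the blocks become the
    cycles. *)
Definition rotfun (x : 'I_n) : 'I_n :=
  let i := reshape_index mu x in
  insubd x (flatten_index mu i ((reshape_offset mu x).+1 %% nth 0 mu i)).

Let idx_lt (x : 'I_n) : (reshape_index mu x < size mu)%N.
Proof. exact: reshape_indexP. Qed.

Let off_lt (x : 'I_n) : (reshape_offset mu x < nth 0 mu (reshape_index mu x))%N.
Proof. exact: reshape_offsetP. Qed.

Let flat_lt i j : (i < size mu)%N -> (j < nth 0 mu i)%N -> (flatten_index mu i j < n)%N.
Proof.
move=> lt_i lt_j; rewrite /part_size -[mu in X in (_ < X)%N](cat_take_drop i.+1).
rewrite sumn_cat (take_nth 0%N) // sumn_rcons /flatten_index.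
by apply: leq_trans (leq_addr _ _); rewrite ltn_add2l.
Qed.

Lemma rotfunE x : rotfun x = flatten_index mu (reshape_index mu x)
  ((reshape_offset mu x).+1 %% nth 0 mu (reshape_index mu x)) :> nat.
Proof.
rewrite /rotfun insubdK // -topredE /=; apply: flat_lt => //.
by rewrite ltn_mod; apply: leq_ltn_trans (off_lt x).
Qed.

Lemma rot_index x : reshape_index mu (rotfun x) = reshape_index mu x.
Proof.
by rewrite rotfunE flatten_indexKl // ltn_mod; apply: leq_ltn_trans (off_lt x).
Qed.

Lemma rot_offset x : reshape_offset mu (rotfun x) =
  ((reshape_offset mu x).+1 %% nth 0 mu (reshape_index mu x))%N.
Proof.
by rewrite rotfunE flatten_indexKr // ltn_mod; apply: leq_ltn_trans (off_lt x).
Qed.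

Lemma rotfun_inj : injective rotfun.
Proof.
move=> x y e; have ei : reshape_index mu x = reshape_index mu y.
  by rewrite -rot_index e rot_index.
have eo := congr1 (fun z : 'I_n => reshape_offset mu z) e; move: eo; rewrite /= !rot_offset -ei => eo.
apply: val_inj => /=; rewrite -(reshape_indexK mu x) -(reshape_indexK mu y) -ei; congr flatten_index.
have := off_lt x; have := off_lt y; rewrite -ei => ly lx.
by move/eqP: eo; rewrite -(addn1 (reshape_offset mu x)) -(addn1 (reshape_offset mu y)) eqn_modDr !modn_small // => /eqP.
Qed.

Definition rotperm : 'S_n := perm rotfun_inj.

Lemma rot_iter x j : reshape_index mu ((rotperm ^+ j)%g x) = reshape_index mu x /\
  reshape_offset mu ((rotperm ^+ j)%g x) =
    ((reshape_offset mu x + j) %% nth 0 mu (reshape_index mu x))%N.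
Proof.
elim: j => [|j [IH1 IH2]]; first by rewrite expg0 perm1 addn0 modn_small.
rewrite expgSr permM permE rot_index rot_offset IH1 IH2; split=> //.
by rewrite -addn1 modnDml addn1 addnS.
Qed.

Lemma porbit_rot x : porbit rotperm x = [set y : 'I_n | reshape_index mu y == reshape_index mu x].
Proof.
apply/setP => y; rewrite inE; apply/porbitP/eqP => [[j ->]|e].
  by case: (rot_iter x j).
set m := nth 0%N mu (reshape_index mu x); have := off_lt x; have := off_lt y; rewrite e -/m => ly lx.
exists (reshape_offset mu y + (m - reshape_offset mu x))%N.
have [e1 e2] := rot_iter x (reshape_offset mu y + (m - reshape_offset mu x)).
apply: val_inj => /=; rewrite -[LHS](reshape_indexK mu) -[RHS](reshape_indexK mu) e1 e e2 -/m.
congr flatten_index.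
have -> : (reshape_offset mu x + (reshape_offset mu y + (m - reshape_offset mu x)) = reshape_offset mu y + m)%N by lia.
by rewrite modnDr modn_small.
Qed.

Lemma cycle_type_rot : cycle_type rotperm = mu.
Proof.
have nth_pos (i : 'I_(size mu)) : (0 < nth 0 mu i)%N.
  by case/andP: pmu => _; rewrite lt0n; apply: contraNneq => <-; apply: mem_nth.
pose B (i : 'I_(size mu)) := [set y : 'I_n | reshape_index mu y == i].
pose pt (i : 'I_(size mu)) : 'I_n := Ordinal (flat_lt (ltn_ord i) (nth_pos i)).
have ptE i : reshape_index mu (pt i) = i by rewrite /= flatten_indexKl.
have Binj : injective B.
  move=> i j /setP/(_ (pt i)); rewrite !inE ptE eqxx => /esym/eqP; exact: val_inj.
have card_B i : #|B i| = nth 0%N mu i.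
  rewrite -[RHS]card_ord.
  have flt (j : 'I_(nth 0 mu i)) := flat_lt (ltn_ord i) (ltn_ord j).
  rewrite -(card_imset predT (f := fun j : 'I_(nth 0 mu i) => Ordinal (flt j))).
    apply: eq_card => y; rewrite inE; apply/eqP/imsetP => [e|[j _ ->]]; last first.
      by rewrite /= flatten_indexKl.
    have lt_o := off_lt y; rewrite e in lt_o; exists (Ordinal lt_o) => //.
    by apply: val_inj; rewrite /= -e reshape_indexK.
  move=> j k /(congr1 val) /= /(congr1 (reshape_offset mu)).
  by rewrite !flatten_indexKr // => /val_inj.
have porbE : porbits rotperm = [set B i | i : 'I_(size mu)].
  apply/setP => O; apply/imsetP/imsetP => [[x _ ->]|[i _ ->]].
    by exists (Ordinal (idx_lt x)) => //; rewrite porbit_rot.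
  by exists (pt i) => //; rewrite porbit_rot ptE.
rewrite /cycle_type; apply: (sorted_eq (leT := geq)).
- by move=> a b' c /= h1 h2; apply: leq_trans h2 h1.
- by move=> a b' /= /andP[h1 h2]; apply/eqP; rewrite eqn_leq h1 h2.
- by apply: sort_sorted => a b'; apply: leq_total.
- by case/andP: pmu.
rewrite perm_sort porbE.
have pe : perm_eq (enum [set B i | i : 'I_(size mu)]) [seq B i | i <- enum 'I_(size mu)].
  apply: uniq_perm; [exact: enum_uniq | by rewrite map_inj_uniq //; apply: enum_uniq|] => O.
  by rewrite mem_enum; apply/imsetP/mapP => -[i _ ->]; exists i; rewrite ?mem_enum.
rewrite (perm_trans (perm_map _ pe)) // -map_comp (eq_map (g := fun i : 'I_(size mu) => nth 0%N mu i)) //.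
rewrite -[mu in X in perm_eq _ X](mkseq_nth 0%N) /mkseq -val_enum_ord -map_comp.
exact: perm_refl.
Qed.

End CycleType.

Local Close Scope ring_scope.
Local Open Scope nat_scope.

(** * Labels *)

Lemma letter_le_trans : transitive letter_le.
Proof. by case=> i [] j [] k //=; apply: leq_trans. Qed.

Lemma letter_le_anti : antisymmetric letter_le.
Proof. by case=> i [] j //=; rewrite -eqn_leq => /eqP->. Qed.

Lemma letter_le_total : total letter_le.
Proof. by case=> i [] j //=; apply: leq_total. Qed.

Lemma lex_le_refl : reflexive lex_le.
Proof. by elim=> //= x u IH; rewrite eqxx. Qed.

Lemma lex_le_anti : antisymmetric lex_le.
Proof.
elim=> [|x u IH] [|y v] //=; have [->|ne] := eqVneq x y.
  by move/IH=> ->.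
by move/letter_le_anti/eqP; rewrite (negbTE ne).
Qed.

Lemma lex_le_total : total lex_le.
Proof.
elim=> [|x u IH] [|y v] //=; have [_|_] := eqVneq x y; first exact: IH.
exact: letter_le_total.
Qed.

Lemma lex_le_trans : transitive lex_le.
Proof.
move=> v u w; elim: v u w => [|y v IH] [|x u] [|z w] //=.
case: (eqVneq x y) => [exy|nexy]; case: (eqVneq y z) => [eyz|neyz].
- by rewrite exy eyz eqxx; apply: IH.
- by rewrite exy (negbTE neyz).
- by rewrite -eyz (negbTE nexy).
- have [exz|nexz] := eqVneq x z; last exact: letter_le_trans.
  move=> h1 h2; have /letter_le_anti e : letter_le y z && letter_le z y by rewrite h2 -exz.
  by rewrite e eqxx in neyz.
Qed.

Lemma label_le_refl : reflexive label_le.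
Proof. by move=> M; apply: lex_le_refl. Qed.

Lemma label_le_anti : antisymmetric label_le.
Proof. by move=> M N /lex_le_anti/(can_inj revK). Qed.

Lemma label_le_total : total label_le.
Proof. by move=> M N; apply: lex_le_total. Qed.

Lemma label_le_trans : transitive label_le.
Proof. by move=> N M P; apply: lex_le_trans. Qed.

Definition bar (k : nat) : seq letter := if k is k'.+1 then [:: inl k'] else [::].

(** Here u and v are reversed unbarred parts. A barred letter stands last in a reversed label and is
    smaller than every unbarred one, so it matters only when u and v agree. *)
Lemma lex_le_bar (u v : seq letter) k k' : all (predC barred) u -> all (predC barred) v ->
  lex_le (u ++ bar k) (v ++ bar k') = if u == v then k <= k' else lex_le u v.
Proof.
elim: u v => [|x u IH] [|y v] //=.
- move=> _ _; case: k k' => [|k] [|k'] //=; case: eqP => [[->]|ne]; rewrite ?leqnn //.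
- by case: y => //= y _ _; case: k => [|k] //=; case: eqP.
- by clear IH; case: x => //= x _ _; case: k' => [|k'] //=; case: eqP.
move=> /andP[_ hu] /andP[_ hv]; rewrite eqseq_cons.
by case: eqP => //= _; apply: IH.
Qed.

(** On a sorted sequence a downward closed predicate holds on an initial segment whose length is its
    count ([pref]). This converts the cell by cell form of column strictness into the counting form
    used for arrays. *)
Lemma sorted_dominance (s s' : seq nat) : sorted leq s -> sorted leq s' -> size s' <= size s ->
  (forall p, p < size s' -> nth 0 s p < nth 0 s' p) <->
  (forall x, count (fun z => z <= x) s' <= count (fun z => z < x) s).
Proof.
have pref (t : seq nat) (P : pred nat) : sorted leq t -> (forall a b, a <= b -> P b -> P a) ->
    forall p, p < size t -> (p < count P t) = P (nth 0 t p).
  elim: t => // a t IH srt hP [|p] /= lt_p.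
    case Pa : (P a) => //=; rewrite add0n; apply/negbTE; rewrite -leqNgt leqn0.
    rewrite -[count P t]/(count P t) -leqn0 leqNgt -has_count; apply/hasPn => b bt.
    by apply: contraFN Pa; apply: hP; apply: (allP (order_path_min leq_trans srt)).
  rewrite -(IH (path_sorted srt) hP) //; case Pa : (P a); first by rewrite add1n ltnS.
  rewrite add0n; have : count P t = 0.
    apply/eqP; rewrite -leqn0 leqNgt -has_count; apply/hasPn => b bt.
    by apply: contraFN Pa; apply: hP; apply: (allP (order_path_min leq_trans srt)).
  by move=> ->; rewrite !ltn0.
move=> srt srt' le_s; split=> [h x|h p lt_p].
  set c := count _ s'; case: (leqP c (count (fun z => z < x) s)) => // lt_c.
  have lt_s' : (count (fun z => z < x) s) < size s' by apply: leq_trans lt_c (count_size _ _).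
  have lt_s := leq_trans lt_s' le_s.
  have := pref s' (fun z => z <= x) srt' _ _ lt_s'; rewrite -/c lt_c => e1.
  have := pref s (fun z => z < x) srt _ _ lt_s; rewrite ltnn => e2.
  have {}e1 : nth 0 s' (count (fun z => z < x) s) <= x by rewrite -e1 // => a b; apply: leq_trans.
  have := h _ lt_s'; move/leq_trans/(_ e1); rewrite -e2 // => a b; apply: leq_ltn_trans.
have lt_s := leq_trans lt_p le_s.
rewrite -(pref s (fun z => z < nth 0 s' p)) //; last by move=> a b; apply: leq_ltn_trans.
apply: leq_trans (h _); rewrite (pref s' (fun z => z <= nth 0 s' p)) // => a b.
exact: leq_trans.
Qed.

(** In a weakly decreasing chunk all letters j+1 come before all letters j, so a whole chunk of j+1
    has to be paid for by the letters j of the preceding chunks. *)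
Lemma lattice_chunks (cs : seq (seq nat)) : all (sorted geq) cs ->
  lattice_word (flatten cs) <->
  (forall i j, i < size cs ->
     count_mem j.+1 (flatten (take i.+1 cs)) <= count_mem j (flatten (take i cs))).
Proof.
move=> srt; split=> [h i j lt_i|h k j].
  pose c := nth [::] cs i; have srt_c : sorted geq c by apply: (allP srt); apply: mem_nth.
  (* The prefix ends inside chunk i just after its letters above j, where the comparison of j+1 with
     j is tightest. *)
  pose k := size (flatten (take i cs)) + count (fun x => j < x) c.
  have cE : flatten cs = flatten (take i cs) ++ c ++ flatten (drop i.+1 cs).
    by rewrite -[in LHS](cat_take_drop i cs) (drop_nth [::] lt_i) flatten_cat.
  have := h k j; rewrite cE /k takeD take_size_cat // drop_size_cat // !count_cat.
  have split_c : forall t : seq nat, sorted geq t ->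
      take (count (fun x => j < x) t) t = [seq x <- t | j < x].
    elim=> // a t IH srt_t /=; case: ltnP => [lt_a|le_a]; first by rewrite add1n /= IH ?(path_sorted srt_t).
    rewrite add0n; have all_t : all (fun b => b <= a) t.
      by apply: (order_path_min _ srt_t) => x y z h1 h2; apply: leq_trans h2 h1.
    have -> : count (fun x => j < x) t = 0.
      apply/eqP; rewrite -leqn0 leqNgt -has_count; apply/hasPn => b /(allP all_t) le_b.
      by rewrite -leqNgt (leq_trans le_b).
    rewrite take0; apply/esym/eqP; rewrite -(filter_pred0 t); apply/eqP/eq_in_filter => b /(allP all_t) le_b.
    by apply/negbTE; rewrite -leqNgt (leq_trans le_b).
  have lt_k : count (fun x => j < x) c <= size c by apply: count_size.
  rewrite takel_cat // split_c // (take_nth [::] lt_i) -/c flatten_rcons count_cat.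
  rewrite !count_filter [X in _ <= _ + X](eq_count (a2 := pred0)) ?count_pred0 ?addn0; last first.
    by move=> x /=; case: eqP => // ->; rewrite ltnn.
  move=> le; apply: leq_trans le; rewrite leq_add2l; apply: sub_count => x /= /eqP->.
  by rewrite eqxx ltnSn.
have [le_k|lt_k] := leqP (size (flatten cs)) k.
  rewrite take_oversize //; case: (posnP (size cs)) => [/size0nil->//|lt_s].
  have := h (size cs).-1 j; rewrite prednK // leqnn take_size => /(_ isT)/leq_trans; apply.
  rewrite -[X in _ <= count_mem j (flatten X)](cat_take_drop (size cs).-1 cs) flatten_cat count_cat; exact: leq_addr.
pose i := reshape_index (shape cs) k; pose o := reshape_offset (shape cs) k.
have lt_k' : k < sumn (shape cs) by rewrite -size_flatten.
have lt_i : i < size cs by have := reshape_indexP lt_k'; rewrite size_map.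
have ek : k = size (flatten (take i cs)) + o.
  rewrite -(reshape_indexK (shape cs) k) /flatten_index size_flatten /shape map_take.
  by rewrite -/i -/o.
have cE : flatten cs = flatten (take i cs) ++ flatten (drop i cs).
  by rewrite -flatten_cat cat_take_drop.
have lt_o : o <= size (nth [::] cs i).
  by have := reshape_offsetP lt_k'; rewrite -/i -/o (nth_map [::]) // => /ltnW.
rewrite ek cE takeD take_size_cat // drop_size_cat // !count_cat.
apply: leq_trans (leq_addr _ _); apply: leq_trans (h i j lt_i).
rewrite (take_nth [::] lt_i) flatten_rcons count_cat leq_add2l.
rewrite (drop_nth [::] lt_i) /= takel_cat //.
by rewrite -[X in _ <= count _ X](cat_take_drop o) count_cat leq_addr.
Qed.

Section LabelCode.

Variables (alpha : seq nat) (b : nat).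
Local Notation E := (expvec alpha b).
Local Notation L := (size alpha).

Definition unat (e : E) : seq nat := sort leq (flatten [seq nseq (e i) (i : nat) | i : 'I_L]).
Definition ulab (e : E) : label := [seq inr i | i <- unat e].
Definition flab (e : E) (k : nat) : label := bar k ++ ulab e.

Lemma count_unat e j : count_mem j (unat e) = \sum_(i < L) (i == j :> nat) * e i.
Proof.
rewrite (seq.permP (permEl (perm_sort _ _))) count_flatten sumnE -map_comp big_map big_enum /=.
by apply: eq_bigr => i _; rewrite count_nseq.
Qed.

Lemma count_ulab e (x : letter) :
  count_mem x (ulab e) = if x is inr j then count_mem j (unat e) else 0.
Proof.
rewrite count_map; case: x => j; last by apply: eq_count => i; rewrite /=; apply/eqP/eqP => [[->]|->].
by rewrite (eq_count (a2 := pred0)) ?count_pred0.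
Qed.

Lemma count_unat_ord e (i : 'I_L) : count_mem (val i) (unat e) = e i.
Proof.
rewrite count_unat (bigD1 i) //= eqxx mul1n big1 ?addn0 // => j.
by rewrite -val_eqE /= => /negbTE->.
Qed.

Lemma ulab_inj : injective ulab.
Proof.
move=> e e' h; apply/ffunP => i; apply: val_inj; rewrite /= -!count_unat_ord.
by have := congr1 (count_mem (inr (val i) : letter)) h; rewrite !count_ulab.
Qed.

Lemma ulab_unbarred e : all (predC barred) (ulab e).
Proof. by apply/allP => _ /mapP[i _ ->]. Qed.

Lemma ulab_sorted e : sorted letter_le (ulab e).
Proof.
rewrite sorted_map; apply: (sub_sorted (e := leq)) => //.
by apply: sort_sorted; apply: leq_total.
Qed.

Lemma unbarred_flab e k : unbarred_part (flab e k) = ulab e.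
Proof.
rewrite /unbarred_part /flab filter_cat; have -> : [seq x <- bar k | ~~ barred x] = [::] by case: k.
exact/all_filterP/ulab_unbarred.
Qed.

Lemma bars_flab e k : bars (flab e k) = if k is k'.+1 then [:: k'] else [::].
Proof.
rewrite /bars /flab pmap_cat; have -> : forall s : seq nat, pmap (fun x : letter =>
   if x is inl j then Some j else None) [seq inr i | i <- s] = [::] by elim.
by rewrite cats0; case: k.
Qed.

Lemma flab_sorted e k : sorted letter_le (flab e k).
Proof.
case: k => [|k]; first exact: ulab_sorted.
rewrite /= (path_sortedE letter_le_trans) ulab_sorted andbT.
by apply/allP => _ /mapP[i _ ->].
Qed.

Lemma flab_barred e k : count barred (flab e k) <= 1.
Proof.
rewrite count_cat [X in _ + X](_ : _ = 0) ?addn0; first by case: k.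
by apply/eqP; rewrite -leqn0 leqNgt -has_count; apply/hasPn => x; apply: (allP (ulab_unbarred e)).
Qed.

Definition urank (e : E) : nat := index (ulab e) (sort label_le [seq ulab e | e : E]).

Let S0 := sort label_le [seq ulab e | e : E].

Lemma mem_S0 e : ulab e \in S0.
Proof. by rewrite mem_sort; apply: map_f; rewrite mem_enum. Qed.

Lemma uniq_S0 : uniq S0.
Proof. by rewrite sort_uniq map_inj_uniq ?enum_uniq //; apply: ulab_inj. Qed.

Lemma size_S0 : size S0 = #|E|.
Proof. by rewrite size_sort size_map -cardE. Qed.

Lemma nth_S0 e : nth [::] S0 (urank e) = ulab e.
Proof. by apply: nth_index; apply: mem_S0. Qed.

Lemma urank_inj : injective urank.
Proof. by move=> e e' h; apply: ulab_inj; rewrite -!nth_S0 h. Qed.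

Lemma urank_lt e : urank e < #|E|.
Proof. by rewrite -size_S0 index_mem mem_S0. Qed.

Lemma urank_le e e' : (urank e <= urank e') = label_le (ulab e) (ulab e').
Proof.
have srt : sorted label_le S0 by apply: sort_sorted; apply: label_le_total.
have le x y : urank x <= urank y -> label_le (ulab x) (ulab y).
  by apply: (sorted_leq_index label_le_trans label_le_refl srt); apply: mem_S0.
apply/idP/idP => [|h]; first exact: le.
rewrite leqNgt; apply/negP => lt; have := le _ _ (ltnW lt) => h'.
have /label_le_anti/ulab_inj eq_e : label_le (ulab e) (ulab e') && label_le (ulab e') (ulab e) by rewrite h h'.
by rewrite eq_e ltnn in lt.
Qed.

Variable n : nat.

Local Notation epos := (lexpos urank).

(** The reverse lexicographic order compares the unbarred parts and then the bars, with no bar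
    smallest. It is therefore the lexicographic order of pairs used for arrays, and labels may be
    replaced by their positions. *)
Lemma flab_le e e' (k k' : 'I_n) :
  label_le (flab e k) (flab e' k') = (epos (e, k) <= epos (e', k')).
Proof.
have rb j : rev (bar j) = bar j by case: j.
rewrite /label_le /flab !rev_cat !rb lex_le_bar ?all_rev ?ulab_unbarred //.
rewrite (inj_eq (can_inj revK)) (inj_eq ulab_inj) -/(label_le _ _) -urank_le /lexpos /=.
have lk := ltn_ord k; have lk' := ltn_ord k'.
have [->|ne] := eqVneq e e'; first by rewrite leq_add2l.
have ner : urank e <> urank e' by move/urank_inj/eqP; apply/negP.
by apply/idP/idP; nia.
Qed.

Lemma flab_inj e e' (k k' : 'I_n) : flab e k = flab e' k' -> (e, k) = (e', k').
Proof.
move=> h; apply: (epos_inj urank_inj); apply/eqP; rewrite eqn_leq -!flab_le h.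
by rewrite label_le_refl.
Qed.

Definition e0 : E := [ffun=> ord0].

Lemma ulab_e0 : ulab e0 = [::].
Proof.
apply/eqP; rewrite -size_eq0 -all_pred0; apply/allP => x /mapP[j + _].
rewrite -has_pred1 has_count count_unat big1 // => i _.
by rewrite ffunE muln0.
Qed.

Lemma flab_nil e k : (flab e k == [::]) = (e == e0) && (k == 0).
Proof.
case: k => [|k]; last by rewrite andbF.
by rewrite andbT /flab /= -ulab_e0 (inj_eq ulab_inj).
Qed.

Lemma urank_e0 : urank e0 = 0.
Proof.
case: (posnP (urank e0)) => // lt0; have lt : 0 < #|E| by apply: leq_ltn_trans (urank_lt e0).
have : nth [::] S0 0 \in S0 by apply: mem_nth; rewrite size_S0.
rewrite mem_sort => /mapP[e _ h].
have ue : urank e = 0 by rewrite /urank -h index_uniq ?uniq_S0 // size_S0.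
by have := urank_le e0 e; rewrite ulab_e0 ue leqn0 => /eqP.
Qed.

(** The default 0 is also the position of the empty label. *)
Definition labcode (M : label) : nat :=
  if [pick p : E * 'I_n | flab p.1 p.2 == M] is Some p then epos p else 0.

Lemma codeE e (k : 'I_n) : labcode (flab e k) = epos (e, k).
Proof.
rewrite /labcode; case: pickP => [[e' k'] /eqP /= /flab_inj -> //|/(_ (e, k))].
by rewrite eqxx.
Qed.

Definition validl (M : label) := [exists p : E * 'I_n, flab p.1 p.2 == M] && (M != [::]).

Lemma code_le M N : validl M -> validl N -> label_le M N = (labcode M <= labcode N).
Proof.
case/andP=> /existsP[[e k] /eqP <-] _ /andP[/existsP[[e' k'] /eqP <-] _] /=.
by rewrite !codeE flab_le.
Qed.

Lemma code_inj M N : validl M -> validl N -> labcode M = labcode N -> M = N.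
Proof.
move=> vM vN h; apply: label_le_anti; rewrite !code_le // h leqnn //.
Qed.

Lemma sum_flab (R : seq label) (F : label -> nat) : all validl R ->
  \sum_(p : E * 'I_n) count_mem (flab p.1 p.2) R * F (flab p.1 p.2) = \sum_(M <- R) F M.
Proof.
elim: R => [|M R IH] /=; first by rewrite big_nil big1.
case/andP=> /andP[/existsP[p0 /eqP ep] _] vR; rewrite big_cons -IH //.
under eq_bigr do rewrite mulnDl; rewrite big_split /=; congr (_ + _).
rewrite (bigD1 p0) //= ep eqxx mul1n big1 ?addn0 // => p ne.
case: eqP => [h|]; last by rewrite mul0n.
by case/eqP: ne; case: p p0 ep h => e k [e' k'] /= <- /flab_inj.
Qed.

Lemma validl_label M : validl M -> is_label M.
Proof.
by case/andP=> /existsP[[e k] /eqP <-] ne; rewrite /is_label flab_sorted ne flab_barred.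
Qed.

(** A label within the bounds on its content is recovered from its exponent vector and its bar,
    since sorted sequences with equal letter counts are equal. *)
Lemma label_validl M : is_label M -> (forall j, inl j \in M -> j.+1 < n) ->
  (forall j : nat, count_mem (inr j : letter) M <= (if j < L then b else 0)) -> 0 < n -> validl M.
Proof.
case/and3P=> srt ne cb hbar hun n_gt0; rewrite /validl ne andbT; apply/existsP.
pose e : E := [ffun i => inord (count_mem (inr (val i) : letter) M)].
have eE (i : 'I_L) : e i = count_mem (inr (val i) : letter) M :> nat.
  by rewrite ffunE inordK // ltnS; have := hun i; rewrite ltn_ord.
pose k := if bars M is j :: _ then j.+1 else 0.
have lt_k : k < n.
  rewrite /k; case E1 : (bars M) => [//|j s]; apply: hbar.
  have : j \in bars M by rewrite E1 mem_head.
  by rewrite mem_pmap => /mapP[[i|i] iM] // [->].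
have barsM : bars M = if k is k'.+1 then [:: k'] else [::].
  have : size (bars M) <= 1 by rewrite size_pmap; apply: leq_trans cb; apply: sub_count => -[].
  by rewrite /k; case: (bars M) => [|j [|]].
exists (e, Ordinal lt_k); apply/eqP => /=.
apply: (sorted_eq letter_le_trans letter_le_anti) => //; first exact: flab_sorted.
apply/allP => x _ /=; apply/eqP.
rewrite count_cat count_ulab; case: x => j.
  rewrite addn0; have -> : count_mem (inl j : letter) M = count_mem j (bars M).
    rewrite /bars; elim: (M) => //= -[i|i] s -> //=.
  by rewrite barsM; case: (k) => [|k'] //=; rewrite !addn0; case: eqP => [[->]|]; rewrite ?eqxx //; case: eqP => // ->.
have -> : count_mem (inr j : letter) (bar k) = 0 by case: (k).
rewrite add0n; have [lt_j|le_j] := ltnP j L; first by rewrite (count_unat_ord e (Ordinal lt_j)) eE.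
have := hun j; rewrite ltnNge le_j /= leqn0 => /eqP->.
rewrite count_unat big1 // => i _; case: eqP => // h; have := ltn_ord i.
by rewrite h ltnNge le_j.
Qed.

End LabelCode.

(** * Tableaux and arrays *)

Lemma flatten_map_filter (T T' : eqType) (p : pred T) (f : T -> seq T') (s : seq T) :
  (forall x, x \in s -> ~~ p x -> f x = [::]) ->
  flatten [seq f x | x <- s & p x] = flatten [seq f x | x <- s].
Proof.
elim: s => //= x s IH h; have IH' := IH (fun y ys => h y (mem_behead (s := x :: s) ys)).
by case: ifP => px /=; rewrite IH' // (h x (mem_head _ _)) ?px.
Qed.

Lemma flatten_map_flatten (T T' : Type) (f : T -> seq T') (ss : seq (seq T)) :
  flatten [seq f x | x <- flatten ss] = flatten [seq flatten [seq f x | x <- s] | s <- ss].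
Proof. by elim: ss => //= s ss IH; rewrite map_cat flatten_cat IH. Qed.

Lemma flatten_iotaM (T : Type) (f : nat -> seq T) d n :
  flatten [seq f t | t <- iota 0 (d * n)] =
  flatten [seq flatten [seq f (i * n + r) | r <- iota 0 n] | i <- iota 0 d].
Proof.
elim: d => [|d IH]; first by rewrite mul0n.
rewrite -[d.+1]addn1 mulnDl mul1n !iotaD !map_cat !flatten_cat IH !add0n /= cats0.
by congr (_ ++ _); rewrite -{1}[d * n]addn0 iotaDl -map_comp.
Qed.

Lemma transpE n (E : finType) (a : {ffun (E * 'I_n) * 'I_n -> 'I_n.+1}) p :
  transp a p = a ((p.1.1, p.2), p.1.2).
Proof. by rewrite ffunE. Qed.

(** Below the empty label there is nothing to count, so the inequality between row r-1 and row r at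
    this label leaves no room for it in row r: empty labels occur in the bottom row only. *)
Lemma rowlat_zero alpha b n (a : {ffun (expvec alpha b * 'I_n) * 'I_n -> 'I_n.+1}) (r k : 'I_n) :
  rowlat (@urank alpha b) a -> 0 < r -> k = 0 :> nat -> a ((e0 alpha b, r), k) = 0 :> nat.
Proof.
move=> rl r_gt0 k0; have lt_r : r.-1 < n by have := ltn_ord r; lia.
have /forallP/(_ (e0 alpha b))/forallP/(_ (Ordinal lt_r))/forallP/(_ r)/forallP/(_ k)/implyP := rl.
rewrite /= prednK // => /(_ (eqxx _)).
have -> : rowcum (@urank alpha b) a (e0 alpha b) (Ordinal lt_r) k = 0.
  by rewrite /rowcum urank_e0 big_pred0 // big_pred0 // => k'; rewrite k0.
rewrite leqn0 /rowcum addn_eq0 => /andP[_].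
by rewrite (bigD1 k) //= addn_eq0 => /andP[/eqP].
Qed.

Section Arrays.

Variables (alpha lam gam : seq nat) (b n : nat).
Hypotheses (plam : is_part lam) (pgam : is_part gam).
Hypothesis alpha_le : forall a, a \in alpha -> a <= b.
(** A bottom row recorded with at most |lam| + |alpha| cells leaves, for such n, at least gam_1 and
    at least lam_1 empty labels. The summand 2 provides room for the extra first part and for letter
    1 even if all partitions are empty. *)
Hypothesis n_big : sumn gam + sumn gam + sumn lam + sumn lam + sumn alpha + 2 <= n.

Local Notation E := (expvec alpha b).
Local Notation L := (size alpha).
Local Notation e0 := (e0 alpha b).
Local Notation valid := (validl alpha b n).
Local Notation code := (labcode alpha b n).
Local Notation epos := (lexpos (@urank alpha b)).
Local Notation S0 := (sort label_le [seq ulab e | e : E]).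
Local Notation array := {ffun (E * 'I_n) * 'I_n -> 'I_n.+1}.
Local Notation eposI := (epos_inj (n := n) (@urank_inj alpha b)).
Local Notation eposL := (epos_lt (n := n) (@urank_lt alpha b)).

Let n_gt0 : 0 < n. Proof. by lia. Qed.
Let o0 : 'I_n := Ordinal n_gt0.

Let size_gam : size gam <= sumn gam. Proof. exact: size_part_le. Qed.
Let size_lam : size lam <= sumn lam. Proof. exact: size_part_le. Qed.
Let nth_le_sumn (s : seq nat) i : nth 0 s i <= sumn s.
Proof. by elim: s i => [|a s IH] [|i] //=; [apply: leq_addr | apply: leq_trans (IH i) (leq_addl _ _)]. Qed.

Definition lamstar := (n - sumn lam) :: lam.
Definition gamstar := (n - sumn gam) :: gam.

(** The part of being a tableau on which [arr] is injective. Over it the remaining requirements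
    translate separately: content into weights and column sums, columns into [rowlat], and row 1
    with the lattice word into [lattice]. *)
Record base_tableau (T : tableau) : Prop := {
  base_shape : [seq size R | R <- T] = size (trow T 0) :: gam;
  base_valid : all valid (flatten T);
  base_sorted : forall r, sorted label_le (trow T r);
  base_size : size (trow T 0) <= n - sumn gam }.

Definition rest (T : tableau) := n - sumn gam - size (trow T 0).

Definition extra T (e : E) (r k : nat) := if [&& e == e0, r == 0 & k == 0] then rest T else 0.

Definition arr (T : tableau) : array :=
  [ffun p : (E * 'I_n) * 'I_n =>
     inord (count_mem (flab p.1.1 p.2) (trow T p.1.2) + extra T p.1.1 p.1.2 p.2)].

Definition cl (T : tableau) (x : letter) := count_mem x (flatten (flatten T)).

Lemma clE T x : cl T x = \sum_(M <- flatten T) count_mem x M.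
Proof. by rewrite /cl count_flatten sumnE big_map. Qed.

(** Labels are nonempty, so there are no more cells than letters. *)
Lemma size_total T : all valid (flatten T) -> has_content lam alpha T ->
  size (trow T 0) <= sumn lam + sumn alpha.
Proof.
move=> vT h; have sM M : valid M -> size M = \sum_(j < n) count_mem (inl (val j) : letter) M +
    \sum_(i < L) count_mem (inr (val i) : letter) M.
  case/andP=> /existsP[[e k] /eqP <-] _ /=; rewrite size_cat size_map.
  congr (_ + _).
    under eq_bigr do rewrite count_cat count_ulab addn0.
    case E1 : (nat_of_ord k) => [|m] /=; first by rewrite big1.
    have lt_m : m < n by have := ltn_ord k; lia.
    rewrite (bigD1 (Ordinal lt_m)) //= eqxx big1 // => j.
    by rewrite -val_eqE /= => ne; case: eqP => // -[em]; rewrite em eqxx in ne.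
  rewrite (eq_bigr (fun i : 'I_L => nat_of_ord (e i))); last first.
    move=> i _; rewrite count_cat count_ulab count_unat_ord.
    by case: (nat_of_ord k).
  rewrite size_sort size_flatten /shape -map_comp sumnE big_map big_enum /=.
  by apply: eq_bigr => i _; rewrite size_nseq.
have -> : sumn lam + sumn alpha = \sum_(M <- flatten T) size M.
  rewrite big_seq (eq_bigr _ (fun M MT => sM M (allP vT M MT))) -big_seq.
  rewrite big_split /=; congr (_ + _); rewrite exchange_big /=.
    rewrite -(sum_nth_sumn (n := n)); last by lia.
    by apply: eq_bigr => j _; rewrite -clE /cl (proj1 (h j)).
  rewrite -(sum_nth_sumn (n := L)) //.
  by apply: eq_bigr => j _; rewrite -clE /cl (proj2 (h j)).
have fT : flatten T = trow T 0 ++ flatten (behead T) by rewrite /trow; case: (T).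
rewrite fT big_cat /=; apply: leq_trans (leq_addr _ _); rewrite -sum1_size.
rewrite big_seq [X in _ <= X]big_seq; apply: leq_sum => M MT.
have : valid M by apply: (allP vT); rewrite fT mem_cat MT.
by case/andP=> _; case: (M).
Qed.

Section Base.

Variable T : tableau.
Hypothesis bT : base_tableau T.

Lemma base_sizeT : size T = (size gam).+1.
Proof. by have := congr1 size (base_shape bT); rewrite size_map. Qed.

Lemma size_trow r : size (trow T r) = if r is r'.+1 then nth 0 gam r' else size (trow T 0).
Proof.
have [lt_r|le_r] := ltnP r (size T).
  by have := congr1 (nth 0 ^~ r) (base_shape bT); rewrite (nth_map [::]) // /trow => ->; case: (r).
rewrite /trow nth_default //; case: r le_r => [|r]; rewrite base_sizeT // ltnS => le_r.
by rewrite nth_default.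
Qed.

Lemma valid_trow r : all valid (trow T r).
Proof.
have [lt_r|le_r] := ltnP r (size T); last by rewrite /trow nth_default.
apply/allP => M MT; apply: (allP (base_valid bT)); apply/flattenP.
by exists (trow T r) => //; apply: mem_nth.
Qed.

Lemma count_nil r : count_mem [::] (trow T r) = 0.
Proof.
apply/count_memPn/negP => /(allP (valid_trow r)).
by rewrite /validl eqxx andbF.
Qed.

Lemma size_trow_le r : size (trow T r) <= n.
Proof.
rewrite size_trow; case: r => [|r]; first by have := base_size bT; lia.
by have := nth_le_sumn gam r; lia.
Qed.

Lemma arrE e (r k : 'I_n) :
  arr T ((e, r), k) = count_mem (flab e k) (trow T r) + extra T e r k :> nat.
Proof.
rewrite ffunE /= inordK // ltnS /extra; case: and3P => [[/eqP-> _ /eqP->]|_].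
  by rewrite /flab ulab_e0 count_nil /rest; lia.
by rewrite addn0; apply: leq_trans (count_size _ _) (size_trow_le r).
Qed.

Lemma sum_arr (r : 'I_n) (F : label -> nat) :
  \sum_(p : E * 'I_n) arr T ((p.1, r), p.2) * F (flab p.1 p.2) =
  \sum_(M <- trow T r) F M + (r == 0 :> nat) * rest T * F [::].
Proof.
rewrite -(sum_flab F (valid_trow r)); under eq_bigr do rewrite arrE mulnDl.
rewrite big_split /=; congr (_ + _); rewrite (bigD1 (e0, o0)) //= big1 ?addn0.
  by rewrite /extra eqxx /flab ulab_e0 /= andbT; case: eqP; rewrite ?mul1n ?mul0n.
move=> [e k] /= ne; rewrite /extra; case: and3P => [[/eqP h1 _ /eqP h2]|//].
by case/eqP: ne; rewrite h1; congr (_, _); apply: val_inj.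
Qed.

Lemma sum_trows (G : label -> nat) :
  \sum_(r < n) \sum_(M <- trow T r) G M = \sum_(M <- flatten T) G M.
Proof.
rewrite big_flatten (big_nth [::]) big_mkord.
have le_s : size T <= n by rewrite base_sizeT; lia.
rewrite (big_ord_widen _ (fun r => \sum_(M <- nth [::] T r) G M) le_s) [RHS]big_mkcond /=.
by apply: eq_bigr => r _; case: ltnP => // le_r; rewrite /trow nth_default // big_nil.
Qed.

Lemma arr_rowsum (r : 'I_n) : colsum (transp (arr T)) r = nth 0 gamstar r.
Proof.
transitivity (\sum_(p : E * 'I_n) arr T ((p.1, r), p.2) * 1).
  by apply: eq_bigr => p _; rewrite transpE muln1.
rewrite (sum_arr r (fun=> 1)) muln1 sum1_size size_trow /gamstar.
case: (nat_of_ord r) => [|r'] /=; last by rewrite mul0n addn0.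
by rewrite mul1n /rest subnKC //; apply: base_size.
Qed.

Lemma arr_sum (F : label -> nat) : F [::] = 0 ->
  \sum_(r < n) \sum_(p : E * 'I_n) arr T ((p.1, r), p.2) * F (flab p.1 p.2) =
  \sum_(M <- flatten T) F M.
Proof.
move=> F0; rewrite -sum_trows; apply: eq_bigr => r _.
by rewrite sum_arr F0 muln0 addn0.
Qed.

Lemma arr_total : \sum_p arr T p = n.
Proof.
transitivity (\sum_(r < n) colsum (transp (arr T)) r).
  rewrite /colsum exchange_big pair_bigA /=.
  rewrite (reindex (fun p : E * 'I_n * 'I_n => ((p.1.1, p.2), p.1.2))) /=.
    by apply: eq_bigr => p _; rewrite transpE.
  by exists (fun p : E * 'I_n * 'I_n => ((p.1.1, p.2), p.1.2)) => -[[? ?] ?].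
under eq_bigr do rewrite arr_rowsum.
rewrite sum_nth_sumn /=; first by lia.
by lia.
Qed.

Lemma arr_weight (j : 'I_L) :
  \sum_e totals (arr T) e * expwt e j = cl T (inr (val j)).
Proof.
rewrite clE -arr_sum // -(eq_bigr _ (fun r _ => pair_bigA _ (fun e k => arr T ((e, r), k) * count_mem (inr (val j) : letter) (flab e k)))).
rewrite exchange_big /=; apply: eq_bigr => e _; rewrite ffunE big_distrl /=.
apply: eq_bigr => r _; rewrite big_distrl /=; apply: eq_bigr => k _; congr (_ * _).
rewrite /flab count_cat count_ulab count_unat_ord.
by have -> : count_mem (inr (val j) : letter) (bar k) = 0 by case: (nat_of_ord k).
Qed.

Lemma arr_col (k : 'I_n) j : k = j.+1 :> nat -> colsum (arr T) k = cl T (inl j).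
Proof.
move=> ek; rewrite clE -arr_sum // /colsum.
rewrite (eq_bigr (fun x : E * 'I_n => nat_of_ord (arr T ((x.1, x.2), k)))); last by case.
rewrite -(pair_bigA _ (fun e r => nat_of_ord (arr T ((e, r), k)))) exchange_big /=.
apply: eq_bigr => r _.
rewrite -(pair_bigA _ (fun e k => arr T ((e, r), k) * count_mem (inl j : letter) (flab e k))) /=.
apply: eq_bigr => e _; rewrite (bigD1 k) //= /flab count_cat count_ulab ek /= eqxx !addn0 muln1.
rewrite big1 ?addn0 // => k' ne; rewrite count_cat count_ulab addn0.
case E1 : (nat_of_ord k') => [|m] /=; first by rewrite muln0.
case: eqP => [[em]|]; last by rewrite !addn0 muln0.
by case/eqP: ne; apply: val_inj; rewrite /= E1 ek em.
Qed.

Lemma cl_out_inr j : L <= j -> cl T (inr j) = 0.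
Proof.
move=> le_j; rewrite clE big_seq big1 // => M /(allP (base_valid bT)).
case/andP=> /existsP[[e k] /eqP <-] _; rewrite count_cat count_ulab count_unat big1.
  by case: (nat_of_ord k).
by move=> i _; case: eqP => // h; have := ltn_ord i; rewrite h ltnNge le_j.
Qed.

Lemma cl_out_inl j : n <= j.+1 -> cl T (inl j) = 0.
Proof.
move=> le_j; rewrite clE big_seq big1 // => M /(allP (base_valid bT)).
case/andP=> /existsP[[e k] /eqP <-] _; rewrite count_cat count_ulab addn0 /=.
case E1 : (nat_of_ord k) => [//|m] /=; case: eqP => // -[em].
by have := ltn_ord k; rewrite E1 em ltnNge le_j.
Qed.

Lemma content_arr : has_content lam alpha T <->
  weighted (@expwt alpha b) (@alphafun alpha) (totals (arr T)) /\
  [forall k : 'I_n, colsum (arr T) k == partfun lamstar k].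
Proof.
split=> [h|[/forallP h1 /forallP h2] j]; last first.
  split; last first.
    have [lt_j|le_j] := ltnP j L; last by rewrite nth_default // -/(cl T _) cl_out_inr.
    by have := h1 (Ordinal lt_j); rewrite arr_weight => /eqP.
  have [lt_j|le_j] := ltnP j.+1 n; last first.
    rewrite -/(cl T _) cl_out_inl // nth_default //; lia.
  by have := h2 (Ordinal lt_j); rewrite (@arr_col _ j) // => /eqP.
split; first by apply/forallP => j; rewrite arr_weight /cl (proj2 (h _)).
have hk (k : 'I_n) : k != o0 -> colsum (arr T) k = partfun lamstar k.
  case E1 : (nat_of_ord k) => [|j] ne; first by case/eqP: ne; apply: val_inj.
  by rewrite (arr_col E1) /cl (proj1 (h j)) /partfun E1.
(* Cells without a bar are not recorded in the content. Both families of column sums add up to n,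
   which determines the sum of column 0. *)
apply/forallP => k; have [->|/hk-> //] := eqVneq k o0.
have s1 : \sum_k colsum (arr T) k = n.
  rewrite -[RHS]arr_total /colsum exchange_big pair_bigA; by apply: eq_bigr => -[].
have s2 : \sum_(k < n) partfun lamstar k = n by rewrite sum_nth_sumn /=; lia.
have s1' : colsum (arr T) o0 + \sum_(k < n | k != o0) partfun lamstar k = n.
  by rewrite -[RHS]s1 [RHS](bigD1 o0) //=; congr (_ + _); apply/esym/eq_bigr.
have s2' : partfun lamstar o0 + \sum_(k < n | k != o0) partfun lamstar k = n.
  by rewrite -[RHS]s2 [RHS](bigD1 o0).
by apply/eqP; apply: (@addIn (\sum_(k < n | k != o0) partfun lamstar k)); rewrite s1' s2'.
Qed.

Lemma code_nil : code [::] = 0.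
Proof.
have := codeE e0 o0; rewrite /flab ulab_e0 /= => ->.
by rewrite /lexpos /= urank_e0.
Qed.

Lemma code_lt M : valid M -> code M < #|{: E * 'I_n}|.
Proof. by case/andP=> /existsP[[e k] /eqP <-] _; rewrite codeE; apply: eposL. Qed.

Lemma code_gt0 M : valid M -> 0 < code M.
Proof.
move=> vM; rewrite lt0n; apply/negP => /eqP h; case/andP: (vM) => /existsP[[e k] /eqP eM] /eqP; apply.
have ek : code (flab e k) = code (flab e0 o0) by rewrite eM h /flab ulab_e0 code_nil.
move: ek; rewrite !codeE => /eposI[e1 e2].
by rewrite -eM /= e1 e2 /flab ulab_e0.
Qed.

Lemma label_lt_code M N : valid M -> valid N -> label_lt M N = (code M < code N).
Proof.
move=> vM vN; rewrite /label_lt (code_le vM vN) ltn_neqAle; congr (~~ _ && _).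
by apply/eqP/eqP => [->|/code_inj->].
Qed.

Lemma psum_arr (r : 'I_n) t : t <= #|{: E * 'I_n}| ->
  psum (natof epos (transp (arr T)) ^~ r) t =
  count (fun M => code M < t) (trow T r) + (r == 0 :> nat) * rest T * (0 < t).
Proof.
move=> le_t; rewrite (psum_col eposI eposL) // big_mkcond.
transitivity (\sum_(p : E * 'I_n) arr T ((p.1, r), p.2) * (code (flab p.1 p.2) < t)).
  apply: eq_bigr => -[e k] _; rewrite transpE codeE /=.
  by case: ifP; rewrite ?muln1 ?muln0.
rewrite (sum_arr r (fun M => (code M < t) : nat)) code_nil; congr (_ + _).
by rewrite -sum1_count [RHS]big_mkcond; apply: eq_bigr => M _; case: ifP.
Qed.

Lemma size_trow_decr r : 0 < r -> size (trow T r.+1) <= size (trow T r).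
Proof.
case: r => // r _; rewrite !size_trow; apply: sorted_geq_nth => //.
by case/andP: pgam.
Qed.

Lemma entry_valid r p : p < size (trow T r) -> valid (entry T r p).
Proof. by move=> lt_p; apply: (allP (valid_trow r)); apply: mem_nth. Qed.

Definition consec_columns :=
  forall r, 0 < r -> forall p, p < size (trow T r.+1) -> code (entry T r p) < code (entry T r.+1 p).

(** The bottom row lies strictly to the right of column gam_1, so none of its cells is below another
    cell. The higher rows shrink upwards, so a column is contiguous and comparing neighbouring rows
    is enough. *)
Lemma columns_consec : columns_strictly_increase gam T <-> consec_columns.
Proof.
split=> [h r r_gt0 p lt_p|h].
  have lt_p' := leq_trans lt_p (size_trow_decr r_gt0).
  rewrite -label_lt_code ?entry_valid //; apply: h => //.
  by rewrite /column; case: r r_gt0 {lt_p lt_p'}.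
move=> i1 i2 k1 k2 lt_i lt_k1 lt_k2; rewrite /column; case: i1 lt_i lt_k1 => [|i1] lt_i lt_k1.
  rewrite /= gtn_eqF // => e; move: lt_k2; rewrite -e size_trow.
  case: (i2) lt_i => // r _; have srt : sorted geq gam by case/andP: pgam.
  by have := sorted_geq_nth srt (leq0n r); rewrite nth0 -/(first_part gam); lia.
rewrite (gtn_eqF (leq_ltn_trans (leq0n _) lt_i)) /= => e; subst k2.
rewrite label_lt_code ?entry_valid //; rewrite -(subnKC lt_i) in lt_k2 *.
elim: (i2 - i1.+2) lt_k2 => [|d IH]; first by rewrite addn0; apply: h.
rewrite addnS => lt_k2; apply: (ltn_trans (IH _)); last by apply: h.
by apply: leq_trans lt_k2 (size_trow_decr _).
Qed.

Lemma dominance_row r : 0 < r ->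
  (forall p, p < size (trow T r.+1) -> code (entry T r p) < code (entry T r.+1 p)) <->
  (forall x, count (fun M => code M <= x) (trow T r.+1) <= count (fun M => code M < x) (trow T r)).
Proof.
move=> r_gt0; have srt q : sorted leq [seq code M | M <- trow T q].
  rewrite sorted_map; apply: (sub_in_sorted _ (valid_trow q)) (base_sorted bT q).
  by move=> M N /= vM vN; rewrite (code_le vM vN).
have := sorted_dominance (srt r) (srt r.+1); rewrite !size_map => /(_ (size_trow_decr r_gt0)) [h1 h2].
split=> [h x|h p lt_p].
  have := h1 _ x; rewrite !count_map; apply => p lt_p.
  rewrite (nth_map [::]) ?(nth_map [::]) //; first exact: h.
  exact: leq_trans lt_p (size_trow_decr r_gt0).
have := h2 _ p lt_p; rewrite (nth_map [::]) ?(nth_map [::]) //.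
  by apply=> x; rewrite !count_map; apply: h.
exact: leq_trans lt_p (size_trow_decr r_gt0).
Qed.

(** The array also compares row 0 with row 1. For t > 0 the empty labels of row 0 already outnumber
    the cells of row 1, and for t = 0 nothing in row 1 is counted because its labels are
    nonempty. *)
Lemma rowlat_columns : size (trow T 0) <= sumn lam + sumn alpha ->
  rowlat (@urank alpha b) (arr T) <-> consec_columns.
Proof.
move=> hs0; rewrite -(lattice_transp (@urank_inj alpha b) (@urank_lt alpha b)).
have row_out r : n <= r.+1 -> trow T r.+1 = [::].
  by move=> le_r; apply: size0nil; rewrite size_trow nth_default //; lia.
split=> [/forallP la r r_gt0|h].
  have [lt_r|le_r] := ltnP r.+1 n; last by rewrite row_out.
  apply/(dominance_row r_gt0) => x; have [lt_x|le_x] := ltnP x #|{: E * 'I_n}|.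
    have /forallP/(_ (Ordinal (ltnW lt_r))) := la (Ordinal lt_x).
    rewrite /viol -leqNgt /= (psum_arr (Ordinal lt_r)) // (psum_arr (Ordinal (ltnW lt_r))) ?(ltnW lt_x) //.
    by rewrite /= gtn_eqF // !mul0n !addn0.
  apply: leq_trans (count_size _ _) _; apply: leq_trans (size_trow_decr r_gt0) _.
  rewrite -(count_predT (trow T r)) leq_eqVlt; apply/orP; left; apply/eqP.
  by apply: eq_in_count => M /(allP (valid_trow r))/code_lt/leq_trans/(_ le_x) ->.
apply/forallP => -[t lt_t]; apply/forallP => r; rewrite /viol -leqNgt /=.
have [lt_r|le_r] := ltnP r.+1 n; last first.
  by rewrite {1}/psum big1 // => i _; rewrite natof_rect ?le_r ?orbT //; apply: eposL.
have -> : psum (natof epos (transp (arr T)) ^~ r.+1) t.+1 =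
    count (fun M => code M < t.+1) (trow T r.+1).
  by rewrite (psum_arr (Ordinal lt_r)) // mul0n addn0.
rewrite psum_arr ?(ltnW lt_t) //; case: (posnP r) => [r0|r_gt0].
  rewrite r0 mul1n; case: (posnP t) => [->|t_gt0].
    rewrite (_ : count _ (trow T 1) = 0) //; apply/eqP; rewrite -leqn0 leqNgt -has_count.
    apply/hasPn => M /(allP (valid_trow 1))/code_gt0; by rewrite ltnS -ltnNge.
  rewrite muln1; apply: leq_trans (count_size _ _) _; apply: leq_trans (leq_addl _ _).
  by rewrite size_trow /rest; have := nth_le_sumn gam 0; lia.
have /(dominance_row r_gt0)/(_ t) := h r r_gt0.
move/leq_trans; apply; exact: leq_addr.
Qed.

(** With t standing for (e, r), this is the contribution of row r to the word of the unbarred part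
    e. Rows are read from right to left, which makes it weakly decreasing. *)
Definition chunk (t : nat) : seq nat :=
  flatten [seq bars M | M <- rev (trow T (t %% n)) & unbarred_part M == nth [::] S0 (t %/ n)].

Lemma flab_eqE (e e' : E) k k' : (flab e k == flab e' k') = (e == e') && (k == k').
Proof.
apply/eqP/andP => [h|[/eqP-> /eqP->]//].
have := congr1 unbarred_part h; rewrite !unbarred_flab => /ulab_inj->; split=> //.
by have := congr1 bars h; rewrite !bars_flab; case: k k' {h} => [|k] [|k'] // [->].
Qed.

Lemma count_chunk t j : t < #|{: E * 'I_n}| -> count_mem j (chunk t) = natof epos (arr T) t j.+1.
Proof.
move=> lt_t; have [[e r] <-] := pos_surj eposI eposL lt_t.
rewrite /chunk epos_mod epos_div nth_S0 /= count_flatten sumnE -map_comp big_map big_filter.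
rewrite (perm_big _ (permEl (perm_rev _))) /=.
have -> : \sum_(M <- trow T r | unbarred_part M == ulab e) count_mem j (bars M) =
    count_mem (flab e j.+1) (trow T r).
  rewrite -sum1_count big_mkcond [RHS]big_mkcond /= big_seq [RHS]big_seq.
  apply: eq_bigr => M /(allP (valid_trow r))/andP[/existsP[[e' k'] /eqP <-] _] /=.
  rewrite unbarred_flab bars_flab (inj_eq (@ulab_inj alpha b)) flab_eqE.
  case: eqP => //= _; case: (nat_of_ord k') => [|m] //=.
  by rewrite addn0 eqSS; case: eqP.
have [lt_j|le_j] := ltnP j.+1 n.
  by rewrite (natofE eposI _ _ (Ordinal lt_j)) arrE /extra /= !andbF addn0.
rewrite natof_rect ?le_j ?orbT //; last exact: eposL.
apply/count_memPn/negP => /(allP (valid_trow r))/andP[/existsP[[e' k'] /=]].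
rewrite flab_eqE => /andP[_ /eqP h] _; have := ltn_ord k'.
by rewrite h ltnNge le_j.
Qed.

Lemma chunk_sorted t : sorted geq (chunk t).
Proof.
rewrite /chunk; move: (t %% n) (nth _ _ _) => r U.
have pw R : all valid R -> sorted label_le R ->
    pairwise leq (flatten [seq bars M | M <- R & unbarred_part M == U]).
  elim: R => //= M R IH /andP[vM vR] srt; case: ifP => [/eqP uM|_] /=; last exact: IH (path_sorted srt).
  rewrite pairwise_cat IH ?(path_sorted srt) // andbT.
  case/andP: vM => /existsP[[e k] /eqP eM] _; rewrite /= in eM.
  rewrite -eM bars_flab; case Ek : (nat_of_ord k) => [|m] //=; rewrite !andbT.
  rewrite allrel1l; apply/allP => y /flattenP[s /mapP[N]].
  rewrite mem_filter => /andP[/eqP uN NR] -> {s}; have leMN := allP (order_path_min label_le_trans srt) N NR.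
  case/andP: (allP vR N NR) => /existsP[[e' k'] /eqP eN] _; rewrite /= in eN.
  have ee : e' = e by apply: (@ulab_inj alpha b); rewrite -(unbarred_flab e' k') -(unbarred_flab e k) eN eM uN uM.
  move: leMN; rewrite -eM -eN ee flab_le /lexpos /= leq_add2l bars_flab Ek.
  by case: (nat_of_ord k') => [|m'] //= le_m; rewrite inE => /eqP->.
have revb M : valid M -> rev (bars M) = bars M.
  by case/andP=> /existsP[[e k] /eqP <-] _; rewrite bars_flab; case: (nat_of_ord _).
have -> : flatten [seq bars M | M <- rev (trow T r) & unbarred_part M == U] =
    rev (flatten [seq bars M | M <- trow T r & unbarred_part M == U]).
  rewrite rev_flatten filter_rev map_rev; congr (flatten (rev _)); rewrite -map_comp.
  apply/eq_in_map => M; rewrite mem_filter => /andP[_ /(allP (valid_trow r))].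
  by move/revb.
rewrite rev_sorted; have -> : sorted (fun y x => geq x y) =1 sorted leq by [].
by rewrite (sorted_pairwise leq_trans); apply: pw (valid_trow r) (base_sorted bT r).
Qed.

Lemma read_word_chunks i :
  read_word T (nth [::] S0 i) = flatten [seq chunk (i * n + r) | r <- iota 0 n].
Proof.
rewrite /read_word /reading.
have -> : flatten [seq rev R | R <- T] = flatten [seq rev (trow T r) | r <- iota 0 n].
  have le_s : size T <= n by rewrite (base_sizeT); lia.
  rewrite -(subnKC le_s) iotaD map_cat flatten_cat add0n.
  rewrite [X in _ = _ ++ X](_ : _ = [::]) ?cats0.
    by congr flatten; rewrite -[in LHS](mkseq_nth [::] T) /mkseq -map_comp.
  apply/nilP; rewrite /nilp size_flatten /shape -map_comp sumnE big_map big1_seq //= => r.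
  by rewrite mem_iota => /andP[le_r _]; rewrite size_rev /trow nth_default.
rewrite filter_flatten flatten_map_flatten -!map_comp; congr flatten.
apply/eq_in_map => r; rewrite mem_iota /= add0n => lt_r.
by rewrite /chunk modnMDl modn_small // divnMDl // divn_small // addn0.
Qed.

(** An unbarred part that does not occur in T contributes nothing, so the word may be taken over all
    possible parts; the empty one has rank 0 and is read first. Parts before rows is the order of
    [lexpos]. *)
Lemma word_chunks :
  read_word T [::] ++ flatten [seq read_word T U | U <- unbarred_parts T] =
  flatten [seq chunk t | t <- iota 0 #|{: E * 'I_n}|].
Proof.
rewrite card_prod card_ord flatten_iotaM.
rewrite -(eq_map read_word_chunks).
have -> : [seq read_word T (nth [::] S0 i) | i <- iota 0 #|E|] = [seq read_word T U | U <- S0].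
  by rewrite -[in RHS](mkseq_nth [::] S0) /mkseq -map_comp size_S0.
have hd : nth [::] S0 0 = [::] by rewrite -(urank_e0 alpha b) nth_S0 ulab_e0.
have sz : 0 < size S0 by rewrite size_S0; apply: leq_ltn_trans (urank_lt e0).
case ES : S0 sz hd => [|U0 S1] //= _ U00; subst U0; congr (_ ++ _).
pose occ := [seq U <- [seq unbarred_part M | M <- flatten T] | U != [::]].
rewrite -(@flatten_map_filter _ _ (mem occ) _ S1); last first.
  move=> U US; rewrite inE => nU; rewrite /read_word.
  have nU0 : U != [::] by apply: contraTneq US => ->; have := uniq_S0 alpha b; rewrite ES => /andP[].
  have -> : [seq M <- reading T | unbarred_part M == U] = [::].
    rewrite -(filter_pred0 (reading T)); apply: eq_in_filter => M MT; apply/negP => /eqP eU.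
    case/negP: nU; rewrite mem_filter nU0 /= -eU; apply: map_f.
    by move: MT => /flattenP[s /mapP[R RT ->]]; rewrite mem_rev => MR; apply/flattenP; exists R.
  by [].
congr (flatten (map _ _)); have srt0 : sorted label_le S0 by apply: sort_sorted; apply: label_le_total.
apply: (sorted_eq label_le_trans label_le_anti).
- by apply: sort_sorted; apply: label_le_total.
- by rewrite ES in srt0; apply: sorted_filter (path_sorted srt0); apply: label_le_trans.
have unS1 : uniq S1 by have := uniq_S0 alpha b; rewrite ES => /andP[].
rewrite perm_sort; apply: uniq_perm; rewrite ?undup_uniq ?filter_uniq // => U.
rewrite mem_undup -/occ [in RHS]mem_filter -[mem occ U]/(U \in occ).
case: (boolP (U \in occ)) => //= Uocc; apply/esym.
move: Uocc; rewrite mem_filter => /andP[ne /mapP[M MT eU]].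
case/andP: (allP (base_valid bT) M MT) => /existsP[[e k] /eqP eM] _.
have : U \in S0 by rewrite eU -eM unbarred_flab mem_S0.
by rewrite ES inE (negbTE ne).
Qed.

(** Among the columns of actual bars the array conditions are those of the reading word at the ends
    of chunks. At t = 0 the conditions for all k together forbid bottom row labels that consist of a
    bar alone. Bar 1 against no bar at t > 0 is automatic, because the empty labels outnumber all
    bars 1. *)
Lemma lattice_arr : size (trow T 0) <= sumn lam + sumn alpha -> has_content lam alpha T ->
  lattice epos (arr T) <->
  all (fun M : label => ~~ all barred M) (trow T 0) /\ lattice_tableau T.
Proof.
move=> hs0 hc; pose A := natof epos (arr T).
have csE i j : i <= #|{: E * 'I_n}| ->
    count_mem j (flatten (take i [seq chunk t | t <- iota 0 #|{: E * 'I_n}|])) = psum (A^~ j.+1) i.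
  move=> le_i; rewrite -map_take take_iota (minn_idPl le_i).
  rewrite count_flatten sumnE -map_comp big_map iota0_index big_mkord.
  by apply: eq_bigr => t _; apply: count_chunk; apply: leq_trans le_i.
have words : lattice_tableau T <-> forall i j, i < #|{: E * 'I_n}| ->
    psum (A^~ j.+2) i.+1 <= psum (A^~ j.+1) i.
  rewrite /lattice_tableau word_chunks.
  have sc : all (sorted geq) [seq chunk t | t <- iota 0 #|{: E * 'I_n}|].
    by apply/allP => _ /mapP[t _ ->]; apply: chunk_sorted.
  have [h1 h2] := lattice_chunks sc.
  rewrite size_map size_iota in h1 h2; split=> [h i j lt_i|h].
    by have := h1 h i j lt_i; rewrite !csE // ltnW.
  by apply: h2 => i j lt_i; rewrite !csE ?h // ltnW.
have A0 k : 0 < k -> A 0 k = count_mem (flab e0 k) (trow T 0).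
  move=> k_gt0; have ep0 : epos (e0, o0) = 0 by rewrite /lexpos /= urank_e0.
  rewrite /A -{1}ep0; have [lt_k|le_k] := ltnP k n.
    by rewrite (natofE eposI _ _ (Ordinal lt_k)) arrE /extra /= gtn_eqF // !andbF addn0.
  rewrite natof_rect ?le_k ?orbT //; last exact: eposL.
  apply/esym/count_memPn/negP => /(allP (valid_trow 0))/andP[/existsP[[e' k'] /=]].
  rewrite flab_eqE => /andP[_ /eqP h] _; have := ltn_ord k'.
  by rewrite h ltnNge le_k.
have row1E : all (fun M : label => ~~ all barred M) (trow T 0) <-> forall k, 0 < k -> A 0 k = 0.
  split=> [/allP h k k_gt0|h].
    rewrite A0 //; apply/count_memPn/negP => /h; rewrite /flab ulab_e0 cats0.
    by case: (k) k_gt0.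
  apply/allP => M MT; case/andP: (allP (valid_trow 0) M MT) => /existsP[[e k] /eqP eM] ne.
  apply/negP => bM; have ee : e = e0.
    apply: (@ulab_inj alpha b); rewrite ulab_e0; move: bM; rewrite -eM /= /flab all_cat => /andP[_].
    by have := ulab_unbarred e; case: (ulab e) => //= x s /andP[nb _] /andP[b' _]; rewrite b' in nb.
  have k_gt0 : 0 < k.
    by rewrite lt0n; apply: contra ne => /eqP k0; rewrite -eM /= flab_nil ee k0 !eqxx.
  have := h _ k_gt0; rewrite A0 // => /eqP; rewrite -leqn0 leqNgt -has_count has_pred1.
  by move: MT; rewrite -eM /= ee => ->.
have N_gt0 : 0 < #|{: E * 'I_n}| by apply: leq_ltn_trans (eposL (e0, o0)).
split=> [/forallP la|[/row1E h1 /words h2]].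
  have la' t k : t < #|{: E * 'I_n}| -> psum (A^~ k.+1) t.+1 <= psum (A^~ k) t.
    move=> lt_t; have [lt_k|le_k] := ltnP k n.
      by have /forallP/(_ (Ordinal lt_k)) := la (Ordinal lt_t); rewrite /viol -leqNgt.
    rewrite {1}/psum big1 // => i _; rewrite /A natof_rect ?(leqW le_k) ?orbT //; exact: eposL.
  split; last by apply/words => i j; apply: la'.
  apply/row1E => -[|k] // _; have := la' 0 k N_gt0.
  by rewrite psumS !psum0 leqn0 => /eqP.
apply/forallP => -[t lt_t]; apply/forallP => -[[|k] lt_k]; rewrite /viol -leqNgt /= -/A; last exact: h2.
case: (posnP t) => [->|t_gt0]; first by rewrite psumS psum0 h1.
have [lt_1|] := ltnP 1 n; last by lia.
apply: leq_trans (leq_psum _ lt_t) _.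
rewrite -(colsumE eposI eposL (arr T) (Ordinal lt_1)) (@arr_col _ 0) // /cl (proj1 (hc 0)).
apply: leq_trans (leq_psum _ t_gt0); rewrite psumS psum0 add0n.
have -> : A 0 0 = rest T.
  have ep0 : epos (e0, o0) = 0 by rewrite /lexpos /= urank_e0.
  by rewrite /A -{1}ep0 (natofE eposI _ _ o0) arrE /flab ulab_e0 -[bar _ ++ _]/([::] : label) count_nil /extra eqxx.
by have := nth_le_sumn lam 0; rewrite /rest; lia.
Qed.

End Base.

Local Notation kron := (kron_array (@urank alpha b) (@expwt alpha b) (@alphafun alpha)
  (@partfun n lamstar) (@partfun n gamstar)).

Lemma kron_base T : base_tableau T -> kron (arr T) <->
  [/\ has_content lam alpha T, columns_strictly_increase gam T,
      all (fun M : label => ~~ all barred M) (trow T 0) & lattice_tableau T].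
Proof.
move=> bT; rewrite /kron_array arr_total // eqxx /=.
have -> : [forall k, colsum (transp (arr T)) k == partfun gamstar k].
  by apply/forallP => r; rewrite arr_rowsum.
rewrite andbT -[X in _ && (_ && (rowlat _ (transp X) && _))](transpK (arr T)).
have latE : rowlat (@urank alpha b) (transp (arr T)) = lattice epos (arr T).
  by rewrite -(lattice_transp (@urank_inj alpha b) (@urank_lt alpha b)) transpK.
rewrite transpK latE; split.
  case/and4P=> hw hr hl hcol; have hc : has_content lam alpha T by apply/(content_arr bT).
  have hs := size_total (base_valid bT) hc; have /(lattice_arr bT hs hc)[r1 la] := hl.
  by split=> //; apply/(columns_consec bT)/(rowlat_columns bT hs).
case=> hc hcol r1 la; have [hw hcl] := (content_arr bT).1 hc; have hs := size_total (base_valid bT) hc.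
rewrite hw hcl andbT /=; apply/andP; split.
  by apply/(rowlat_columns bT hs)/(columns_consec bT).
by apply/(lattice_arr bT hs hc).
Qed.

Lemma has_shapeE T : has_shape gam T <-> [seq size R | R <- T] = size (trow T 0) :: gam.
Proof.
split=> [[r le_r e]|e]; first by rewrite e; case: T e => //= R T [-> _].
by exists (first_part gam + size (trow T 0)); rewrite ?leq_addr // addnC addnK.
Qed.

Lemma MCT_base T : MCT gam lam alpha T -> base_tableau T.
Proof.
case=> /has_shapeE shT /allP labT rowT _ hc _.
have vT : all valid (flatten T).
  apply/allP => M MT; have sub x : count_mem x M <= cl T x.
    rewrite /cl count_flatten sumnE big_map (big_rem M) //=; exact: leq_addr.
  apply: label_validl => // [||j]; first exact: labT.
    move=> j jM; have : 0 < nth 0 lam j.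
      rewrite -(proj1 (hc j)); apply: leq_trans (sub (inl j)).
      by rewrite -has_count has_pred1.
    by case: (ltnP j (size lam)) => [|le_j]; [lia | rewrite nth_default].
  apply: leq_trans (sub (inr j)) _; rewrite /cl (proj2 (hc j)).
  by case: ltnP => [lt_j|le_j]; [apply/alpha_le/mem_nth | rewrite nth_default].
have srt r : sorted label_le (trow T r).
  rewrite (sorted_pairwise label_le_trans); apply/(pairwiseP [::]) => i j.
  rewrite !inE => lt_i lt_j lt_ij; exact: rowT.
have sT := size_total vT hc.
by split=> //; lia.
Qed.

Lemma MCT_kron T : MCT gam lam alpha T -> lattice_tableau T -> kron (arr T).
Proof.
move=> mT la; have bT := MCT_base mT; apply/(kron_base bT).
by case: mT => _ _ _ hcol hc r1; split.
Qed.

Lemma kron_MCT T : base_tableau T -> kron (arr T) -> MCT gam lam alpha T /\ lattice_tableau T.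
Proof.
move=> bT /(kron_base bT)[hc hcol r1 la]; split=> //; split=> //.
- by apply/has_shapeE/(base_shape bT).
- by apply/allP => M /(allP (base_valid bT)); apply: validl_label.
- move=> i k1 k2 lt_k lt_s; have := base_sorted bT i.
  rewrite (sorted_pairwise label_le_trans) => /(pairwiseP [::]); apply; rewrite ?inE //.
  exact: ltn_trans lt_s.
Qed.

Lemma arr_inj T T' : base_tableau T -> base_tableau T' -> arr T = arr T' -> T = T'.
Proof.
move=> bT bT' eT; apply: (@eq_from_nth _ [::]); first by rewrite !base_sizeT.
rewrite base_sizeT // => r lt_r; have lt_rn : r < n by lia.
rewrite -/(trow T r) -/(trow T' r).
apply: (sorted_eq label_le_trans label_le_anti); try exact: base_sorted.
apply/allP => M; rewrite mem_cat => MT; have vM : valid M.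
  by case/orP: MT; apply: (allP (valid_trow _ _)).
case/andP: vM => /existsP[[e k] /eqP <-]; rewrite /= flab_nil => ne.
have := congr1 (fun a : array => nat_of_ord (a ((e, Ordinal lt_rn), k))) eT.
rewrite /= !arrE // /extra; suff -> : [&& e == e0, r == 0 & nat_of_ord k == 0] = false.
  by rewrite !addn0 => ->.
by apply: contraNF ne => /and3P[-> _ ->].
Qed.

Definition tabcnt (a : array) (e : E) (r : nat) (k : 'I_n) : nat :=
  if insub r is Some r' then a ((e, r'), k) else 0.

Definition tabrow (a : array) (r : nat) : seq label :=
  sort label_le (flatten [seq nseq (tabcnt a p.1 r p.2) (flab p.1 p.2) |
    p : E * 'I_n <- enum {: E * 'I_n} & flab p.1 p.2 != [::]]).

(** The inverse of [arr] on the arrays of interest: empty labels are dropped, and the rows beyond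
    the shape have sum 0. *)
Definition tab (a : array) : tableau := [seq tabrow a r | r <- iota 0 (size gam).+1].

Lemma tabcntE a e (r : 'I_n) k : tabcnt a e r k = a ((e, r), k).
Proof. by rewrite /tabcnt insubT // => lt_r; congr (nat_of_ord (a ((_, _), _))); apply: val_inj. Qed.

Lemma sum_tabrow (a : array) r (F : label -> nat) :
  \sum_(M <- tabrow a r) F M =
  \sum_(p : E * 'I_n | flab p.1 p.2 != [::]) tabcnt a p.1 r p.2 * F (flab p.1 p.2).
Proof.
rewrite (perm_big _ (permEl (perm_sort _ _))) big_flatten big_map big_filter big_enum_cond /=.
by apply: eq_bigr => p _; rewrite big_nseq iter_addn_0 mulnC.
Qed.

Lemma count_tabrow (a : array) r e k : flab e (nat_of_ord k) != [::] ->
  count_mem (flab e (nat_of_ord k)) (tabrow a r) = tabcnt a e r k.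
Proof.
move=> ne; rewrite -sum1_count big_mkcond (sum_tabrow _ _ (fun M => if M == flab e k then 1 else 0)).
rewrite (bigD1 (e, k)) //= eqxx muln1 big1 ?addn0 // => -[e' k'] /= /andP[_ ne'].
case: eqP => [/flab_inj h|]; last by rewrite muln0.
by rewrite h eqxx in ne'.
Qed.

Lemma trow_tab a r : r < (size gam).+1 -> trow (tab a) r = tabrow a r.
Proof. by move=> lt_r; rewrite /trow (nth_map 0) ?size_iota // nth_iota. Qed.

Lemma tab_base a : kron a -> base_tableau (tab a) /\ arr (tab a) = a.
Proof.
case/and3P=> _ _ /and4P[rl _ _ /forallP cg].
have rowS (r : 'I_n) : \sum_(p : E * 'I_n) a ((p.1, r), p.2) = nth 0 gamstar r.
  by rewrite -[RHS](eqP (cg r)); apply: eq_bigr => p _; rewrite transpE.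
have zero (r : 'I_n) : 0 < r -> a ((e0, r), o0) = 0 :> nat.
  by move=> r_gt0; apply: (rowlat_zero rl).
have sz (r : 'I_n) : size (tabrow a r) + a ((e0, r), o0) = nth 0 gamstar r.
  rewrite -rowS -sum1_size (sum_tabrow _ _ (fun=> 1)) [RHS](bigD1 (e0, o0)) //= addnC; congr (_ + _).
  apply: eq_big => [[e k]|[e k] _] /=; last by rewrite tabcntE muln1.
  by rewrite flab_nil xpair_eqE -(inj_eq val_inj k).
have szS r : r < size gam -> size (tabrow a r.+1) = nth 0 gam r.
  move=> lt_r; have lt_rn : r.+1 < n by lia.
  by have := sz (Ordinal lt_rn); rewrite zero // addn0.
have shT : [seq size R | R <- tab a] = size (trow (tab a) 0) :: gam.
  rewrite trow_tab // /tab -map_comp /=; congr (_ :: _).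
  apply: (@eq_from_nth _ 0); first by rewrite size_map size_iota.
  rewrite size_map size_iota => r lt_r; rewrite (nth_map 0) ?size_iota // nth_iota //=.
  exact: szS.
have sz0 := sz o0; rewrite /= in sz0.
have bT : base_tableau (tab a).
  split=> //.
  - apply/allP => M /flattenP[R /mapP[r _ ->]]; rewrite mem_sort => /flattenP[s /mapP[p]].
    rewrite mem_filter => /andP[ne _] ->; rewrite mem_nseq => /andP[_ /eqP->].
    by rewrite /validl ne andbT; apply/existsP; exists p.
  - move=> r; have [lt_r|le_r] := ltnP r (size gam).+1.
      by rewrite trow_tab //; apply: sort_sorted; apply: label_le_total.
    by rewrite /trow nth_default // size_map size_iota.
  - by rewrite trow_tab //; lia.
split=> //; apply/ffunP => -[[e r] k]; apply: val_inj; rewrite /= arrE //.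
have [lt_r|le_r] := ltnP r (size gam).+1; last first.
  have g0 : nth 0 gamstar r = 0 by rewrite nth_default.
  have a0 : a ((e, r), k) = 0 :> nat.
    apply/eqP; rewrite -leqn0 -g0 -rowS (bigD1 (e, k)) //=; exact: leq_addr.
  rewrite a0 /trow nth_default ?size_map ?size_iota // /extra.
  by case: and3P => [[_ /eqP r0 _]|//]; rewrite r0 in le_r.
rewrite trow_tab //; have [/eqP h|ne] := boolP (flab e k == [::]); last first.
  rewrite count_tabrow // tabcntE /extra; case: and3P => [[h1 _ h2]|_]; last by rewrite addn0.
  by rewrite flab_nil h1 h2 in ne.
move/eqP: (h); rewrite flab_nil => /andP[/eqP he /eqP hk].
have -> : k = o0 by apply: val_inj.
have -> : nat_of_ord o0 = 0 by [].
rewrite he /flab ulab_e0 /=.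
have -> : count_mem [::] (tabrow a r) = 0 by rewrite -trow_tab // (count_nil bT).
rewrite /extra eqxx /= andbT add0n; case: (posnP r) => [r0|r_gt0]; last first.
  by rewrite zero //; case: eqP => // r0; rewrite r0 in r_gt0.
have -> : r = o0 by apply: val_inj.
by rewrite /rest trow_tab // -sz0 addKn.
Qed.

Lemma tableau_count : exists2 Lt : {fset tableau},
  (forall T : tableau, T \in Lt <-> MCT gam lam alpha T /\ lattice_tableau T)
  & #|` Lt|%fset = #|[set a : array | kron a]|.
Proof.
exists [fset T in [seq tab a | a <- enum [set a : array | kron a]]]%fset.
  move=> T; rewrite in_fset /=; split=> [/mapP[a]|[mT la]].
    rewrite mem_enum inE => ka ->; have [bT ea] := tab_base ka.
    by apply: kron_MCT => //; rewrite ea.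
  have kT := MCT_kron mT la; apply/mapP; exists (arr T); first by rewrite mem_enum inE.
  have [bT ea] := tab_base kT; apply: arr_inj => //; exact: MCT_base.
rewrite card_fseq undup_id; first by rewrite size_map -cardE.
rewrite map_inj_in_uniq ?enum_uniq // => a a'; rewrite !mem_enum !inE => ka ka' e.
by rewrite -(tab_base ka).2 e (tab_base ka').2.
Qed.

End Arrays.

Local Open Scope ring_scope.

(** * Symmetric families *)

Definition mnmext n (m : 'X_{1..n}) : 'X_{1..n.+1} :=
  [multinom (if unlift ord_max i is Some j then m j else 0%N) | i < n.+1].

Lemma mcoeff_restrictX n (m' : 'X_{1..n.+1}) (m : 'X_{1..n}) :
  (restrict_last 'X_[m'])@_m = (m' == mnmext m)%:R.
Proof.
have wE (i : 'I_n) : widen_ord (leqnSn n) i = lift ord_max i.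
  by apply: val_inj; rewrite /= /bump leqNgt ltn_ord.
rewrite /restrict_last comp_mpolyX big_ord_recr /= tnth_mktuple unlift_none.
rewrite (eq_bigr (fun i : 'I_n => 'X_i ^+ m' (widen_ord (leqnSn n) i))); last first.
  by move=> i _; rewrite tnth_mktuple wE liftK.
pose m2 := [multinom m' (widen_ord (leqnSn n) i) | i < n].
have -> : \prod_(i < n) 'X_i ^+ m' (widen_ord (leqnSn n) i) = 'X_[m2] :> {mpoly rat[n]}.
  by rewrite mpolyXE_id; apply: eq_bigr => i _; rewrite mnmE.
rewrite expr0n; have [m0|m0] := eqVneq (m' ord_max) 0%N; last first.
  rewrite mulr0 mcoeff0; case: eqP => // e; case/eqP: m0.
  by rewrite e mnmE unlift_none.
rewrite mulr1 mcoeffX; congr ((nat_of_bool _)%:R); apply/eqP/eqP => [<-|e].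
  apply/mnmP => i; rewrite mnmE; case: unliftP => [j|] ->; last by [].
  by rewrite mnmE wE.
by apply/mnmP => i; rewrite mnmE e mnmE wE liftK.
Qed.

Lemma mcoeff_restrict n (p : {mpoly rat[n.+1]}) m : (restrict_last p)@_m = p@_(mnmext m).
Proof.
rewrite /restrict_last comp_mpolyEX raddf_sum /=.
rewrite (eq_bigr (fun m' => if m' == mnmext m then p@_(mnmext m) else 0)); last first.
  move=> m' _; rewrite mcoeffZ [X in _ * X]mcoeff_restrictX.
  by case: eqP => [->|_]; rewrite ?mulr1 ?mulr0.
have [mp|mp] := boolP (mnmext m \in msupp p).
  rewrite (bigD1_seq (mnmext m)) ?msupp_uniq //= eqxx big1 ?addr0 // => i /negbTE ne.
  by rewrite ne.
by rewrite big1_seq ?memN_msupp_eq0 // => m' /andP[_ m'p]; case: eqP => // e; rewrite -e m'p in mp.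
Qed.

Lemma mcoeff_hsym k n m : (hsym k n)@_m = (mdeg m == k)%:R.
Proof.
rewrite /hsym raddf_sum /=; under eq_bigr do rewrite mcoeffX.
have [dm|dm] := eqVneq (mdeg m) k; last first.
  by rewrite big1 // => m' /eqP dm'; case: eqP => // e; rewrite -e dm' eqxx in dm.
have lt_m : (mdeg m < k.+1)%N by rewrite dm.
rewrite (bigD1 (BMultinom lt_m)) /= ?dm // eqxx big1 ?addr0 // => m' /andP[_ ne].
by case: eqP => // e; case/eqP: ne; apply: val_inj.
Qed.

Definition symfam (F : forall n, {mpoly rat[n]}) : Prop :=
  [/\ forall n, F n \is symmetric, forall n, restrict_last (F n.+1) = F n
    & exists d : nat, forall n, (msize (F n) <= d)%N].

Lemma symfam_symfun (f : symfun) : symfam f.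
Proof. by case: f => F h1 h2 h3; split. Qed.

Lemma symfam_hsym k : symfam (hsym k).
Proof.
split=> [n|n|].
- by apply/issymP => s; apply/mpolyP => m; rewrite mcoeff_sym !mcoeff_hsym mdeg_mperm.
- apply/mpolyP => m; rewrite mcoeff_restrict !mcoeff_hsym !mdegE big_ord_recr /=.
  rewrite mnmE unlift_none addn0; congr ((nat_of_bool (_ == _))%:R).
  apply: eq_bigr => i _; rewrite mnmE; set j := widen_ord _ _.
  have -> : j = lift ord_max i by apply: val_inj; rewrite /= /bump leqNgt ltn_ord.
  by rewrite liftK.
- exists k.+1 => n; apply: (leq_trans (mmeasure_sum _ _ _ _)).
  by apply/bigmax_leqP => m /eqP dm; rewrite msizeX dm.
Qed.

Lemma eq_symfam F G : (forall n, F n = G n) -> symfam F -> symfam G.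
Proof.
move=> e [h1 h2 [d h3]]; split=> [n|n|]; first by rewrite -e.
  by rewrite -!e.
by exists d => n; rewrite -e.
Qed.

Lemma symfam0 : symfam (fun n => 0).
Proof.
by split=> [n|n|]; rewrite ?rpred0 ?/restrict_last ?comp_mpoly0 //; exists 0%N => n; rewrite mmeasure0.
Qed.

Lemma symfam1 : symfam (fun n => 1).
Proof.
by split=> [n|n|]; rewrite ?rpred1 ?/restrict_last ?comp_mpoly1 //; exists 1%N => n; rewrite msize1.
Qed.

Lemma symfamD F G : symfam F -> symfam G -> symfam (fun n => F n + G n).
Proof.
move=> [f1 f2 [d f3]] [g1 g2 [d' g3]]; split=> [n|n|]; first by rewrite rpredD ?f1 ?g1.
  by rewrite -(f2 n) -(g2 n) /restrict_last comp_mpolyD.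
by exists (maxn d d') => n; apply: (leq_trans (mmeasureD_le _ _ _)); rewrite geq_max !leq_max f3 g3 orbT.
Qed.

Lemma symfamM F G : symfam F -> symfam G -> symfam (fun n => F n * G n).
Proof.
move=> [f1 f2 [d f3]] [g1 g2 [d' g3]]; split=> [n|n|]; first by rewrite rpredM ?f1 ?g1.
  by rewrite -(f2 n) -(g2 n) /restrict_last rmorphM.
exists (d + d').+1 => n; apply: (leq_trans (msizeM_le _ _)).
by rewrite ltnS leq_add.
Qed.

Lemma symfamZ c F : symfam F -> symfam (fun n => c *: F n).
Proof.
move=> [f1 f2 [d f3]]; split=> [n|n|]; first by rewrite rpredZ ?f1.
  by rewrite -(f2 n) /restrict_last comp_mpolyZ.
by exists d => n; apply: (leq_trans (msizeZ_le _ _)).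
Qed.

Lemma symfam_sum (I : Type) (r : seq I) (F : I -> forall n, {mpoly rat[n]}) :
  (forall i, symfam (F i)) -> symfam (fun n => \sum_(i <- r) F i n).
Proof.
move=> h; elim: r => [|i r IH].
  by apply: eq_symfam symfam0 => n; rewrite big_nil.
by apply: eq_symfam (symfamD (h i) IH) => n; rewrite big_cons.
Qed.

Lemma symfam_prod (I : Type) (r : seq I) (F : I -> forall n, {mpoly rat[n]}) :
  (forall i, symfam (F i)) -> symfam (fun n => \prod_(i <- r) F i n).
Proof.
move=> h; elim: r => [|i r IH].
  by apply: eq_symfam symfam1 => n; rewrite big_nil.
by apply: eq_symfam (symfamM (h i) IH) => n; rewrite big_cons.
Qed.

(** The bound d on the degree is uniform in n, so for large n there are enough cycle types to kill
    the component; the components in fewer variables follow by restriction. *)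
Lemma symfam_vanish F n0 : symfam F ->
  (forall mu, is_part mu -> (n0 <= part_size mu)%N ->
     mmap (ratr : rat -> algC) (fun i => nth 0 (Xi mu) i) (F (part_size mu)) = 0) ->
  forall n, F n = 0.
Proof.
move=> [f1 f2 [d f3]] h.
have big n : (n0 + d * d * d + d < n)%N -> F n = 0.
  move=> lt_n; apply: (@sympoly_vanish d n) => //; first by lia.
  by move=> mu pmu smu; have := h mu pmu; rewrite smu; apply; lia.
have down k n : F (n + k)%N = 0 -> F n = 0.
  elim: k n => [|k IH] n; first by rewrite addn0.
  rewrite addnS -addSn => /IH e; rewrite -f2 e.
  by rewrite /restrict_last comp_mpoly0.
by move=> n; apply: (down (n0 + d * d * d + d).+1); apply: big; lia.
Qed.

Lemma cycle_type_part n (w : 'S_n) : is_part (cycle_type w) /\ part_size (cycle_type w) = n.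
Proof.
split.
  apply/andP; split; first by apply: sort_sorted => x y; apply: leq_total.
  rewrite mem_sort; apply/mapP => -[X]; rewrite mem_enum => /imsetP[x _ ->] /esym/eqP.
  by rewrite cards_eq0 => /eqP e; have := porbit_id w x; rewrite e inE.
rewrite /part_size sumnE (perm_big _ (permEl (perm_sort _ _))) big_map big_enum /=.
rewrite -[RHS]card_ord -sum1_card (partition_big (porbit w) (mem (porbits w))) /=; last first.
  by move=> x _; apply: imset_f.
apply: eq_bigr => O /imsetP[x0 _ ->]; rewrite -sum1_card; apply: eq_bigl => x.
by rewrite -eq_porbit_mem eq_sym.
Qed.

(** * Partitions *)

Lemma part_nth_eq s t : is_part s -> is_part t ->
  (forall j, nth 0%N s j = nth 0%N t j) -> s = t.
Proof.
have aux u v : is_part u -> (forall j, nth 0%N u j = nth 0%N v j) -> (size u <= size v)%N.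
  case/andP=> _ nu e; rewrite leqNgt; apply/negP => lt; case/negP: nu.
  by rewrite -[X in X \in _](nth_default 0%N (leqnn (size v))) -e mem_nth.
move=> ps pt e; apply: (@eq_from_nth _ 0%N) => [|j _]; last exact: e.
by apply/eqP; rewrite eqn_leq !aux.
Qed.

Definition pospart (s : seq nat) : seq nat := [seq x <- s | (0 < x)%N].

Lemma nth_pospart s j : sorted geq s -> nth 0%N (pospart s) j = nth 0%N s j.
Proof.
elim: s j => // a s IH j; rewrite /= => srt; case: ifP => [a_gt0|/negbT].
  by case: j => //= j; apply: IH; apply: path_sorted srt.
rewrite -eqn0Ngt => /eqP a0; rewrite a0 in srt *.
have /all_pred1P -> : all (pred1 0%N) s.
  have := order_path_min (fun x y z h1 h2 => leq_trans h2 h1) srt.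
  by apply: sub_all => x /=; rewrite leqn0.
by rewrite /pospart filter_nseq /= nth_nil; case: j => //= j; rewrite nth_nseq if_same.
Qed.

Lemma pospart_part s : sorted geq s -> is_part (pospart s).
Proof.
move=> srt; rewrite /is_part mem_filter ltnn andbT; apply: sorted_filter srt.
by move=> x y z h1 h2; apply: leq_trans h2 h1.
Qed.

Lemma sumn_pospart s : sumn (pospart s) = sumn s.
Proof. by elim: s => //= a s IH; case: (posnP a) => [->|a_gt0] /=; rewrite ?a_gt0 /= IH. Qed.

Section FunSeq.

Variables (n : nat) (f : 'I_n -> nat).

Definition funseq := [seq f j | j <- enum 'I_n].

Lemma size_funseq : size funseq = n. Proof. by rewrite size_map size_enum_ord. Qed.

Lemma nth_funseq (j : 'I_n) : nth 0%N funseq j = f j.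
Proof. by rewrite (nth_map j) ?size_enum_ord // nth_ord_enum. Qed.

Lemma sumn_funseq : sumn funseq = (\sum_j f j)%N.
Proof. by rewrite sumnE big_map big_enum. Qed.

Lemma sorted_funseq : decr f -> sorted geq funseq.
Proof.
move=> df; apply/(sortedP 0%N) => i; rewrite size_funseq => lt_i.
have lt_i' : (i < n)%N by lia.
have := nth_funseq (Ordinal lt_i); have := nth_funseq (Ordinal lt_i') => /= -> ->.
by apply: df => /=.
Qed.

End FunSeq.

(** Partitions of size at most B have at most B parts, each at most B, so they all arise from
    functions on ['I_B] by dropping zeros. *)
Lemma parts_le B : exists G : {fset partition_type},
  forall nu : partition_type, (nu \in G) = (sumn (val nu) <= B)%N.
Proof.
pose toseq (g : {ffun 'I_B -> 'I_B.+1}) := pospart (funseq (natfun g)).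
pose l := pmap (fun g => insub (toseq g) : option partition_type) (enum {ffun 'I_B -> 'I_B.+1}).
exists [fset nu in l | (sumn (val nu) <= B)%N]%fset => nu.
rewrite !inE /=; apply/andP/idP => [[]//|le_nu]; split=> //.
have pnu := valP nu; have sz : (size (val nu) <= B)%N.
  by apply: leq_trans le_nu; apply: size_part_le.
have ltB j : (nth 0%N (val nu) j < B.+1)%N.
  have [lt_j|le_j] := ltnP j (size (val nu)); last by rewrite nth_default.
  rewrite ltnS; apply: leq_trans le_nu; rewrite -(sum_nth_sumn (leqnn _)).
  by rewrite (bigD1 (Ordinal lt_j)) //= leq_addr.
pose g : {ffun 'I_B -> 'I_B.+1} := [ffun j : 'I_B => inord (nth 0%N (val nu) j)].
have dg : decr (natfun g).
  move=> i j le_ij; rewrite !ffunE !inordK //; apply: sorted_geq_nth => //.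
  by case/andP: pnu.
have srt := sorted_funseq dg.
have e : toseq g = val nu.
  apply: part_nth_eq => //; first exact: pospart_part.
  move=> j; rewrite nth_pospart //; have [lt_j|le_j] := ltnP j B.
    by have /= -> := nth_funseq (natfun g) (Ordinal lt_j); rewrite ffunE inordK.
  by rewrite !nth_default ?size_funseq //; apply: leq_trans le_j.
rewrite mem_pmap; apply/mapP; exists g; first by rewrite mem_enum.
by rewrite e valK.
Qed.

Lemma sum_tail n x (s : seq nat) : (size s < n)%N ->
  (\sum_(r < n | (0 < r)%N) nth 0%N (x :: s) r = sumn s)%N.
Proof.
case: n => // n lt_s; rewrite big_mkcond big_ord_recl /= add0n.
by rewrite -(sum_nth_sumn lt_s); apply: eq_bigr => i _.
Qed.

(** Removing the first part of a partition of n leaves nu, and the removed part is n - |nu|. So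
    testing against all X_delta is testing against the characters of the basis elements. *)
Lemma ordpart_star n (delta : 'I_n -> nat) : (0 < n)%N -> decr delta -> (\sum_j delta j = n)%N ->
  exists nu : partition_type, (size (val nu) < n)%N /\
    forall j : 'I_n, nth 0%N (gamstar (val nu) n) j = delta j.
Proof.
case: n delta => // n delta _ dd sd.
have srt := sorted_funseq dd; have ss := sumn_funseq delta; have sz := size_funseq delta.
have nE := nth_funseq delta; move: (funseq delta) srt ss sz nE => [|x s] //= srt ss [sz] nE; rewrite sd in ss.
have srs := path_sorted srt.
exists (Sub (pospart s) (pospart_part srs)); rewrite SubK; split.
  by rewrite size_filter ltnS -sz count_size.
move=> j; rewrite -nE /gamstar sumn_pospart.
by case: (nat_of_ord j) => [|i] /=; [lia | rewrite nth_pospart].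
Qed.

Lemma eq_spechtX n (lam mu : 'I_n -> nat) : lam =1 mu -> spechtX lam = spechtX mu.
Proof.
move=> e; apply: eq_theta => M; apply: eq_bigl => s; apply: eq_forallb => j.
by rewrite e.
Qed.

Lemma gamstar_part nu n : is_part nu -> (sumn nu + sumn nu < n)%N ->
  is_part (gamstar nu n) /\ sumn (gamstar nu n) = n.
Proof.
move=> pnu lt_n; split; last by rewrite /= subnK //; lia.
case/andP: (pnu) => srt nz; rewrite /is_part inE negb_or nz andbT; apply/andP; split; last by lia.
by case: nu srt {pnu nz} lt_n => //= a s -> ; rewrite andbT; lia.
Qed.

(** Above the bottom row no label is empty, so each of these cells uses up a barred or an unbarred
    letter, of which there are |lam| + |alpha|. This makes the expansion finite. *)
Lemma kron_tail alpha b n lam (delta : 'I_n -> nat)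
    (a : {ffun (expvec alpha b * 'I_n) * 'I_n -> 'I_n.+1}) : (size lam < n)%N ->
  kron_array (@urank alpha b) (@expwt alpha b) (@alphafun alpha)
    (@partfun n (lamstar lam n)) delta a ->
  (\sum_(r < n | (0 < r)%N) delta r <= sumn lam + sumn alpha)%N.
Proof.
move=> lt_lam /and3P[_ /forallP wt /and4P[rl _ /forallP cl /forallP cg]].
pose w (x : expvec alpha b * 'I_n) := ((0 < x.2) + \sum_j expwt x.1 j)%N.
have le1 : (\sum_(r < n | (0 < r)%N) delta r <=
    \sum_(r < n) \sum_x a ((x.1, r), x.2) * w x)%N.
  rewrite big_mkcond; apply: leq_sum => r _; case: ifP => // r_gt0.
  rewrite -(eqP (cg r)); apply: leq_sum => -[e k] _; rewrite transpE /=.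
  have [w0|w_gt0] := posnP (w (e, k)); last by rewrite leq_pmulr.
  move/eqP: w0; rewrite /w addn_eq0 sum_nat_eq0 /= => /andP[/eqP k0 /forallP e0E].
  have -> : e = e0 alpha b.
    by apply/ffunP => j; apply: val_inj; rewrite ffunE /=; apply/eqP; have := e0E j.
  by rewrite (rowlat_zero rl) //; move: k0; case: (nat_of_ord k).
apply: leq_trans le1 _; rewrite exchange_big /=.
under eq_bigr do rewrite -big_distrl /= /w mulnDr.
rewrite big_split /= leq_add //.
  rewrite -(sum_tail (n - sumn lam)%N lt_lam) [X in (_ <= X)%N]big_mkcond /=.
  rewrite -(pair_bigA _ (fun e k => (\sum_(r < n) a ((e, r), k)) * (0 < nat_of_ord k))%N) /= exchange_big /=.
  apply: leq_sum => k _; rewrite -big_distrl /=.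
  have -> : (\sum_e \sum_(r < n) a ((e, r), k) = nth 0 (lamstar lam n) k)%N.
    by rewrite -[RHS](eqP (cl k)) pair_bigA; apply: eq_bigr => -[].
  by case: ifP => _; rewrite ?muln1 ?muln0.
rewrite -(pair_bigA _ (fun e k => (\sum_(r < n) a ((e, r), k)) * \sum_j expwt e j)%N) /=.
rewrite -(sum_nth_sumn (leqnn (size alpha))).
rewrite (eq_bigr (fun e => \sum_j totals a e * expwt e j)%N); last first.
  by move=> e _; rewrite -big_distrl -big_distrr /= ffunE exchange_big.
rewrite exchange_big /=; apply: leq_sum => j _.
by rewrite (eqP (wt j)).
Qed.

(** * Expansion in the irreducible character basis *)

Definition starX n nu : 'CF([set: 'S_n]) := spechtX (@partfun n (gamstar nu n)).

Definition starsum n (c : {fsfun partition_type -> rat with 0}) : 'CF([set: 'S_n]) :=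
  \sum_(nu <- finsupp c) ratr (c nu) *: starX n (val nu).

(** Orthonormality of the X_delta picks out one term. The size bound on the support makes every n -
    |nu| a true first part, so distinct nu give distinct partitions of n. *)
Lemma starsum_dot n (c : {fsfun partition_type -> rat with 0}) (nu0 : partition_type)
    (delta : 'I_n -> nat) : decr delta -> (\sum_j delta j = n)%N -> (size (val nu0) < n)%N ->
  (forall j : 'I_n, nth 0%N (gamstar (val nu0) n) j = delta j) ->
  (forall nu, nu \in finsupp c -> (sumn (val nu) + sumn (val nu) < n)%N) ->
  '[starsum n c, spechtX delta] = ratr (c nu0).
Proof.
move=> dd sd lt0 e0 small; rewrite /starsum cfdot_suml.
rewrite (eq_big_seq (fun nu => if nu == nu0 then ratr (c nu0) else 0)); last first.
  move=> nu nuc; rewrite cfdotZl; case: eqP => [->|ne].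
    by rewrite /starX (eq_spechtX e0) spechtX_norm // mulr1.
  have [pnu snu] := gamstar_part (valP nu) (small _ nuc).
  have [/eqP->|nz] := boolP ('[starX n (val nu), spechtX delta] == 0); first by rewrite mulr0.
  have eqn := spechtX_orth (partfun_decr pnu) dd nz.
  case: ne; apply: val_inj; apply: part_nth_eq (valP nu) (valP nu0) _ => j.
  have [lt_j|le_j] := ltnP j.+1 n.
    have := eqn (Ordinal lt_j); have := e0 (Ordinal lt_j) => /= <-.
    by rewrite /partfun.
  have := size_part_le pnu snu; rewrite /= => lt_nu.
  by rewrite !nth_default // -ltnS; apply: leq_trans le_j.
case: finsuppP => [|nuc]; last first.
  rewrite (bigD1_seq nu0) ?fset_uniq //= eqxx big1 ?addr0 // => nu /negbTE ne.
  by rewrite ne.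
by move=> nuc; rewrite big1_seq ?rmorph0 // => nu /andP[_ h]; case: eqP => // en; rewrite -en h in nuc.
Qed.

Lemma st_starX nu (f : symfun) mu (w : 'S_(part_size mu)) : is_part nu -> is_stilde nu f ->
  is_part mu -> cycle_type w = mu -> (sumn nu + sumn nu < part_size mu)%N ->
  mmap (ratr : rat -> algC) (fun i => nth 0 (Xi mu) i) (f (part_size mu)) =
  starX (part_size mu) nu w.
Proof.
move=> pnu stf pmu cw lt_n; have [pn sn] := gamstar_part pnu lt_n.
rewrite -[LHS]/(eval_Xi f mu) (stf (part_size mu) _ mu pmu erefl w cw).
  by rewrite /starX -(irr_char_SnE pn sn).
have : (first_part nu <= sumn nu)%N by case: nu {pnu stf lt_n pn sn} => //= a s; apply: leq_addr.
by rewrite /part_size in lt_n *; lia.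
Qed.

Lemma expansion_eval (st : partition_type -> symfun)
    (st_char : forall nu : partition_type, is_stilde (val nu) (st nu))
    (c : {fsfun partition_type -> rat with 0}) mu (w : 'S_(part_size mu)) :
  is_part mu -> cycle_type w = mu ->
  (forall nu, nu \in finsupp c -> (sumn (val nu) + sumn (val nu) < part_size mu)%N) ->
  mmap (ratr : rat -> algC) (fun i => nth 0 (Xi mu) i)
    (\sum_(nu <- finsupp c) c nu *: st nu (part_size mu)) = starsum (part_size mu) c w.
Proof.
move=> pmu cw small; rewrite raddf_sum /= /starsum sum_cfunE.
apply: eq_big_seq => nu nuc; rewrite mmapZ cfunE; congr (_ * _).
exact: (st_starX (valP nu) (st_char nu) pmu cw (small _ nuc)).
Qed.

(** Evaluated at the permutations of one large n, two expansions of the same family give the same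
    class function, and its inner products recover each coefficient. *)
Lemma expansion_uniq (st : partition_type -> symfun)
    (st_char : forall nu : partition_type, is_stilde (val nu) (st nu)) F
    (c c' : {fsfun partition_type -> rat with 0}) :
  is_expansion st F c -> is_expansion st F c' -> c' = c.
Proof.
move=> eF eF'; apply/fsfunP => nu0.
pose sz (l : seq partition_type) := (\sum_(nu <- l) sumn (val nu))%N.
have le_sz (l : seq partition_type) nu : nu \in l -> (sumn (val nu) <= sz l)%N.
  by move=> nl; rewrite /sz (big_rem nu) //= leq_addr.
(* [m] bounds the size of every partition in sight, so n = 2m + 2 makes each (n - |nu|, nu) a
   partition. *)
pose m := (sz (finsupp c) + sz (finsupp c') + sumn (val nu0))%N.
pose n := (m + m).+2.
have small (d : {fsfun partition_type -> rat with 0}) : (sz (finsupp d) <= m)%N ->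
    forall nu, nu \in finsupp d -> (sumn (val nu) + sumn (val nu) < n)%N.
  move=> le_d nu /le_sz h; have h' := leq_trans h le_d.
  by apply: leq_ltn_trans (leq_add h' h') _; rewrite /n ltnS leqnSn.
have s1 := small c; have s2 := small c'.
have {}s1 := s1 ltac:(rewrite /m; lia); have {}s2 := s2 ltac:(rewrite /m; lia).
have lt0 : (sumn (val nu0) + sumn (val nu0) < n)%N by rewrite /n /m; lia.
have [p0 q0] := gamstar_part (valP nu0) lt0.
have sz0 : (size (val nu0) < n)%N by have := size_part_le p0 q0.
have e : starsum n c = starsum n c'.
  apply/cfunP => w; have [pmu smu] := cycle_type_part w.
  have [mu cw] : exists mu, cycle_type w = mu by exists (cycle_type w).
  rewrite cw in pmu smu.
  move: n smu w cw s1 s2 {small lt0 p0 q0 sz0} => n0 smu; case: n0 / smu => w cw s1 s2.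
  by rewrite -(expansion_eval st_char pmu cw s1) -(expansion_eval st_char pmu cw s2) -(eF (part_size mu)) -(eF' (part_size mu)).
have d0 := partfun_decr (n := n) p0; have t0 := partfun_sum p0 q0.
have h1 := starsum_dot d0 t0 sz0 (fun=> erefl) s1.
have h2 := starsum_dot d0 t0 sz0 (fun=> erefl) s2.
suff : ratr (c' nu0) = ratr (c nu0) :> algC by apply: fmorph_inj.
by rewrite -h1 -h2 e.
Qed.

Section Coefficients.

Variables (alpha lam : seq nat).
Hypothesis plam : is_part lam.

Local Notation b := (sumn alpha).
Local Notation Bd := (sumn lam + sumn alpha)%N.

Let alpha_le a : a \in alpha -> (a <= b)%N.
Proof.
by elim: alpha => // x s IH; rewrite inE => /orP[/eqP->|/IH h] /=; [apply: leq_addr | apply: leq_trans h (leq_addl _ _)].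
Qed.

Definition kcount n (delta : 'I_n -> nat) : nat :=
  #|[set a | kron_array (@urank alpha b) (@expwt alpha b) (@alphafun alpha)
       (@partfun n (lamstar lam n)) delta a]|.

Lemma eq_kcount n (delta delta' : 'I_n -> nat) : delta =1 delta' -> kcount delta = kcount delta'.
Proof.
move=> e; apply: eq_card => a; rewrite !inE /kron_array; do 5!congr (_ && _).
by apply: eq_forallb => r; rewrite e.
Qed.

Definition stable_size (nu : seq nat) :=
  (sumn nu + sumn nu + sumn lam + sumn lam + sumn alpha + 2)%N.

Definition mult nu : nat := kcount (@partfun (stable_size nu) (gamstar nu (stable_size nu))).

Lemma mult_tableaux nu : is_part nu -> exists2 L : {fset tableau},
  (forall T : tableau, T \in L <-> MCT nu lam alpha T /\ lattice_tableau T)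
  & mult nu = #|` L|%fset.
Proof.
move=> pnu; have [L hL cL] := tableau_count plam pnu alpha_le (leqnn (stable_size nu)).
by exists L; rewrite ?cL.
Qed.

(** Both counts equal the number of the same tableaux, whose definition does not involve n. *)
Lemma kcount_stable n nu : is_part nu -> (stable_size nu <= n)%N ->
  kcount (@partfun n (gamstar nu n)) = mult nu.
Proof.
move=> pnu le_n; have [L hL ->] := mult_tableaux pnu.
have [L' hL' cL'] := tableau_count plam pnu alpha_le le_n.
rewrite /kcount -cL'; congr (#|` _|%fset); apply/fsetP => T.
by apply/idP/idP => [/hL'/hL|/hL/hL'].
Qed.

Lemma kcount_large n (delta : 'I_n -> nat) : (size lam < n)%N ->
  (Bd < \sum_(r < n | (0 < r)%N) delta r)%N -> kcount delta = 0%N.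
Proof.
move=> lt_n big; apply/eqP; rewrite cards_eq0; apply/eqP/setP => a; rewrite !inE.
by apply/negP => /(kron_tail lt_n); rewrite leqNgt big.
Qed.

Let size_lam : (size lam <= sumn lam)%N. Proof. exact: size_part_le. Qed.

Lemma mult_large nu : is_part nu -> (Bd < sumn nu)%N -> mult nu = 0%N.
Proof.
move=> pnu big; have sz : (size nu <= sumn nu)%N by exact: size_part_le.
apply: kcount_large; first by rewrite /stable_size; lia.
by rewrite [X in (_ < X)%N]sum_tail // /stable_size; lia.
Qed.

Lemma mult_fsfun : exists c : {fsfun partition_type -> rat with 0},
  (forall nu : partition_type, c nu = (mult (val nu))%:R) /\
  (forall nu, nu \in finsupp c -> (sumn (val nu) <= Bd)%N).
Proof.
have [G hG] := parts_le Bd.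
exists [fsfun nu in G => (mult (val nu))%:R | 0].
have cE nu : [fsfun nu in G => (mult (val nu))%:R | 0] nu = (mult (val nu))%:R :> rat.
  rewrite fsfunE hG; case: leqP => // big.
  by rewrite mult_large //; apply: valP.
split=> // nu; rewrite mem_finsupp cE; apply: contraNT; rewrite -ltnNge => big.
by rewrite mult_large //; apply: valP.
Qed.

Variable c : {fsfun partition_type -> rat with 0}.
Hypothesis cE : forall nu : partition_type, c nu = (mult (val nu))%:R.
Hypothesis c_supp : forall nu, nu \in finsupp c -> (sumn (val nu) <= Bd)%N.

(** The difference [phi] is orthogonal to every X_delta, hence to every class function on words;
    being a combination of such functions itself, it has norm 0. The bound on n exceeds
    [stable_size nu] whenever |nu| is at most |lam| + |alpha|, and for larger nu both counts
    vanish. *)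
Lemma kronecker_expansion n : (Bd + Bd + Bd + Bd + 2 <= n)%N ->
  thetaH n (@expwt alpha b) (@alphafun alpha) * starX n lam = starsum n c.
Proof.
move=> le_n; apply/eqP; rewrite -subr_eq0; set phi := _ - _.
have n_gt0 : (0 < n)%N by lia.
have small nu : nu \in finsupp c -> (sumn (val nu) + sumn (val nu) < n)%N by move/c_supp; lia.
have [pl sl] : is_part (lamstar lam n) /\ sumn (lamstar lam n) = n by apply: gamstar_part => //; lia.
have dl := partfun_decr pl.
have orth (delta : {ffun 'I_n -> 'I_n.+1}) : decr (natfun delta) -> (\sum_k delta k = n)%N ->
    '[spechtX (natfun delta), phi] = 0.
  move=> dd sd; have [nu [lt_nu nuE]] := ordpart_star n_gt0 dd sd.
  apply/eqP; rewrite cfdotC conjC_eq0 /phi cfdotBl (starsum_dot dd sd lt_nu nuE small).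
  rewrite /starX (kronecker (@urank_inj alpha b) (@urank_lt alpha b)) //.
  rewrite cE ratr_nat -[X in X%:R - _]/(kcount (natfun delta)).
  have -> : kcount (natfun delta) = mult (val nu); last by rewrite subrr.
  have [le_nu|big] := leqP (sumn (val nu)) Bd.
    rewrite -(@kcount_stable n _ (valP nu)); last by rewrite /stable_size; lia.
    by apply: eq_kcount => j; rewrite -nuE.
  rewrite mult_large //; last exact: valP.
  apply: kcount_large; first by lia.
  by under eq_bigr do rewrite -nuE; rewrite sum_tail.
have th := theta_orth orth.
rewrite -cfnorm_eq0 {1}/phi cfdotBl /thetaH /starX /spechtX theta_mul th.
rewrite cfdot_suml big1 ?subrr // => nu _.
by rewrite cfdotZl /starX /spechtX th mulr0.
Qed.

(** Every large mu is the cycle type of [rotperm], where both sides evaluate to values of the same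
    class function; vanishing of the difference at all large mu then gives the identity in every
    number of variables. *)
Lemma hsym_expansion (st : partition_type -> symfun)
    (st_char : forall nu : partition_type, is_stilde (val nu) (st nu)) (ell : partition_type) :
  val ell = lam ->
  is_expansion st (fun n => (\prod_(a <- alpha) hsym a n) * st ell n) c.
Proof.
move=> ellE n; apply/eqP; rewrite -subr_eq0; apply/eqP; move: n.
have fam : symfam (fun n => \prod_(a <- alpha) hsym a n * st ell n -
    \sum_(nu <- finsupp c) c nu *: st nu n).
  apply: (@eq_symfam (fun n => (\prod_(a <- alpha) hsym a n) * st ell n +
    (-1) *: (\sum_(nu <- finsupp c) c nu *: st nu n))); first by move=> n; rewrite scaleN1r.
  apply: symfamD; first apply: symfamM.
  - by apply: symfam_prod => a; apply: symfam_hsym.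
  - exact: symfam_symfun.
  - apply: symfamZ; apply: (@symfam_sum _ (finsupp c) (fun nu n => c nu *: st nu n)) => nu.
    by apply: symfamZ; apply: symfam_symfun.
apply: (symfam_vanish (n0 := (Bd + Bd + Bd + Bd + 2)%N) fam) => mu pmu le_n.
have cw := cycle_type_rot pmu.
rewrite raddfB /= (expansion_eval st_char pmu cw); last by move=> nu /c_supp; lia.
rewrite rmorphM /= (hprod_eval pmu cw erefl alpha_le).
rewrite (@st_starX (val ell) _ _ (rotperm mu)) //; first last.
- by rewrite ellE; lia.
- exact: valP.
by rewrite -kronecker_expansion // cfmulE ellE subrr.
Qed.

End Coefficients.

Theorem mainTheorem1 (st : partition_type -> symfun)
    (st_char : forall nu : partition_type, is_stilde (val nu) (st nu))
    (lam gam : partition_type)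
    (alpha : seq nat) (alpha_comp : 0%N \notin alpha) :
  exists c : {fsfun partition_type -> rat with 0},
    [/\ is_expansion st
          (fun n => (\prod_(a <- alpha) hsym a n) * st lam n) c,
        (forall c' : {fsfun partition_type -> rat with 0},
          is_expansion st
            (fun n => (\prod_(a <- alpha) hsym a n) * st lam n) c' -> c' = c)
      & exists2 L : {fset tableau},
          (forall T : tableau,
            T \in L <-> MCT (val gam) (val lam) alpha T /\ lattice_tableau T)
        & c gam = (#|` L|%fset)%:R].
Proof.
have [c [cE c_supp]] := mult_fsfun alpha (valP lam).
have ec := hsym_expansion (valP lam) cE c_supp st_char (erefl (val lam)).
exists c; split=> //; first by move=> c'; apply: expansion_uniq.
have [L hL mL] := mult_tableaux alpha (valP lam) (valP gam).
by exists L => //; rewrite cE mL.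
Qed.
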